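(* Let $a,b,c$ be positive integers and let the half-full plane partition $H$, the statistic $n(P)=|P\setminus H|$, and the numbers $B(\cdot,\cdot,\cdot)$ and $SC(\cdot,\cdot,\cdot)$ be as defined in the context. Then the sum $$\sum_{P}(-1)^{n(P)},$$ taken over all self-complementary plane partitions $P$ in the $a\times b\times c$ box, equals, up to sign, $$B\left(\tfrac a2,\tfrac b2,\tfrac c2\right)\quad\text{if $a,b,c$ are even,}$$ $$SC\left(\tfrac a2,\tfrac{b+1}2,\tfrac{c-1}2\right)\,SC\left(\tfrac a2,\tfrac{b-1}2,\tfrac{c+1}2\right)\quad\text{if $a$ is even and $b,c$ are odd,}$$ $$SC\left(\tfrac{a+1}2,\tfrac b2,\tfrac c2\right)\,SC\left(\tfrac{a-1}2,\tfrac b2,\tfrac c2\right)\quad\text{if $a$ is odd and $b,c$ are even.}$$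
   Context: A plane partition is a finite set $P$ of points $(i,j,k)$ with positive integer coordinates such that $(i,j,k)\in P$ and $1\le i'\le i$, $1\le j'\le j$, $1\le k'\le k$ imply $(i',j',k')\in P$. Points of $P$ are called cubes. $P$ is contained in the $a\times b\times c$ box if $i\le a$, $j\le b$, $k\le c$ for all $(i,j,k)\in P$. A plane partition $P$ contained in the $a\times b\times c$ box is self-complementary if for all $1\le i\le a$, $1\le j\le b$, $1\le k\le c$: $(i,j,k)\in P \Leftrightarrow (a+1-i,b+1-j,c+1-k)\notin P$. The half-full plane partition $H$ in the box is $H=\{(i,j,k): 1\le i\le a/2,\ 1\le j\le b,\ 1\le k\le c\}$ if $a$ is even, and $H=\{(i,j,k):1\le i\le a,\ 1\le j\le b/2,\ 1\le k\le c\}$ if $a$ is odd and $b,c$ are even. For a self-complementary plane partition $P$ in the box, $n(P)=|P\setminus H|$ is the number of cubes of $P$ that are not in $H$. For nonnegative integers $a,b,c$, $B(a,b,c)=\prod_{i=1}^{a}\frac{(c+i)_b}{(i)_b}$, where $(t)_n=t(t+1)\cdots(t+n-1)$; this is the number of all plane partitions contained in an $a\times b\times c$ box. For nonnegative integers $a,b,c$, $SC(a,b,c)$ is the number of self-complementary plane partitions contained in an $a\times b\times c$ box (it is symmetric in $a,b,c$, equals $0$ if $a,b,c$ are all odd, and equals $1$ if one side is $0$). By a known theorem of Stanley, $SC(a,b,c)$ equals $B(\frac a2,\frac b2,\frac c2)^2$ for $a,b,c$ even; $B(\frac a2,\frac{b+1}2,\frac{c-1}2)\,B(\frac a2,\frac{b-1}2,\frac{c+1}2)$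 for $a$ even and $b,c$ odd; $B(\frac{a+1}2,\frac b2,\frac c2)\,B(\frac{a-1}2,\frac b2,\frac c2)$ for $a$ odd and $b,c$ even. *)

(* Defs.v *)
From mathcomp Require Import all_boot all_order all_algebra.

Set Implicit Arguments.
Unset Strict Implicit.
Unset Printing Implicit Defensive.

Import GRing.Theory.
Local Open Scope ring_scope.

(* Coordinates are shifted to start at 0: the triple (i, j, k) of ordinals
   stands for the point (i + 1, j + 1, k + 1). Sets of cubes of this type are
   exactly the subsets of the a x b x c box. *)
Definition cube (a b c : nat) : finType := ('I_a * 'I_b * 'I_c)%type.

Definition cube_le (a b c : nat) (u v : cube a b c) : bool :=
  [&& (u.1.1 <= v.1.1)%N, (u.1.2 <= v.1.2)%N & (u.2 <= v.2)%N].

Definition plane_partition (a b c : nat) (P : {set cube a b c}) : bool :=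
  [forall u in P, forall v, cube_le v u ==> (v \in P)].

(* With 0-based coordinates, i |-> a + 1 - i becomes i |-> a - 1 - i, which is
   rev_ord. *)
Definition cube_opp (a b c : nat) (u : cube a b c) : cube a b c :=
  (rev_ord u.1.1, rev_ord u.1.2, rev_ord u.2).

Definition self_complementary (a b c : nat) (P : {set cube a b c}) : bool :=
  plane_partition P && [forall u, (u \in P) == (cube_opp u \notin P)].

(* The second branch is meaningful only for b and c even. The 1-based condition
   i <= a / 2 is i < a / 2 in 0-based coordinates. *)
Definition half_full (a b c : nat) : {set cube a b c} :=
  if ~~ odd a then [set u : cube a b c | (u.1.1 < a./2)%N]
  else [set u : cube a b c | (u.1.2 < b./2)%N].

Definition nstat (a b c : nat) (P : {set cube a b c}) : nat :=
  #|P :\: half_full a b c|.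

Definition signed_sum (a b c : nat) : int :=
  \sum_(P : {set cube a b c} | self_complementary P) (-1) ^+ nstat P.

Definition SC (a b c : nat) : nat :=
  #|[set P : {set cube a b c} | self_complementary P]|.

Definition rising (t n : nat) : nat := (\prod_(0 <= m < n) (t + m))%N.

Definition B (a b c : nat) : rat :=
  \prod_(1 <= i < a.+1) ((rising (c + i) b)%:R / (rising i b)%:R).

(* Main.v *)
Require Import Defs.
From mathcomp Require Import all_boot all_order all_algebra all_fingroup.
From mathcomp Require Import zify ring.
Set Implicit Arguments. Unset Strict Implicit. Unset Printing Implicit Defensive.
Import Order.TTheory GRing.Theory Num.Theory.
Local Open Scope ring_scope.

(** The sum is written as a sum of determinants depending on a parameter zeta
with zeta ^+ 2 = 1; zeta = 1 counts the self-complementary plane partitions and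
zeta = -1 gives the signed sum.

Take the box to be h x m x n with n = m + 2f (exchanging m and n costs at most
a sign, [signed_sum_swap]), and let N = m + f and K = h + n - 1. A
self-complementary P contains exactly one cube of every pair of opposite cubes,
and so do H and the set R of the cubes to the right of the central diagonal
(together with one half of that diagonal). Hence |P \ H| and |P /\ R| differ
by a constant modulo 2 ([odd_setD_transversal]), and the signed sum is, up to
sign, the sum of (-1) ^ |P /\ R|.

The heights of P along its diagonals form an interlacing chain of rows, of which
the ones right of the center determine the others. Such Gelfand-Tsetlin sums
are determinants in Gaussian binomial coefficients at zeta ([GT_sum_det]).
The central diagonal is its own complement, so the rows of the determinant come
in pairs of points y, K - y, together with the point K / 2 if m is odd, and one
sums over all strictly decreasing sequences of points y > K / 2
([sum_center_det]).

If zeta = 1, the columns can be replaced by polynomials that are symmetric or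
antisymmetric under x -> K - x. The determinant then factors
([det_paired_rows]), the Cauchy-Binet formula turns the sum into one
determinant of moments ([paired_sum]), the moments telescope
([telescoping_moment]), and what remains is a Hilbert determinant. This gives
the product formula of Stanley.

If zeta = -1, a Gaussian binomial coefficient is an ordinary one in the half of
its argument, possibly restricted to odd arguments ([gauss_bin_N1]). The columns
can therefore be chosen to live on even or on odd points only. If K is even,
that is h + n odd, the reflection x -> K - x preserves parity, and each parity
class is an unsigned sum of half the size: the signed sum is a product of two
values given by the product formula ([class_sum_val]), or 0. Comparing factors
in each parity case gives SC times SC in the two mixed cases. If K is odd, so
that all sides are even, the reflection exchanges the classes: the determinant
becomes a product of two determinants of binomial coefficients in complementary
arguments, and the Cauchy-Binet and Chu-Vandermonde formulas reduce the sum to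
one Hankel determinant of binomial coefficients, which is MacMahon's number
B ([class_sum_odd_val], [det_binomial_hankel]). *)

(** * Determinants and the Cauchy-Binet formula *)

(** The sign depends on the rearrangement and not on the matrix, so that it can be
taken out of a sum of determinants that are rearranged in the same way. Signs
are quantified before the summation variable for this reason throughout. *)
Lemma det_mxsub_inj (R : comNzRingType) n (r c : 'I_n -> 'I_n) :
  injective r -> injective c ->
  exists b : bool, forall A : 'M[R]_n, \det (mxsub r c A) = (-1) ^+ b * \det A.
Proof.
move=> rI cI; exists (odd_perm (perm rI) (+) odd_perm (perm cI)) => A.
have -> : mxsub r c A = row_perm (perm rI) (col_perm (perm cI) A).
  by apply/matrixP => i j; rewrite !mxE !permE.
rewrite row_permE col_permE !det_mulmx !det_perm odd_permV signr_addb.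
by rewrite -mulrA; congr (_ * _); rewrite mulrC.
Qed.

(** A permutation that raises the grade of every point it moves would raise the sum
of all grades; so every permutation but the identity meets a zero entry. *)
Lemma det_graded (R : comNzRingType) n (dg : 'I_n -> nat) (M : 'M[R]_n) :
  (forall i j, i != j -> (dg j <= dg i)%N -> M i j = 0) ->
  \det M = \prod_i M i i.
Proof.
move=> M0; rewrite /determinant (bigD1 (1%g : 'S_n)) //= odd_perm1 mul1r.
rewrite [X in _ + X]big1 ?addr0; last first.
  move=> s sN1; have [/existsP[i /andP[si di]]|] :=
    boolP [exists i, (i != s i) && (dg (s i) <= dg i)%N].
    by rewrite (bigD1 i) //= (M0 i (s i)) // mul0r mulr0.
  rewrite negb_exists => /forallP noi.
  have [i si] : exists i, i != s i.
    apply/existsP; apply: contraNT sN1; rewrite negb_exists => /forallP sE.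
    by apply/eqP/permP => i; rewrite perm1; move: (sE i); rewrite negbK => /eqP.
  have le k : (dg k <= dg (s k))%N.
    by have:= noi k; case: eqP => [<-//|_] /=; rewrite -ltnNge => /ltnW.
  have : (\sum_k dg k < \sum_k dg (s k))%N.
    rewrite (bigD1 i) //= [X in (_ < X)%N](bigD1 i) //=.
    rewrite -addSn leq_add ?leq_sum //.
    by have:= noi i; rewrite si /= -ltnNge.
  by rewrite [X in (X < _)%N](reindex_inj (@perm_inj _ s)) ltnn.
by apply: eq_bigr => i _; rewrite perm1.
Qed.

(** A permutation avoiding the zero block would map A injectively into the
complement of B, which is too small. *)
Lemma det_zero_block (R : comNzRingType) n (A B : {set 'I_n}) (M : 'M[R]_n) :
  (forall i j, i \in A -> j \in B -> M i j = 0) -> (n < #|A| + #|B|)%N ->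
  \det M = 0.
Proof.
move=> M0 ltn; rewrite /determinant big1 // => s _.
have [/existsP[i /andP[iA siB]]|] := boolP [exists i, (i \in A) && (s i \in B)].
  by rewrite (bigD1 i) //= M0 // mul0r mulr0.
rewrite negb_exists => /forallP noi.
have : s @: A \subset ~: B.
  apply/subsetP => _ /imsetP[i iA ->]; rewrite inE.
  by have:= noi i; rewrite iA.
move/subset_leq_card; rewrite card_imset; last exact: perm_inj.
by have:= cardsC B; rewrite card_ord; lia.
Qed.

Definition strictly_decreasing q X (z : {ffun 'I_q -> 'I_X}) :=
  [forall i : 'I_q, forall j : 'I_q, (i < j)%N ==> (z j < z i)%N].

Lemma strictly_decreasingP q X (z : {ffun 'I_q -> 'I_X}) :
  reflect (forall i j : 'I_q, (i < j)%N -> (z j < z i)%N) (strictly_decreasing z).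
Proof.
apply: (iffP forallP) => [h i j ij|h i].
  by have/forallP/(_ j) := h i; rewrite ij.
by apply/forallP => j; apply/implyP/h.
Qed.

(** An injective sequence is a strictly decreasing one composed with the permutation
that ranks its values. *)
Lemma sum_injective_sort (R : comNzRingType) q X (H : {ffun 'I_q -> 'I_X} -> R) :
  \sum_(y : {ffun 'I_q -> 'I_X} | injectiveb y) H y =
  \sum_(z : {ffun 'I_q -> 'I_X} | strictly_decreasing z) \sum_(s : 'S_q) H [ffun i => z (s i)].
Proof.
rewrite exchange_big /=.
have -> : \sum_(j : 'S_q) \sum_(i | strictly_decreasing i) H [ffun k => i (j k)] =
          \sum_(s : 'S_q) \sum_(y : {ffun 'I_q -> 'I_X} | strictly_decreasing [ffun i => y ((s^-1)%g i)]) H y.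
  apply: eq_bigr => s _.
  rewrite [RHS](reindex (fun z : {ffun 'I_q -> 'I_X} => [ffun i => z (s i)])).
    apply: eq_bigl => z; congr strictly_decreasing; apply/ffunP => i.
    by rewrite !ffunE permKV.
  exists (fun z : {ffun 'I_q -> 'I_X} => [ffun i => z ((s^-1)%g i)]) => z _; apply/ffunP => i.
    by rewrite !ffunE permKV.
  by rewrite !ffunE permK.
rewrite (exchange_big_dep (fun y : {ffun 'I_q -> 'I_X} => injectiveb y)) /=; last first.
  move=> s y _ /strictly_decreasingP yd; apply/injectiveP => i j yij.
  apply: (@perm_inj _ s); apply/val_inj/eqP.
  case: ltngtP => // /yd; by rewrite !ffunE !permK yij ltnn.
apply: eq_bigr => y /injectiveP yI.
(* The rank counts the larger values: it is the place of y i in the decreasing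
   rearrangement of y. *)
have rkP i : (#|[set j | (y i < y j)%N]| < q)%N.
  rewrite -[X in (_ < X)%N]card_ord -cardsT; apply: proper_card.
  by apply/properP; split; [apply: subsetT|exists i; rewrite ?inE ?ltnn].
pose rk i := Ordinal (rkP i).
have rk_mono i j : (y i < y j)%N -> (rk j < rk i)%N.
  move=> yij; apply: proper_card; apply/properP; split.
    by apply/subsetP => k; rewrite !inE; apply: ltn_trans.
  by exists j; rewrite !inE ?ltnn.
have rkI : injective rk.
  move=> i j eq; apply: yI; apply/val_inj/eqP; case: ltngtP => // /rk_mono;
  by rewrite eq ltnn.
rewrite (big_pred1 (perm rkI)) // => s /=; apply/strictly_decreasingP/eqP => [yd|-> i j].
  apply/permP => i; rewrite permE; apply/val_inj => /=.
  have yd' j k : (y j < y k)%N = (s k < s j)%N.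
    apply/idP/idP => [|/yd]; last by rewrite !ffunE !permK.
    apply: contraTT; rewrite -leqNgt leq_eqVlt => /orP[/eqP/val_inj/perm_inj->|].
      by rewrite ltnn.
    by move/yd; rewrite !ffunE !permK -leqNgt => /ltnW.
  rewrite -[LHS](@card_ord (s i)).
  have -> : #|[set j | (y i < y j)%N]| = #|[set j : 'I_q | (j < s i)%N]|.
    rewrite -(card_imset _ (@perm_inj _ s)); congr #|pred_of_set _|.
    apply/setP => j; rewrite !inE; apply/imsetP/idP => [[k]|ji].
      by rewrite inE yd' => ? ->.
    by exists ((s^-1)%g j); rewrite ?permKV // inE yd' permKV.
  have le : (s i <= q)%N by apply: ltnW.
  have wI : injective (widen_ord le) by move=> ? ? [] /val_inj.
  rewrite -(card_imset _ wI).
  congr #|pred_of_set _|; apply/setP => j; rewrite inE; apply/imsetP/idP.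
    by move=> [k _ ->] /=.
  by move=> ji; exists (Ordinal ji) => //; apply: val_inj.
rewrite !ffunE => ij; rewrite -[i in X in (_ < X)%N]/i.
have rkV k : rk (((perm rkI)^-1)%g k) = k by rewrite -[LHS](permE rkI) permKV.
move: ij; rewrite -{1}[i]rkV -{1}[j]rkV ltnNge; apply: contraLR.
rewrite -leqNgt negbK leq_eqVlt => /orP[/eqP/val_inj/yI->//|/rk_mono/ltnW//].
Qed.

(** The Cauchy-Binet formula for two q x X matrices, with a weight on the X
summation points. A minor is indexed by the decreasing sequence of its columns,
which is the form in which the sums over central diagonals appear. *)
Lemma Cauchy_Binet_sorted (R : comNzRingType) q X (c : nat -> R)
    (P Q : 'I_q -> nat -> R) :
  \sum_(y : {ffun 'I_q -> 'I_X} | strictly_decreasing y) (\prod_i c (y i)) *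
    (\det (\matrix_(i, j) P j (y i)) * \det (\matrix_(i, j) Q j (y i))) =
  \det (\matrix_(i, j) \sum_(x < X) c x * (P i x * Q j x)).
Proof.
pose H (y : {ffun 'I_q -> 'I_X}) := (\prod_i (c (y i) * P i (y i))) *
  \det (\matrix_(i, j) Q j (y i)).
transitivity (\sum_(y : {ffun 'I_q -> 'I_X} | injectiveb y) H y).
  rewrite sum_injective_sort; apply: eq_bigr => z _.
  rewrite -det_tr mulrA {1}/determinant [X in X * _]mulr_sumr mulr_suml.
  apply: eq_bigr => s _; rewrite /H.
  have -> : \matrix_(i, j) Q j ([ffun i0 => z (s i0)] i) =
            row_perm s (\matrix_(i, j) Q j (z i)).
    by apply/matrixP => i j; rewrite !mxE ffunE.
  rewrite row_permE det_mulmx det_perm big_split /=.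
  have -> : \prod_i c ([ffun i0 => z (s i0)] i) = \prod_i c (z i).
    by rewrite [RHS](reindex_inj (@perm_inj _ s)); apply: eq_bigr => i _; rewrite ffunE.
  have -> : \prod_i (\matrix_(i0, j) P j (z i0))^T i (s i) =
            \prod_i P i ([ffun i0 => z (s i0)] i).
    by apply: eq_bigr => i _; rewrite !mxE ffunE.
  by rewrite -!mulrA; congr (_ * _); apply: mulrCA.
rewrite big_mkcond /= [RHS]/determinant.
under [RHS]eq_bigr do under eq_bigr do rewrite mxE.
under [RHS]eq_bigr do rewrite bigA_distr_bigA big_distrr /=.
rewrite exchange_big; apply: eq_bigr => y _ /=.
transitivity (H y).
  case: ifP => // /negbT/injectivePn[i [j ij yij]].
  by rewrite /H (determinant_alternate ij) ?mulr0 // => k; rewrite !mxE yij.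
rewrite /H /determinant big_distrr; apply: eq_bigr => s _ /=.
under [in RHS]eq_bigr do rewrite mulrA; rewrite [in RHS]big_split /=.
under [X in _ * (_ * X)]eq_bigr do rewrite mxE.
by rewrite mulrCA.
Qed.

(** * Sums over interlacing chains as determinants *)

(** All rows of an interlacing chain have the same formal length N and are padded by
zeros, so that rows of different true lengths share one finite type. *)
Definition gt_row N h := {ffun 'I_N -> 'I_h.+1}.

(** Reading past the end gives 0, the height outside the box. *)
Definition entry N h (lam : gt_row N h) (i : nat) : nat :=
  if insub i is Some o then lam o else 0%N.

Lemma entryE N h (lam : gt_row N h) (i : 'I_N) : entry lam i = lam i.
Proof. by rewrite /entry valK. Qed.

Lemma entry_out N h (lam : gt_row N h) i : (N <= i)%N -> entry lam i = 0%N.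
Proof. by move=> Ni; rewrite /entry insubF // ltnNge Ni. Qed.

Lemma entry_le N h (lam : gt_row N h) i : (entry lam i <= h)%N.
Proof. by rewrite /entry; case: insub => // o; rewrite -ltnS. Qed.

(** The true length of the lower row mu is k. *)
Definition interlaced N h k (lam mu : gt_row N h) :=
  [forall i : 'I_N, if (i < k)%N then (entry lam i.+1 <= mu i <= entry lam i)%N
                    else mu i == 0%N :> nat].

Lemma interlacedP N h k (lam mu : gt_row N h) :
  reflect ((forall i, (i < k)%N -> (i < N)%N ->
             (entry lam i.+1 <= entry mu i <= entry lam i)%N) /\
           (forall i, (k <= i)%N -> entry mu i = 0%N)) (interlaced k lam mu).
Proof.
apply: (iffP forallP) => [H|[H1 H2] i].
  split=> i; last first.
    case: (ltnP i N) => [iN ki|/entry_out//].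
    have:= H (Ordinal iN); rewrite ltnNge ki /= => /eqP.
    by rewrite -(entryE mu).
  by move=> ik iN; have:= H (Ordinal iN); rewrite ik -entryE.
by rewrite -!entryE; case: ifP => [ik|/negbT]; [exact: H1|rewrite -leqNgt => /H2->].
Qed.

Lemma sum_interlaced_prod N h k (lam : gt_row N h) (g : nat -> nat -> rat) :
  (k <= N)%N ->
  \sum_(mu | interlaced k lam mu) \prod_(i < k) g i (entry mu i) =
  \prod_(i < k) \sum_(v < h.+1 | (entry lam i.+1 <= v <= entry lam i)%N) g i v.
Proof.
move=> kN.
rewrite [RHS](big_ord_widen N (fun i => \sum_(v < h.+1 |
  (entry lam i.+1 <= v <= entry lam i)%N) g i v)) // [RHS]big_mkcond /=.
have -> : \prod_(i < N) (if (i < k)%N then \sum_(v < h.+1 |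
    (entry lam i.+1 <= v <= entry lam i)%N) g i v else 1) =
  \prod_(i < N) \sum_(v : 'I_h.+1 | if (i < k)%N then
     (entry lam i.+1 <= v <= entry lam i)%N else v == 0%N :> nat)
     (if (i < k)%N then g i v else 1).
  apply: eq_bigr => i _; case: ifP => // _.
  by rewrite (big_pred1 ord0) // => v.
rewrite bigA_distr_big_dep; apply: eq_big => [mu|mu _].
  by apply: eq_forallb => i; rewrite unfold_in.
rewrite (big_ord_widen N (fun i => g i (entry mu i))) // big_mkcond /=.
by apply: eq_bigr => i _; rewrite entryE.
Qed.

(** The sum of zeta ^+ (y_1 + ... + y_j) over y_1 < ... < y_j < x, that is
zeta ^+ 'C(j, 2) times the Gaussian binomial coefficient of x and j at zeta. *)
Fixpoint gauss_bin (zeta : rat) (j : nat) (x : nat) : rat :=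
  if j is j'.+1 then \sum_(0 <= y < x) zeta ^+ y * gauss_bin zeta j' y else 1.

Definition row_sum N h (mu : gt_row N h) : nat := (\sum_i (mu i : nat))%N.

(** The zeta-weighted number of Gelfand-Tsetlin patterns below a top row lam of true
length k. *)
Fixpoint GT_sum N h (zeta : rat) (k : nat) (lam : gt_row N h) : rat :=
  if k is k'.+1
  then \sum_(mu | interlaced k' lam mu) zeta ^+ row_sum mu * GT_sum zeta k' mu
  else 1.

(** Subtract from every row the next one: the constant first column becomes zero
except in its last entry. *)
Lemma det_differences k (psi : nat -> nat -> rat) (l : nat -> nat) :
  (forall x, psi 0%N x = 1) ->
  \det (\matrix_(i < k.+1, j < k.+1) psi j (l i)) =
  (-1) ^+ k * \det (\matrix_(i < k, j < k) (psi j.+1 (l i) - psi j.+1 (l i.+1))).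
Proof.
move=> psi0.
pose Bi : 'M[rat]_k.+1 := \matrix_(i, j)
  ((i == j)%:R - (i.+1 == j :> nat)%:R).
have detB : \det Bi = 1.
  rewrite (@det_graded _ _ (fun i : 'I_k.+1 => i)); last first.
    move=> i j ij le; rewrite mxE (negbTE ij) gtn_eqF ?subrr //=.
  by apply: big1 => i _; rewrite mxE eqxx gtn_eqF ?subr0.
rewrite -[LHS]mul1r -{1}detB -det_mulmx (expand_det_col _ ord0).
have BE (i j : 'I_k.+1) : (Bi *m \matrix_(i < k.+1, j < k.+1) psi j (l i)) i j =
  psi j (l i) - (if (i < k)%N then psi j (l i.+1) else 0).
  rewrite mxE (eq_bigr (fun r : 'I_k.+1 => (i == r)%:R * psi j (l r) -
     (i.+1 == r :> nat)%:R * psi j (l r))); last first.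
    by move=> r _; rewrite !mxE mulrBl.
  rewrite big_split /= (bigD1 i) //= eqxx mul1r big1 ?addr0; last first.
    by move=> r ri; rewrite eq_sym (negbTE ri) mul0r.
  rewrite sumrN; congr (_ - _); case: ifP => ik.
    have ik' : (i.+1 < k.+1)%N by [].
    rewrite (bigD1 (Ordinal ik')) //= eqxx mul1r big1 ?addr0 // => r ri.
    rewrite [_ == _ :> nat]eq_sym -[X in _ == X]/(val (Ordinal ik')) val_eqE.
    by rewrite (negbTE ri) mul0r.
  rewrite big1 // => r _; rewrite gtn_eqF ?mul0r //.
  by have:= ltn_ord r; move/negbT: ik; rewrite -leqNgt; lia.
rewrite (bigD1 ord_max) //= big1 ?addr0; last first.
  move=> i ik; rewrite BE !psi0 ifT ?subrr ?mul0r //.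
  by have:= ltn_ord i; move: ik; rewrite -val_eqE /=; lia.
rewrite BE ltnn subr0 psi0 mul1r /cofactor /= addn0; congr (_ * \det _).
apply/matrixP => i j; rewrite mxE mxE BE mxE /= /bump leq0n add1n.
by have ik := ltn_ord i; rewrite [(k <= i)%N]leqNgt ik add0n ik.
Qed.

Lemma gauss_bin_sub zeta j a b : (a <= b)%N ->
  gauss_bin zeta j.+1 b - gauss_bin zeta j.+1 a = \sum_(a <= y < b) zeta ^+ y * gauss_bin zeta j y.
Proof.
by move=> ab; rewrite /= (@big_cat_nat _ _ _ a 0%N b) //= -addrA addrCA subrr addr0.
Qed.

(** The arguments l_i = lam_i + k - 1 - i are strictly decreasing. By induction the
sum over mu is a sum of k x k determinants in which each entry of mu occurs in a
single row and ranges independently over an interval; summing row by row turns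
the Gaussian binomials of index j into differences of those of index j + 1, and
[det_differences] identifies the result with a determinant of size k + 1. *)
Lemma GT_sum_det N h zeta k : zeta ^+ 2 = 1 -> (k <= N)%N ->
  exists e : nat, exists b : bool, forall lam : gt_row N h,
  (forall i, (i.+1 < k)%N -> (entry lam i.+1 <= entry lam i)%N) ->
  GT_sum zeta k lam = (-1) ^+ b * zeta ^+ e *
     \det (\matrix_(i < k, j < k) gauss_bin zeta j (entry lam i + (k - i.+1))).
Proof.
move=> z2; elim: k => [|k IH] kN.
  by exists 0%N, false => lam _; rewrite det_mx00 !mulr1.
have [e [b He]] := IH (ltnW kN).
exists (e + \sum_(i < k) (k - i.+1))%N, (b (+) odd k) => lam mono.
have -> : GT_sum zeta k.+1 lam = (-1) ^+ b * zeta ^+ e *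
   \sum_(mu | interlaced k lam mu) \sum_(s : 'S_k) (-1) ^+ s *
     \prod_(i < k) (zeta ^+ entry mu i * gauss_bin zeta (if (insub (i : nat) : option 'I_k) is Some o then s o else 0%N) (entry mu i + (k - i.+1))).
  rewrite /= big_distrr; apply: eq_bigr => mu /interlacedP[st1 st0].
  rewrite He; last first.
    move=> i ik; have /andP[le1 _] := st1 i (ltnW ik) (ltn_trans (ltnW ik) kN).
    have /andP[_ le2] := st1 i.+1 ik (ltn_trans ik kN).
    exact: leq_trans le2 le1.
  have -> : row_sum mu = (\sum_(i < k) entry mu i)%N.
    rewrite /row_sum (big_ord_widen N (entry mu)) ?(ltnW kN) // [RHS]big_mkcond /=.
    apply: eq_bigr => i _; rewrite -entryE; case: ifP => // /negbT.
    by rewrite -leqNgt => /st0.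
  rewrite mulrCA; congr (_ * _); rewrite /determinant big_distrr.
  apply: eq_bigr => s _ /=; rewrite big_split /= expr_sum mulrCA; congr (_ * (_ * _)).
  by apply: eq_bigr => i _; rewrite mxE valK.
rewrite exchange_big /=.
rewrite (@det_differences k (gauss_bin zeta) (fun i => entry lam i + (k.+1 - i.+1))%N) //.
rewrite signr_addb signr_odd exprD.
have -> (a b' c d x : rat) : a * b' * (c * d) * (b' * x) = a * c * (d * (b' ^+ 2 * x)) by ring.
rewrite -exprM mulnC exprM sqrrN expr1n mul1r; congr (_ * _ * _).
rewrite /determinant big_distrr; apply: eq_bigr => s _ /=.
rewrite -big_distrr /= (sum_interlaced_prod lam (fun i v => zeta ^+ v *
   gauss_bin zeta (if (insub (i : nat) : option 'I_k) is Some o then s o else 0%N) (v + (k - i.+1)))) ?(ltnW kN) //.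
rewrite mulrCA; congr (_ * _); rewrite expr_sum -big_split /=.
apply: eq_bigr => i _; rewrite mxE valK gauss_bin_sub; last first.
  by have:= mono i (ltn_ord i); have:= ltn_ord i; lia.
set j := val (s i).
have ik := ltn_ord i; have mi := mono i ik.
have -> : (\sum_(v < h.+1 | (entry lam i.+1 <= v <= entry lam i)%N)
     zeta ^+ v * gauss_bin zeta j (v + (k - i.+1)))
  = \sum_(entry lam i.+1 <= v < (entry lam i).+1) zeta ^+ v * gauss_bin zeta j (v + (k - i.+1)).
  rewrite (big_nat_widen _ _ h.+1) ?ltnS ?entry_le // big_geq_mkord.
  by apply: eq_bigl => v /=; rewrite ltnS andbC.
have -> : (entry lam i + (k.+1 - i.+1) = (entry lam i).+1 + (k - i.+1))%N by lia.
have -> : (k.+1 - i.+2 = k - i.+1)%N by lia.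
rewrite big_addn addnK mulr_sumr.
apply: eq_bigr => v _; rewrite exprD.
by rewrite [_ ^+ v * _ ^+ _]mulrC !mulrA -expr2 -exprM mulnC exprM z2 expr1n mul1r.
Qed.

(** * Heights of a plane partition *)

Section Heights.
Variables h m n : nat.
Implicit Types (P : {set cube h m n}) (u v : cube h m n).

Definition pp_height P (i j : nat) : nat :=
  #|[set u in P | (u.1.2 == i :> nat) && (u.2 == j :> nat)]|.

Lemma pp_height_out P i j : (m <= i)%N || (n <= j)%N -> pp_height P i j = 0%N.
Proof.
move=> out; apply/eqP; rewrite cards_eq0; apply/eqP/setP => u; rewrite !inE.
apply/negbTE; apply: contraL out => /and3P[_ /eqP<- /eqP<-].
by rewrite negb_or -!ltnNge !ltn_ord.
Qed.

Lemma card_column (D : {set 'I_h}) (i : 'I_m) (j : 'I_n) P :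
  (forall x, ((x, i, j) \in P) = (x \in D)) -> pp_height P i j = #|D|.
Proof.
move=> PD; have inj : injective (fun x : 'I_h => (x, i, j)) by move=> x y [].
rewrite -(card_imset _ inj); apply: eq_card => -[[x i'] j'].
rewrite !inE /=; apply/and3P/imsetP => [[xP /eqP/val_inj ii /eqP/val_inj jj]|].
  by move: xP; rewrite ii jj PD => xD; exists x.
by move=> [y yD [-> -> ->]]; rewrite PD yD.
Qed.

Lemma card_ltn_ord (t : nat) : (t <= h)%N -> #|[set x : 'I_h | (x < t)%N]| = t.
Proof.
move=> th; have wI : injective (widen_ord th) by move=> ? ? [] /val_inj.
rewrite -[RHS]card_ord -(card_imset _ wI); apply: eq_card => j; rewrite inE.
apply/idP/imsetP => [jt|[k _ ->]]; last exact: (ltn_ord k).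
by exists (Ordinal jt) => //; apply: val_inj.
Qed.

Lemma pp_height_le P i j : (pp_height P i j <= h)%N.
Proof.
case: (ltnP i m) => [im|mi]; last by rewrite pp_height_out ?mi.
case: (ltnP j n) => [jn|nj]; last by rewrite pp_height_out ?nj ?orbT.
rewrite (@card_column [set x | (x, Ordinal im, Ordinal jn) \in P]
  (Ordinal im) (Ordinal jn) P) => [|x]; last by rewrite inE.
by rewrite -[X in (_ <= X)%N](card_ord h) max_card.
Qed.

Lemma pp_height_mem P u : plane_partition P -> (u \in P) = (u.1.1 < pp_height P u.1.2 u.2)%N.
Proof.
case: u => [[x i] j] /= /forallP PP.
have down (y z : 'I_h) : (z <= y)%N -> (y, i, j) \in P -> (z, i, j) \in P.
  move=> zy yP; have /implyP/(_ yP)/forallP/(_ (z, i, j)) := PP (y, i, j).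
  by rewrite /cube_le /= zy !leqnn.
rewrite (@card_column [set y | (y, i, j) \in P] i j P) => [|y]; last by rewrite inE.
apply/idP/idP => [xP|].
  rewrite -(@card_ltn_ord x.+1) //; apply: subset_leq_card.
  by apply/subsetP => y; rewrite !inE ltnS => /down; apply.
apply: contraTT => xP; rewrite -leqNgt -[X in (_ <= X)%N](@card_ltn_ord x);
  last exact: ltnW.
apply: subset_leq_card; apply/subsetP => y; rewrite !inE ltnNge => yP.
by apply: contra xP => /down; apply.
Qed.

Lemma pp_height_set (A : nat -> nat -> nat) (i : 'I_m) (j : 'I_n) :
  (forall i j : nat, A i j <= h)%N ->
  pp_height [set u : cube h m n | (u.1.1 < A u.1.2 u.2)%N] i j = A i j.
Proof.
move=> Ah; rewrite -[RHS](card_ltn_ord (Ah i j)).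
by apply: card_column => x; rewrite !inE.
Qed.

Lemma pp_height_anti P i j i' j' : plane_partition P ->
  (i <= i')%N -> (j <= j')%N -> (pp_height P i' j' <= pp_height P i j)%N.
Proof.
move=> PP ii jj; rewrite leqNgt; apply/negP => lt.
case: (ltnP i' m) => [im|mi]; last by move: lt; rewrite [X in (_ < X)%N]pp_height_out ?mi.
case: (ltnP j' n) => [jn|nj]; last by move: lt; rewrite [X in (_ < X)%N]pp_height_out ?nj ?orbT.
have th : (pp_height P i j < h)%N by apply: leq_trans lt (pp_height_le _ _ _).
have uP : (Ordinal th, Ordinal im, Ordinal jn) \in P by rewrite pp_height_mem.
have := PP; move=> /forallP/(_ (Ordinal th, Ordinal im, Ordinal jn)).
rewrite uP => /forallP.
move=> /(_ (Ordinal th, Ordinal (leq_ltn_trans ii im), Ordinal (leq_ltn_trans jj jn))).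
by rewrite /cube_le /= leqnn ii jj pp_height_mem //= ltnn.
Qed.

(** The complement of P, read from the top of the box, is P in the opposite column. *)
Lemma pp_height_compl P i j : self_complementary P -> (i < m)%N -> (j < n)%N ->
  (pp_height P i j + pp_height P (m - i.+1) (n - j.+1) = h)%N.
Proof.
move=> /andP[PP /forallP SC] im jn.
have ah := pp_height_le P i j; have bh := pp_height_le P (m - i.+1) (n - j.+1).
set a := pp_height P i j in ah *; set b := pp_height P _ _ in bh *.
(* The level x is filled in one column exactly when the level h - 1 - x is empty in
   the opposite one. *)
have key x : (x < h)%N -> (x < a)%N = ~~ (h - x.+1 < b)%N.
  move=> xh; have /eqP := SC (Ordinal xh, Ordinal im, Ordinal jn).
  by rewrite !pp_height_mem.
case: (ltngtP (a + b)%N h) => // hab.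
- by have := key a; lia.
- have := key a.-1; have := key (h - b)%N; lia.
Qed.

Lemma pp_set (A : nat -> nat -> nat) :
  (forall i j i' j', i <= i' -> j <= j' -> i' < m -> j' < n -> A i' j' <= A i j)%N ->
  plane_partition [set u : cube h m n | (u.1.1 < A u.1.2 u.2)%N].
Proof.
move=> anti; apply/forallP => u; apply/implyP; rewrite inE => uA.
apply/forallP => v; apply/implyP => /and3P[vu1 vu2 vu3]; rewrite inE.
apply: leq_ltn_trans vu1 (leq_trans uA _).
by apply: anti.
Qed.

Lemma sc_set (A : nat -> nat -> nat) :
  (forall i j, i < m -> j < n -> A i j <= h)%N ->
  (forall i j i' j', i <= i' -> j <= j' -> i' < m -> j' < n -> A i' j' <= A i j)%N ->
  (forall i j, i < m -> j < n -> A i j + A (m - i.+1) (n - j.+1) = h)%N ->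
  self_complementary [set u : cube h m n | (u.1.1 < A u.1.2 u.2)%N].
Proof.
move=> Ah anti compl; rewrite /self_complementary pp_set //=.
apply/forallP => -[[x i] j]; rewrite !inE /=.
have := compl i j (ltn_ord i) (ltn_ord j).
have := Ah i j (ltn_ord i) (ltn_ord j); have := ltn_ord x.
by move: (A _ _) (A _ _) => a b; lia.
Qed.

End Heights.

(** * Self-complementary plane partitions as interlacing chains *)

(** The rows below lam are listed from the top; their true lengths are
k - 1, ..., 0. *)
Fixpoint chain N h k (lam : gt_row N h) (t : seq (gt_row N h)) : bool :=
  match k, t with
  | k'.+1, mu :: t' => interlaced k' lam mu && chain k' mu t'
  | 0, [::] => true
  | _, _ => false
  end.

Lemma chainP N h k (lam : gt_row N h) (t : seq (gt_row N h)) : size t = k ->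
  reflect (forall p, (p < k)%N ->
            interlaced (k - p.+1) (nth lam (lam :: t) p) (nth lam t p))
          (chain k lam t).
Proof.
elim: k lam t => [|k IH] lam [|mu t] //= => [_|[st]]; first by constructor.
apply: (iffP andP) => [[s1 /(IH _ _ st) c] [|p] pk|H].
- by rewrite subSS subn0.
- have := c p pk; rewrite subSS (set_nth_default lam) //=; last first.
    by rewrite st; lia.
  by rewrite (set_nth_default lam) // st.
split; first by have := H 0%N isT; rewrite subSS subn0.
apply/(IH _ _ st) => p pk; have := H p.+1 pk.
rewrite subSS /= (set_nth_default mu) /=; last by rewrite st; lia.
by rewrite (set_nth_default mu) // st.
Qed.

Lemma big_tuple_cons (T : finType) k (F : seq T -> rat) (P : pred (seq T)) :
  \sum_(t : k.+1.-tuple T | P t) F t =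
  \sum_(x : T) \sum_(t : k.-tuple T | P (x :: t)) F (x :: t).
Proof.
rewrite pair_big_dep /=.
rewrite (reindex (fun p : T * k.-tuple T => [tuple of p.1 :: p.2])) //=.
exists (fun t : k.+1.-tuple T => (thead t, [tuple of behead t])) => [[x t] _|t _].
  by congr pair; apply: val_inj.
by rewrite /= -tuple_eta.
Qed.

Lemma GT_sum_chain N h zeta k (lam : gt_row N h) :
  GT_sum zeta k lam =
  \sum_(t : k.-tuple (gt_row N h) | chain k lam t) \prod_(mu <- t) zeta ^+ row_sum mu.
Proof.
elim: k lam => [|k IH] lam.
  rewrite (big_pred1 [tuple]) => [|t]; first by rewrite /= big_nil.
  by rewrite (tuple0 t) [RHS]/= eq_refl.
rewrite (@big_tuple_cons _ _ (fun t => \prod_(mu <- t) zeta ^+ row_sum mu)).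
rewrite /= big_mkcond /=; apply: eq_bigr => mu _.
case: ifP => /= st; last by rewrite big_pred0.
by rewrite IH big_distrr; apply: eq_bigr => t _; rewrite big_cons.
Qed.

Section DiagonalEncoding.
Variables h m f : nat.
Local Notation n := (m + f + f)%N.
Local Notation N := (m + f)%N.
Local Notation T := (gt_row N h).
Implicit Types (P : {set cube h m n}) (x : T * N.-tuple T).

(** What self-complementarity says about the central diagonal j = i + f, which is
mapped to itself by the central symmetry of the box. *)
Definition center (lam : T) :=
  [forall i : 'I_N, if (i < m)%N
    then (entry lam i.+1 <= lam i)%N && (lam i + entry lam (m - i.+1) == h)%N
    else lam i == 0%N :> nat].

Lemma centerP (lam : T) :
  reflect [/\ forall i, (entry lam i.+1 <= entry lam i)%N,
              forall i, (i < m)%N -> (entry lam i + entry lam (m - i.+1) = h)%N &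
              forall i, (m <= i)%N -> entry lam i = 0%N]
          (center lam).
Proof.
apply: (iffP forallP) => [H|[H1 H2 H3] i].
  have H3 i : (m <= i)%N -> entry lam i = 0%N.
    case: (ltnP i N) => [iN|/entry_out//].
    by have := H (Ordinal iN); rewrite -entryE /= ltnNge => + mi; rewrite mi => /eqP.
  split=> // i; last first.
    move=> im; have iN : (i < N)%N by lia.
    by have := H (Ordinal iN); rewrite -entryE /= im => /andP[_ /eqP].
  case: (ltnP i m) => [im|mi]; last by rewrite (H3 i.+1) //; apply: leqW.
  have iN : (i < N)%N by lia.
  by have := H (Ordinal iN); rewrite -entryE /= im => /andP[].
rewrite -entryE; case: ifP => [im|/negbT]; first by rewrite H1 H2 ?eqxx.
by rewrite -leqNgt => /H3->.
Qed.

Definition rows x (p i : nat) : nat := entry (nth x.1 (x.1 :: x.2) p) i.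

Definition valid_chain x := center x.1 && chain N x.1 x.2.

(** Left of the central diagonal the heights are forced by complementation. *)
Definition height x (i j : nat) : nat :=
  if (i + f <= j)%N then rows x (j - (i + f)) i
  else (h - rows x ((n - j.+1) - (m - i.+1 + f)) (m - i.+1))%N.

Definition of_rows x : {set cube h m n} :=
  [set u : cube h m n | (u.1.1 < height x u.1.2 u.2)%N].

Definition diagonal P (p : nat) : T :=
  [ffun i : 'I_N => inord (pp_height P i (i + f + p))].

Definition to_rows P : T * N.-tuple T :=
  (diagonal P 0, [tuple diagonal P p.+1 | p < N]).

Lemma entry_diagonal P p i : entry (diagonal P p) i = pp_height P i (i + f + p).
Proof.
case: (ltnP i N) => [iN|Ni]; last first.
  by rewrite entry_out // pp_height_out //; apply/orP; left; lia.
by rewrite -[i]/(val (Ordinal iN)) entryE ffunE inordK // ltnS pp_height_le.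
Qed.

Lemma rows_to_rows P p i : (p <= N)%N ->
  rows (to_rows P) p i = pp_height P i (i + f + p).
Proof.
move=> pN; rewrite -entry_diagonal /rows; congr (entry _ _).
case: p pN => [//|p pN].
rewrite -[LHS]/(nth (diagonal P 0) [tuple diagonal P q.+1 | q < N] (Ordinal pN)).
by rewrite -tnth_nth tnth_mktuple.
Qed.

Lemma rows_le x p i : (rows x p i <= h)%N. Proof. exact: entry_le. Qed.

Lemma height_le x i j : (height x i j <= h)%N.
Proof. by rewrite /height; case: ifP => _; rewrite ?leq_subr ?rows_le. Qed.

Lemma to_rowsK P : self_complementary P -> of_rows (to_rows P) = P.
Proof.
move=> SC; have PP : plane_partition P by case/andP: SC.
apply/setP => -[[x i] j]; rewrite inE /= pp_height_mem //=; congr (_ < _)%N.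
have im := ltn_ord i; have jn := ltn_ord j.
rewrite /height; case: leqP => ij.
  by rewrite rows_to_rows; [congr pp_height|]; lia.
have := pp_height_compl SC im jn; rewrite rows_to_rows; last by lia.
have -> : (m - i.+1 + f + (n - j.+1 - (m - i.+1 + f)) = n - j.+1)%N by lia.
by lia.
Qed.

(** The interlacing conditions rewritten as inequalities between heights in
neighbouring columns of the box, together with the support of the rows. *)
Lemma valid_chainP x :
  reflect [/\ forall i, (i < m)%N -> (rows x 0 i + rows x 0 (m - i.+1) = h)%N,
              forall p i, (p <= N)%N -> (m <= i)%N || (N <= i + p)%N -> rows x p i = 0%N,
              forall p i, (p <= N)%N -> (rows x p i.+1 <= rows x p i)%N,
              forall p i, (i + p.+1 < N)%N -> (rows x p.+1 i <= rows x p i)%N &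
              forall p i, (i + p.+1 < N)%N -> (rows x p i.+1 <= rows x p.+1 i)%N]
    (valid_chain x).
Proof.
have st2 : size x.2 = N by rewrite size_tuple.
apply: (iffP andP) => [[/centerP[c1 c2 c3] /(chainP _ st2) ch]|[v1 v2 v3 v4 v5]].
  have st p : (p < N)%N -> (forall i, (i < N - p.+1)%N -> (i < N)%N ->
             (rows x p i.+1 <= rows x p.+1 i <= rows x p i)%N) /\
           (forall i, (N - p.+1 <= i)%N -> rows x p.+1 i = 0%N).
    by move=> /ch/interlacedP.
  have r0 p i : (p <= N)%N -> (m <= i)%N -> rows x p i = 0%N.
    elim: p => [|p IH] pN mi; first exact: c3.
    have [s1 s2] := st _ pN; case: (ltnP i (N - p.+1)) => [lt|/s2//].
    have /andP[_] := s1 i lt ltac:(lia); rewrite (IH (ltnW pN)) //.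
    by rewrite leqn0 => /eqP.
  split=> //.
  - move=> p i pN /orP[mi|Nip]; first exact: r0.
    case: p pN Nip => [|p] pN Nip; first by apply: c3; lia.
    by have [_ ->] := st _ pN; last lia.
  - move=> p i; case: p => [|p] pN; first exact: c1.
    have [s1 s2] := st _ pN; case: (ltnP i.+1 (N - p.+1)) => [lt|/s2->//].
    have /andP[_ le1] := s1 i.+1 lt ltac:(lia).
    have /andP[le2 _] := s1 i ltac:(lia) ltac:(lia).
    exact: leq_trans le1 le2.
  - move=> p i lt; have [s1 s2] := st p ltac:(lia).
    by have /andP[] := s1 i ltac:(lia) ltac:(lia).
  - move=> p i lt; have [s1 s2] := st p ltac:(lia).
    by have /andP[] := s1 i ltac:(lia) ltac:(lia).
split.
  apply/centerP; split=> i; first exact: (v3 0%N i).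
    exact: v1.
  by move=> mi; apply: (v2 0%N); rewrite ?mi.
apply/(chainP _ st2) => p pN; apply/interlacedP; split=> i.
  move=> ip iN; apply/andP; split; [apply: (v5 p)|apply: (v4 p)]; lia.
by move=> ip; apply: (v2 p.+1) => //; lia.
Qed.

Lemma valid_chain_to_rows P : self_complementary P -> valid_chain (to_rows P).
Proof.
move=> SC; have PP : plane_partition P by case/andP: SC.
apply/valid_chainP; split.
- move=> i im; rewrite !rows_to_rows // !addn0.
  have -> : (m - i.+1 + f = n - (i + f).+1)%N by lia.
  by apply: pp_height_compl => //; lia.
- by move=> p i pN out; rewrite rows_to_rows // pp_height_out //; lia.
- by move=> p i pN; rewrite !rows_to_rows //; apply: pp_height_anti => //; lia.
- by move=> p i lt; rewrite !rows_to_rows; [apply: pp_height_anti => //| |]; lia.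
- by move=> p i lt; rewrite !rows_to_rows; [apply: pp_height_anti => //| |]; lia.
Qed.

End DiagonalEncoding.

Section DiagonalBijection.
Variables h m f : nat.
Local Notation n := (m + f + f)%N.
Local Notation N := (m + f)%N.
Local Notation T := (gt_row N h).
Implicit Types (P : {set cube h m n}) (x : T * N.-tuple T).

Lemma height_right x i j : (i + f <= j)%N ->
  height x i j = rows x (j - (i + f)) i.
Proof. by rewrite /height => ->. Qed.

Lemma height_compl x i j : valid_chain x -> (i < m)%N -> (j < n)%N ->
  (height x i j + height x (m - i.+1) (n - j.+1) = h)%N.
Proof.
move=> /valid_chainP[v1 _ _ _ _].
have left a b : (a < m)%N -> (b < n)%N -> (b < a + f)%N ->
    (height x a b + height x (m - a.+1) (n - b.+1) = h)%N.
  move=> am bn ba; rewrite (@height_right _ (m - a.+1)); last by lia.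
  by rewrite /height leqNgt ba /= subnK // rows_le.
move=> im jn; case: (ltngtP j (i + f)) => [ji|ji|ji]; first exact: left.
  have := left (m - i.+1)%N (n - j.+1)%N ltac:(lia) ltac:(lia) ltac:(lia).
  have -> : (m - (m - i.+1).+1 = i)%N by lia.
  have -> : (n - (n - j.+1).+1 = j)%N by lia.
  by rewrite addnC.
rewrite !height_right; [|by lia..].
have -> : (n - j.+1 - (m - i.+1 + f) = 0)%N by lia.
by rewrite ji subnn v1.
Qed.

(** It is enough to compare neighbouring columns. Right of the central diagonal this
is interlacing, and complementation carries it to the left side. *)
Lemma height_anti x i j i' j' : valid_chain x ->
  (i <= i' -> j <= j' -> i' < m -> j' < n -> height x i' j' <= height x i j)%N.
Proof.
move=> vx; have /valid_chainP[_ _ _ v4 v5] := vx; have hc := height_compl vx.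
have rj a b : (a < m)%N -> (b.+1 < n)%N -> (a + f <= b)%N ->
    (height x a b.+1 <= height x a b)%N.
  move=> am bn ab; rewrite !height_right ?(leq_trans ab) // subSn //.
  by apply: v4; lia.
have ri a b : (a.+1 < m)%N -> (b < n)%N -> (a.+1 + f <= b)%N ->
    (height x a.+1 b <= height x a b)%N.
  move=> am bn ab; rewrite !height_right; [|by lia..].
  have -> : (b - (a + f) = (b - (a.+1 + f)).+1)%N by lia.
  by apply: v5; lia.
have sj a b : (a < m)%N -> (b.+1 < n)%N -> (height x a b.+1 <= height x a b)%N.
  move=> am bn; case: (leqP (a + f) b) => [|lt]; first exact: rj.
  have := rj (m - a.+1)%N (n - b.+2)%N ltac:(lia) ltac:(lia) ltac:(lia).
  have := hc a b am ltac:(lia); have := hc a b.+1 am ltac:(lia).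
  have -> : ((n - b.+2).+1 = n - b.+1)%N by lia.
  by lia.
have si a b : (a.+1 < m)%N -> (b < n)%N -> (height x a.+1 b <= height x a b)%N.
  move=> am bn; case: (leqP (a.+1 + f) b) => [|lt]; first exact: ri.
  have := ri (m - a.+2)%N (n - b.+1)%N ltac:(lia) ltac:(lia) ltac:(lia).
  have := hc a b ltac:(lia) bn; have := hc a.+1 b ltac:(lia) bn.
  have -> : ((m - a.+2).+1 = m - a.+1)%N by lia.
  by lia.
move=> ii jj im jn; apply: (@leq_trans (height x i j')).
  move: im; rewrite -(subnKC ii); elim: (i' - i)%N => [|d IH]; first by rewrite addn0.
  by rewrite addnS => im; apply: leq_trans (IH (ltnW im)); apply: si.
move: jn; rewrite -(subnKC jj); elim: (j' - j)%N => [|d IH]; first by rewrite addn0.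
rewrite addnS => jn; apply: leq_trans (IH (ltnW jn)); apply: sj => //.
exact: leq_ltn_trans im.
Qed.

Lemma of_rows_sc x : valid_chain x -> self_complementary (of_rows x).
Proof.
move=> vx; apply: (@sc_set h m n (height x)) => [i j _ _|i j i' j'|i j].
- exact: height_le.
- exact: height_anti.
- exact: height_compl.
Qed.

Lemma rows_eq x y : (forall p i, (p <= N)%N -> (i < N)%N -> rows x p i = rows y p i) ->
  x = y.
Proof.
case: x y => [x1 x2] [y1 y2] eq; congr pair.
  by apply/ffunP => i; apply: val_inj; have := eq 0%N i isT (ltn_ord i); rewrite /rows !entryE.
apply: eq_from_tnth => p; apply/ffunP => i; apply: val_inj.
have := eq p.+1 i (ltn_ord p) (ltn_ord i); rewrite /rows !entryE /=.
by rewrite -!tnth_nth.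
Qed.

Lemma of_rowsK x : valid_chain x -> to_rows (of_rows x) = x.
Proof.
move=> vx; have /valid_chainP[_ v2 _ _ _] := vx.
apply: rows_eq => p i pN iN; rewrite rows_to_rows //.
case: (boolP ((m <= i) || (N <= i + p))%N) => [out|].
  by rewrite v2 // pp_height_out //; lia.
rewrite negb_or -!ltnNge => /andP[im ip].
have jn : (i + f + p < n)%N by lia.
rewrite -[i in LHS]/(val (Ordinal im)) -[X in pp_height _ _ X]/(val (Ordinal jn)).
rewrite pp_height_set; last exact: height_le.
by rewrite /= height_right; [rewrite addKn|lia].
Qed.

(** One cube of each pair of opposite cubes, chosen along diagonals so that its
intersection with P is counted by the entries of the chain and by the upper half
of the central diagonal. For odd m the lower half of the central column has to
be added; this requires h to be even. *)
Definition half_cubes : {set cube h m n} :=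
  [set u : cube h m n | (u.1.2 + f < u.2)%N || ((u.2 == u.1.2 + f :> nat)%N &&
     ((u.1.2.*2.+1 < m) || ((u.1.2.*2.+1 == m) && (u.1.1.*2.+1 < h))))%N].

Lemma card_columns P (Q : nat -> nat -> bool) :
  #|[set u in P | Q u.1.2 u.2]| =
  (\sum_(i < m) \sum_(j < n) if Q i j then pp_height P i j else 0)%N.
Proof.
pose Fu (u : cube h m n) (i : 'I_m) (j : 'I_n) : nat :=
  (Q i j && (u.1.2 == i) && (u.2 == j))%N.
transitivity (\sum_(u in P) \sum_(i < m) \sum_(j < n) Fu u i j)%N.
  rewrite -sum1_card (eq_bigl (fun u : cube h m n => (u \in P) && Q u.1.2 u.2)); last first.
    by move=> u; rewrite inE.
  rewrite big_mkcondr; apply: eq_bigr => -[[y i] j] _ /=.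
  rewrite (bigD1 i) //= (bigD1 j) //= /Fu /= !eqxx !andbT.
  rewrite big1 ?addn0 => [|k kj]; last by rewrite [j == _]eq_sym (negbTE kj) andbF.
  rewrite big1 ?addn0 => [|k ki]; first by case: ifP.
  by apply: big1 => l _; rewrite [i == _]eq_sym (negbTE ki) andbF.
rewrite exchange_big; apply: eq_bigr => i _ /=.
rewrite exchange_big; apply: eq_bigr => j _ /=.
rewrite /Fu; case: ifP => Qij; last by rewrite big1.
rewrite /pp_height -sum1_card -big_mkcondr /=.
by apply: eq_bigl => u; rewrite !inE.
Qed.

Lemma row_sum_to_rows P :
  (\sum_(mu <- (to_rows P).2) row_sum mu =
   #|[set u in P | (u.1.2 + f < u.2)%N]|)%N.
Proof.
rewrite (card_columns P (fun i j => i + f < j)%N) big_tuple.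
transitivity (\sum_(p < N) \sum_(i < N) pp_height P i (i + f + p.+1))%N.
  apply: eq_bigr => p _; rewrite tnth_mktuple /row_sum; apply: eq_bigr => i _.
  by rewrite -entryE entry_diagonal.
rewrite exchange_big /= big_split_ord /= [X in (_ + X)%N]big1 ?addn0; last first.
  by move=> i _; apply: big1 => p _; rewrite pp_height_out ?leq_addr.
apply: eq_bigr => i _; have im := ltn_ord i.
rewrite -[LHS](big_mkord xpredT (fun p => pp_height P i (i + f + p.+1))).
rewrite -(big_mkord xpredT (fun j => if (i + f < j)%N then pp_height P i j else 0%N)).
rewrite [RHS](big_cat_nat (n := (i + f).+1)) //=; last by lia.
rewrite [X in _ = (X + _)%N]big1_seq ?add0n; last first.
  by move=> j /andP[_]; rewrite mem_index_iota => /andP[_ jlt]; rewrite ifF //; lia.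
transitivity (\sum_((i + f).+1 <= j < (i + f).+1 + N) pp_height P i j)%N.
  rewrite -{1}[(i + f).+1]add0n big_addn addKn; apply: eq_bigr => p _.
  by congr pp_height; lia.
rewrite [LHS](big_cat_nat (n := n)) //=; [|by lia..].
rewrite [X in (_ + X)%N = _]big1_seq ?addn0; last first.
  by move=> j /andP[_]; rewrite mem_index_iota => /andP[nj _]; rewrite pp_height_out ?nj ?orbT.
by apply: eq_big_seq => j; rewrite mem_index_iota => /andP[-> _].
Qed.

Lemma card_half_cubes P : self_complementary P -> (odd m -> ~~ odd h) ->
  #|P :&: half_cubes| =
  (\sum_(mu <- (to_rows P).2) row_sum mu + \sum_(i < m./2) entry (to_rows P).1 i
   + odd m * h./2)%N.
Proof.
move=> SC oddmh; have PP : plane_partition P by case/andP: SC.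
rewrite row_sum_to_rows.
pose A2 := [set u in P | (u.2 == u.1.2 + f :> nat)%N && (u.1.2.*2.+1 < m)%N].
pose A3 := [set u in P | (u.2 == u.1.2 + f :> nat)%N && (u.1.2.*2.+1 == m)%N
             && (u.1.1.*2.+1 < h)%N].
have -> : P :&: half_cubes = [set u in P | (u.1.2 + f < u.2)%N] :|: (A2 :|: A3).
  apply/setP => u; rewrite !inE; case: (u \in P) => //=.
  by rewrite andb_orr andbA.
rewrite cardsU (_ : _ :&: (A2 :|: A3) = set0) ?cards0 ?subn0; last first.
  by apply/setP => u; rewrite !inE; case: (u \in P) => //=; lia.
rewrite cardsU (_ : A2 :&: A3 = set0) ?cards0 ?subn0; last first.
  by apply/setP => u; rewrite !inE; case: (u \in P) => //=; lia.
rewrite -[RHS]addnA; congr (_ + (_ + _))%N.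
  rewrite /A2 (card_columns P (fun i j => (j == i + f) && (i.*2.+1 < m)))%N.
  rewrite (big_ord_widen m (entry (to_rows P).1)); last by lia.
  rewrite [RHS]big_mkcond; apply: eq_bigr => i _.
  have im := ltn_ord i; have ifn : (i + f < n)%N by lia.
  have -> : (i < m./2)%N = (i.*2.+1 < m)%N by lia.
  rewrite entry_diagonal addn0; case: ifP => im2; last first.
    by apply: big1 => j _; rewrite andbF.
  rewrite (bigD1 (Ordinal ifn)) //= eqxx /= big1 ?addn0 // => j.
  by rewrite andbT -val_eqE /= => /negbTE->.
rewrite /A3; case om : (odd m); last first.
  rewrite mul0n; apply/eqP; rewrite cards_eq0; apply/eqP/setP => u; rewrite !inE.
  by case: (u \in P) => //=; lia.
have i0m : (m./2 < m)%N by lia.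
have j0n : (m./2 + f < n)%N by lia.
have hev := oddmh om.
have hmid : pp_height P m./2 (m./2 + f) = h./2.
  have := pp_height_compl SC i0m j0n.
  have -> : (m - m./2.+1 = m./2)%N by lia.
  have -> : (n - (m./2 + f).+1 = m./2 + f)%N by lia.
  by lia.
rewrite mul1n -hmid; apply: eq_card => -[[y i] j]; rewrite !inE /=.
case yP: ((y, i, j) \in P) => //=.
have -> : (i.*2.+1 == m) = (i == m./2 :> nat) by lia.
case: (i =P m./2 :> nat) => [ei|]; last by rewrite andbF.
rewrite ei andbT; case: (j =P (m./2 + f)%N :> nat) => //= ej.
by move: yP; rewrite pp_height_mem //= ei ej hmid; lia.
Qed.

(** For odd m and even h the central column has height h / 2 in every
self-complementary plane partition, whence the constant factor. *)
Lemma sum_sc_GT_sum (zeta : rat) : (odd m -> ~~ odd h) ->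
  \sum_(P : {set cube h m n} | self_complementary P) zeta ^+ #|P :&: half_cubes| =
  zeta ^+ (odd m * h./2) *
  \sum_(lam : T | center lam) zeta ^+ (\sum_(i < m./2) entry lam i)%N * GT_sum zeta N lam.
Proof.
move=> oddmh; rewrite (reindex_onto (@of_rows h m f) (@to_rows h m f)); last first.
  by move=> P; apply: to_rowsK.
rewrite (eq_bigl (@valid_chain h m f)); last first.
  move=> x; apply/andP/idP => [[SC /eqP<-]|vx]; first exact: valid_chain_to_rows.
  by rewrite of_rows_sc ?of_rowsK.
transitivity (\sum_(x | @valid_chain h m f x) (zeta ^+ (odd m * h./2) *
   (zeta ^+ (\sum_(i < m./2) entry x.1 i)%N * \prod_(mu <- x.2) zeta ^+ row_sum mu))).
  apply: eq_bigr => x vx; rewrite card_half_cubes ?of_rows_sc // of_rowsK //.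
  rewrite addnC 2!exprD (expr_sum zeta _ _ (@row_sum N h)); congr (_ * _).
  exact: mulrC.
rewrite -mulr_sumr; congr (_ * _).
rewrite -(pair_big_dep (@center h m f) (fun lam (t : N.-tuple T) => chain N lam t)
  (fun lam (t : N.-tuple T) => zeta ^+ (\sum_(i < m./2) entry lam i)%N *
      \prod_(mu <- t) zeta ^+ row_sum mu)) /=.
by apply: eq_bigr => lam _; rewrite GT_sum_chain mulr_sumr.
Qed.

End DiagonalBijection.

(** * Summing over the central diagonal *)

Lemma gauss_bin_small zeta j x : (x < j)%N -> gauss_bin zeta j x = 0.
Proof.
elim: j x => // j IH x xj /=; apply: big1_seq => y /andP[_].
by rewrite mem_index_iota => /andP[_ yx]; rewrite IH ?mulr0 //; lia.
Qed.

Lemma gauss_binn zeta j : gauss_bin zeta j j = zeta ^+ (\sum_(i < j) i)%N.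
Proof.
elim: j => [|j IH]; first by rewrite big_ord0.
rewrite /= big_nat_recr //= IH big_ord_recr /= [in RHS]addnC exprD big1_seq ?add0r //.
by move=> y /andP[_]; rewrite mem_index_iota => /andP[_ yx]; rewrite gauss_bin_small ?mulr0.
Qed.

Definition val_at q X (y : {ffun 'I_q -> 'I_X}) (i : nat) : nat :=
  if insub i is Some o then y o else 0%N.

Lemma val_atE q X (y : {ffun 'I_q -> 'I_X}) (i : 'I_q) : val_at y i = y i.
Proof. by rewrite /val_at valK. Qed.

(** The points K - y_0, ..., K - y_(q-1), then K / 2 if e holds, then
y_0, ..., y_(q-1): up to order, the arguments l_i of a self-complementary
central diagonal. Indeed lam_i + lam_(m-1-i) = h gives l_i + l_(m-1-i) = K. *)
Definition paired_point K q (e : bool) X (y : {ffun 'I_q -> 'I_X}) (i : nat) : nat :=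
  if (i < q)%N then (K - val_at y i)%N
  else if (i < q + e)%N then K./2 else val_at y (i - (q + e)).

Section Center.
Variables (h q f : nat) (e : bool).
Hypothesis he : e -> ~~ odd h.
Local Notation m := (q + (e + q))%N.
Local Notation N := (m + f)%N.
Local Notation X := (h + N)%N.
Local Notation K := (h + m + f + f).-1.
Local Notation T := (gt_row N h).
Local Notation Y := {ffun 'I_q -> 'I_X}.

Lemma strict_of_center_lt (lam : T) (i : 'I_q) : (entry lam i + (N - i.+1) < X)%N.
Proof. by have := entry_le lam i; have := ltn_ord i; lia. Qed.

(** The upper half of the central diagonal determines the lower one, so only its q
arguments l_i are kept. *)
Definition strict_of_center (lam : T) : Y := [ffun i => Ordinal (strict_of_center_lt lam i)].

Definition center_of_strict_fun (y : Y) (i : nat) : nat :=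
  if (i < q)%N then (val_at y i - (N - i.+1))%N else
  if (i < q + e)%N then h./2 else
  if (i < m)%N then (h - (val_at y (m - i.+1) - (N - (m - i))))%N else 0%N.

Definition center_of_strict (y : Y) : T := [ffun i : 'I_N => inord (center_of_strict_fun y i)].

(** For a decreasing sequence this only concerns the last entry, where it says that
the smallest height in the upper half of the diagonal is at least h / 2. *)
Definition above_middle (y : Y) := [forall i, (K < (y i).*2)%N].

Lemma val_at_strict_of_center lam i : (i < q)%N -> val_at (strict_of_center lam) i = (entry lam i + (N - i.+1))%N.
Proof. by move=> iq; rewrite -[i]/(val (Ordinal iq)) val_atE ffunE. Qed.

Lemma entry_center_of_strict y i : (forall i, center_of_strict_fun y i <= h)%N -> entry (center_of_strict y) i = center_of_strict_fun y i.
Proof.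
move=> yh; case: (ltnP i N) => [iN|Ni]; last first.
  by rewrite entry_out // /center_of_strict_fun !ifF //; lia.
by rewrite -[i]/(val (Ordinal iN)) entryE ffunE inordK // ltnS.
Qed.

Lemma strict_of_centerK lam : center lam -> center_of_strict (strict_of_center lam) = lam.
Proof.
move=> /centerP[c1 c2 c3].
have E i : center_of_strict_fun (strict_of_center lam) i = entry lam i.
  rewrite /center_of_strict_fun; case: ifP => iq; first by rewrite val_at_strict_of_center // addnK.
  case: ifP => ie.
    have im : (i < m)%N by lia.
    have := c2 i im; have -> : (m - i.+1 = i)%N by lia.
    by have := he; lia.
  case: ifP => im; last by rewrite c3 //; lia.
  rewrite val_at_strict_of_center; last by lia.
  by have := c2 i im; lia.
apply/ffunP => i; apply: val_inj => /=; rewrite -!entryE entry_center_of_strict //.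
by move=> j; rewrite E entry_le.
Qed.

Lemma center_of_strictK y : strictly_decreasing y -> above_middle y -> center (center_of_strict y) /\ strict_of_center (center_of_strict y) = y.
Proof.
move=> /strictly_decreasingP sd /forallP ty.
have yl i : (i < q)%N -> (K < (val_at y i).*2)%N.
  by move=> iq; have := ty (Ordinal iq); rewrite -val_atE.
have yX i : (i < q)%N -> (val_at y i < X)%N.
  by move=> iq; rewrite -[i]/(val (Ordinal iq)) val_atE.
have ys i : (i.+1 < q)%N -> (val_at y i.+1 < val_at y i)%N.
  move=> iq; have := sd (Ordinal (ltnW iq)) (Ordinal iq) (ltnSn i).
  by rewrite -!val_atE.
(* As y decreases strictly, y_i is at most X - 1 - i, and exceeds K / 2 by at least
   q - 1 - i; this makes the recovered heights lie between 0 and h. *)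
have yU i : (i < q)%N -> (val_at y i + i < X)%N.
  elim: i => [|i IH] iq; first by rewrite addn0 yX.
  by have := IH (ltnW iq); have := ys i iq; lia.
have yL i : (i < q)%N -> (K < (val_at y i - (q - i.+1)).*2)%N.
  move=> iq; have -> : (i = q - (q - i.+1).+1)%N by lia.
  have : (q - i.+1 < q)%N by lia.
  elim: (q - i.+1)%N => [|k IH] kq; first by have := yl (q - 1)%N ltac:(lia); lia.
  have := IH (ltnW kq); have := ys (q - k.+2)%N ltac:(lia).
  have -> : ((q - k.+2).+1 = q - k.+1)%N by lia.
  by lia.
have yh i : (center_of_strict_fun y i <= h)%N.
  rewrite /center_of_strict_fun; case: ifP => iq; first by have := yU i iq; lia.
  by case: ifP => _; [lia|case: ifP => _; lia].
split; last first.
  apply/ffunP => i; apply: val_inj; rewrite ffunE /= entry_center_of_strict // -val_atE.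
  rewrite /center_of_strict_fun ltn_ord.
  by have := yL i (ltn_ord i); have := ltn_ord i; lia.
apply/centerP; split=> i; rewrite !entry_center_of_strict // /center_of_strict_fun.
- case: (ltnP i q) => iq; case: (ltnP i.+1 q) => iq1; try (by lia).
  + by have := ys i iq1; lia.
  + case: ifP => ie; first by have := yL i iq; have := he; lia.
    case: ifP => // im.
    have -> : (m - i.+2 = i)%N by lia.
    by have := yL i iq; lia.
  + case: (ltnP i (q + e)) => ie; case: (ltnP i.+1 (q + e)) => ie1; try (by lia).
      case: ifP => im; last by lia.
      have -> : (m - i.+2 = q.-1)%N by lia.
      by have := yL q.-1 ltac:(lia); have := he; lia.
    case: (ltnP i m) => im; case: (ltnP i.+1 m) => im1; try (by lia).
    have := ys (m - i.+2)%N ltac:(lia).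
    have := yL (m - i.+1)%N ltac:(lia).
    have -> : ((m - i.+2).+1 = m - i.+1)%N by lia.
    by lia.
- move=> im; case: (ltnP i q) => iq /=.
    rewrite ifF; last by lia.
    rewrite ifF; last by lia.
    rewrite ifT; last by lia.
    have -> : (m - (m - i.+1).+1 = i)%N by lia.
    by have := yU i iq; lia.
  case: (ltnP i (q + e)) => ie /=.
    rewrite ifF; last by lia.
    by rewrite ifT; have := he; lia.
  rewrite im ifT; last by lia.
  by have := yU (m - i.+1)%N ltac:(lia); lia.
- by move=> mi; rewrite !ifF //; lia.
Qed.

Lemma strict_of_center_above lam : center lam -> strictly_decreasing (strict_of_center lam) && above_middle (strict_of_center lam).
Proof.
move=> /centerP[c1 c2 c3].
have mono i j : (i <= j)%N -> (entry lam j <= entry lam i)%N.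
  move=> ij; rewrite -(subnKC ij); elim: (j - i)%N => [|d IH]; first by rewrite addn0.
  by rewrite addnS (leq_trans (c1 _)).
apply/andP; split.
  apply/strictly_decreasingP => i j ij; rewrite !ffunE /=.
  have := mono i j (ltnW ij); have := ltn_ord j; lia.
apply/forallP => i; rewrite ffunE /=.
have := c2 i ltac:(have := ltn_ord i; lia).
have := mono i (m - i.+1)%N ltac:(have := ltn_ord i; lia).
by have := ltn_ord i; lia.
Qed.

Lemma sum_center (F : T -> rat) :
  \sum_(lam | center lam) F lam = \sum_(y | strictly_decreasing y && above_middle y) F (center_of_strict y).
Proof.
rewrite (reindex_onto center_of_strict strict_of_center); last exact: strict_of_centerK.
apply: eq_bigl => y; apply/andP/andP => [[cy /eqP<-]|[sy ty]].
  by apply/andP/strict_of_center_above.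
by have [-> ->] := center_of_strictK sy ty.
Qed.

(** The diagonal vanishes beyond index m, so its last f arguments are the constants
f - 1, ..., 0, on which the Gaussian binomials of index below f are
triangular and those of index at least f vanish. Expanding along these rows
leaves the columns f, ..., f + m - 1. *)
Lemma frozen_det (zeta : rat) : exists b : bool, exists k : nat,
  forall y : Y, strictly_decreasing y -> above_middle y ->
  \det (\matrix_(i < N, j < N) gauss_bin zeta j (entry (center_of_strict y) i + (N - i.+1))) =
  (-1) ^+ b * zeta ^+ k *
  \det (\matrix_(i < m, j < m) gauss_bin zeta (f + j) (paired_point K e y i)).
Proof.
(* The rows are reordered as required by paired_point, with the frozen rows last;
   the columns with index below f are moved behind the others. *)
pose rn (i : nat) : nat := (if i < q then m - i.+1 else if i < q + e then q
  else if i < m then i - (q + e) else N - (i - m).+1)%N.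
have rP (i : 'I_N) : (rn i < N)%N by rewrite /rn; have := ltn_ord i; do !case: ifP => ?; lia.
have cP (j : 'I_N) : ((if (j < m)%N then (f + j)%N else (j - m)%N) < N)%N.
  by have := ltn_ord j; case: ifP; lia.
pose r i := Ordinal (rP i); pose c j := Ordinal (cP j).
have rI : injective r.
  move=> i j /(congr1 val) /=; rewrite /rn => eq; apply: val_inj => /=.
  by have := ltn_ord i; have := ltn_ord j; move: eq; do !case: ifP; lia.
have cI : injective c.
  move=> i j /(congr1 val) /= eq; apply: val_inj => /=.
  by have := ltn_ord i; have := ltn_ord j; move: eq; do !case: ifP; lia.
have [b Hb] := det_mxsub_inj rat rI cI.
have [k Hk] : exists k, \det (\matrix_(i < f, j < f) gauss_bin zeta j i) = zeta ^+ k.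
  rewrite -det_tr (@det_graded _ _ (fun i : 'I_f => i)); last first.
    move=> i j ij le; rewrite !mxE gauss_bin_small // ltn_neqAle le andbT.
    by rewrite eq_sym val_eqE.
  exists (\sum_(i < f) \sum_(j < i) j)%N.
  by rewrite expr_sum; apply: eq_bigr => i _; rewrite !mxE gauss_binn.
exists b, k => y sy ty.
have [cy tK] := center_of_strictK sy ty.
have /centerP[c1 c2 c3] := cy.
have yv i : (i < q)%N -> val_at y i = (entry (center_of_strict y) i + (N - i.+1))%N.
  by move=> iq; rewrite -{1}tK val_at_strict_of_center.
have := Hb (\matrix_(i < N, j < N) gauss_bin zeta j (entry (center_of_strict y) i + (N - i.+1))).
have -> : mxsub r c (\matrix_(i < N, j < N) gauss_bin zeta j (entry (center_of_strict y) i + (N - i.+1)))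
  = block_mx (\matrix_(i < m, j < m) gauss_bin zeta (f + j) (paired_point K e y i))
     (\matrix_(i < m, j < f) gauss_bin zeta j (paired_point K e y i)) 0
     (\matrix_(i < f, j < f) gauss_bin zeta j i).
  have rlow (i : 'I_m) : (entry (center_of_strict y) (rn i) + (N - (rn i).+1) = paired_point K e y i)%N.
    have im := ltn_ord i; rewrite /rn /paired_point.
    case: ifP => iq.
      rewrite yv //; have := c2 i im; have := entry_le (center_of_strict y) i.
      by lia.
    case: ifP => ie.
      have := c2 q ltac:(lia); have -> : (m - q.+1 = q)%N by lia.
      by have := he; lia.
    by rewrite im yv //; lia.
  have rhigh (i : 'I_f) : (entry (center_of_strict y) (rn (m + i)) + (N - (rn (m + i)).+1) = i)%N.
    have im := ltn_ord i; rewrite /rn !ifF; [|by lia..].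
    by rewrite c3; lia.
  apply/matrixP => i j; rewrite !mxE.
  case: (split_ordP i) => i' ->; rewrite !mxE; case: (split_ordP j) => j' ->;
    rewrite !mxE /=; have := ltn_ord j'.
  - by move=> ->; rewrite rlow.
  - by move=> _; rewrite rlow ifF; [congr gauss_bin|]; lia.
  - by move=> ->; rewrite rhigh gauss_bin_small //; have := ltn_ord i'; lia.
  - by move=> _; rewrite rhigh ifF; [congr gauss_bin|]; lia.
rewrite det_ublock Hk => H.
rewrite -[LHS](signrMK b) -H.
by rewrite mulrCA mulrC.
Qed.

End Center.

(** The factors zeta ^+ y_i come from the half of the central diagonal that belongs
to [half_cubes], up to a constant power of zeta. The condition y_i > K / 2 is
put into the weight, so that the sum has the shape of [Cauchy_Binet_sorted]. *)
Lemma sum_center_det (zeta : rat) h q f (e : bool) : zeta ^+ 2 = 1 ->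
  (e -> ~~ odd h) ->
  let m := (q + (e + q))%N in let K := (h + m + f + f).-1 in
  exists b : bool, exists k : nat,
  \sum_(lam : gt_row (m + f) h | center lam)
     zeta ^+ (\sum_(i < m./2) entry lam i)%N * GT_sum zeta (m + f) lam =
  (-1) ^+ b * zeta ^+ k *
  \sum_(y : {ffun 'I_q -> 'I_(h + (m + f))} | strictly_decreasing y)
     (\prod_i if (K < (y i).*2)%N then zeta ^+ y i else 0) *
     \det (\matrix_(i < m, j < m) gauss_bin zeta (f + j) (paired_point K e y i)).
Proof.
move=> z2 he m K.
have [k1 [b1 H1]] := GT_sum_det h z2 (leqnn (m + f)).
have [b2 [k2 H2]] := @frozen_det h q f e he zeta.
pose k3 := (\sum_(i < q) (m + f - i.+1))%N.
exists (b1 (+) b2), (k1 + k2 + k3)%N.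
rewrite (sum_center he) big_mkcondr /= mulr_sumr; apply: eq_bigr => y sy.
case: ifP => [ty|/negbT]; last first.
  rewrite negb_forall => /existsP[i /negbTE yi].
  by rewrite (bigD1 i) //= yi !mul0r mulr0.
have [cy tK] := center_of_strictK he sy ty; have /centerP[c1 c2 c3] := cy.
rewrite H1; last by move=> i _; apply: c1.
rewrite (H2 y sy ty).
have -> : m./2 = q by rewrite /m; lia.
have -> : (\prod_i if (K < (y i).*2)%N then zeta ^+ y i else 0) =
   zeta ^+ (\sum_(i < q) entry (center_of_strict y) i)%N * zeta ^+ k3.
  rewrite -exprD -big_split expr_sum; apply: eq_bigr => i _ /=.
  by rewrite (forallP ty i) -{1}tK ffunE.
rewrite signr_addb !exprD.
have z3 : zeta ^+ k3 * zeta ^+ k3 = 1 by rewrite -expr2 -exprM mulnC exprM z2 expr1n.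
move: (\det _) (zeta ^+ (\sum_(_ < _) _)) => d z'.
move: z3; move: (zeta ^+ k3) (zeta ^+ k1) (zeta ^+ k2) => c a' b' cc.
by rewrite -[LHS]mulr1 -cc; ring.
Qed.

Lemma gauss_binS zeta j x : gauss_bin zeta j.+1 x.+1 = gauss_bin zeta j.+1 x + zeta ^+ x * gauss_bin zeta j x.
Proof. by rewrite /= big_nat_recr. Qed.

Lemma gauss_bin0S zeta j : gauss_bin zeta j.+1 0 = 0.
Proof. by rewrite /= big_geq. Qed.

Lemma gauss_bin_1 j x : gauss_bin 1 j x = 'C(x, j)%:R.
Proof.
elim: j x => [|j IH] x; first by rewrite bin0.
elim: x => [|x IHx]; first by rewrite gauss_bin0S.
by rewrite gauss_binS IHx IH expr1n mul1r binS natrD.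
Qed.

(** * Gaussian binomials at 1 and -1, and paired rows *)

(** The q-Lucas theorem at q = -1. *)
Lemma gauss_bin_N1 i x : gauss_bin (-1) i.*2 x = (-1) ^+ i * 'C(x./2, i)%:R /\
  gauss_bin (-1) i.*2.+1 x = (-1) ^+ i * ((odd x)%:R * 'C(x./2, i)%:R).
Proof.
have odd_of_even j : (forall x, gauss_bin (-1) j.*2 x = (-1) ^+ j * 'C(x./2, j)%:R) ->
    forall x, gauss_bin (-1) j.*2.+1 x = (-1) ^+ j * ((odd x)%:R * 'C(x./2, j)%:R).
  move=> IH; elim=> [|y IHy]; first by rewrite gauss_bin0S /= mul0r mulr0.
  rewrite gauss_binS IHy IH -[(-1) ^+ y]signr_odd /= uphalf_half.
  by case: (odd y); rewrite /= ?add0n ?expr1 ?expr0; ring.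
elim: i x => [|i IH] x; first by split; [rewrite bin0 mulr1|apply: odd_of_even => // y; rewrite bin0 mulr1].
have IH1 y := proj2 (IH y).
have E y : gauss_bin (-1) i.+1.*2 y = (-1) ^+ i.+1 * 'C(y./2, i.+1)%:R.
  rewrite doubleS; elim: y => [|y IHy]; first by rewrite gauss_bin0S /= mulr0.
  rewrite gauss_binS IHy IH1 -[(-1) ^+ y]signr_odd /= uphalf_half exprS.
  case: (odd y); rewrite /= ?add0n ?add1n ?expr1 ?expr0 ?binS ?natrD; ring.
by split; [apply: E|apply: odd_of_even].
Qed.

(** Subtract the row of K - y from the row of y. This kills the first q + e columns,
which are symmetric, in the lower rows; the middle row keeps only the column q
among these. What is left is block triangular. *)
Lemma det_paired_rows K q (e : bool) X (y : {ffun 'I_q -> 'I_X}) (g : nat -> nat -> rat) :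
  (forall (i : 'I_q) j, (j < q + e)%N -> g j (K - y i)%N = g j (y i)) ->
  (e -> g q K./2 = 1 /\ forall j, (j < q)%N -> g j K./2 = 0) ->
  \det (\matrix_(i < q + (e + q), j < q + (e + q)) g j (paired_point K e y i)) =
  \det (\matrix_(i < q, j < q) g j (y i)) *
  \det (\matrix_(i < q, j < q) (g (q + e + j)%N (y i) - g (q + e + j)%N (K - y i)%N)).
Proof.
move=> gsym gmid.
set M := (X in \det X = _).
pose L : 'M[rat]_(q + (e + q)) := block_mx 1%:M 0 (col_mx 0 (- 1%:M)) 1%:M.
have detL : \det L = 1 by rewrite det_lblock !det1 mulr1.
rewrite -[LHS]mul1r -detL -det_mulmx.
pose Mt := \matrix_(i < q, j < q + (e + q)) g j (K - y i)%N.
pose Mr := \matrix_(i < e + q, j < q + (e + q)) g j (paired_point K e y (q + i)).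
have ME : M = col_mx Mt Mr.
  apply/matrixP => i j; rewrite !mxE; case: (split_ordP i) => i' ->; rewrite !mxE //=.
  by rewrite /paired_point ltn_ord val_atE.
pose D := block_mx (1%:M : 'M[rat]_e)
   (\matrix_(i < e, j < q) g (q + e + j)%N K./2) 0
   (\matrix_(i < q, j < q) (g (q + e + j)%N (y i) - g (q + e + j)%N (K - y i)%N)).
have -> : L *m M = block_mx (\matrix_(i < q, j < q) g j (y i))
   (\matrix_(i < q, j < e + q) g (q + j)%N (K - y i)%N) 0 D.
  rewrite ME /L mul_block_col mul1mx mul0mx addr0 mul1mx mul_col_mx mul0mx mulNmx mul1mx.
  rewrite /block_mx; congr col_mx; apply/matrixP => i j.
    case: (split_ordP j) => j' ->; rewrite ?row_mxEl ?row_mxEr !mxE //=.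
    by rewrite gsym //; have := ltn_ord j'; lia.
  rewrite mxE; case: (split_ordP i) => k ->; rewrite ?col_mxEu ?col_mxEd [X in X + _]mxE [X in _ + X]mxE /=.
    have ee : e by case: (e) k => // -[].
    have k0 : (k = 0 :> nat)%N by have := ltn_ord k; rewrite {2}ee; lia.
    have [gm1 gm0] := gmid ee.
    have -> : paired_point K e y (q + k) = K./2.
      by rewrite /paired_point k0 addn0 ltnn ifT // ee addn1.
    rewrite add0r; case: (split_ordP j) => j' ->; rewrite ?row_mxEl ?row_mxEr.
      by rewrite mxE /= gm0.
    rewrite col_mxEu; case: (split_ordP j') => l ->; rewrite ?row_mxEl ?row_mxEr !mxE /=.
      have l0 : (l = 0 :> nat)%N by have := ltn_ord l; rewrite {2}ee; lia.
      by rewrite l0 addn0 gm1 -val_eqE /= k0 l0.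
    by rewrite addnA.
  have -> : paired_point K e y (q + (e + k)) = y k.
    by rewrite /paired_point !ifF ?addnA ?addKn ?val_atE //; lia.
  rewrite mxE; case: (split_ordP j) => j' ->; rewrite ?row_mxEl ?row_mxEr.
    by rewrite !mxE /= gsym ?addNr //; have := ltn_ord j'; lia.
  rewrite col_mxEd; case: (split_ordP j') => l ->; rewrite ?row_mxEl ?row_mxEr !mxE /=.
    by rewrite gsym ?addNr //; have := ltn_ord l; lia.
  by rewrite addnA addrC.
by rewrite !det_ublock det1 mul1r.
Qed.

(** Row i has class kap i and evaluation point xi i, and a column vanishes on rows
of another class. When the degrees in each class are 0, 1, 2, ... without gaps,
passing to monomials is a change of basis inside each class that is triangular
with the leading coefficients on its diagonal. So two families of polynomials
with the same degrees give determinants that differ by a known factor. *)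
Lemma det_class_poly n (cl : 'I_n -> bool) (d : 'I_n -> nat) (P : 'I_n -> {poly rat})
    (kap : 'I_n -> bool) (xi : 'I_n -> rat) :
  (forall i j, cl i = cl j -> d i = d j -> i = j) ->
  (forall i k, (k < d i)%N -> exists2 j, cl j = cl i & d j = k) ->
  (forall i, size (P i) = (d i).+1) ->
  \det (\matrix_(i, j) ((kap i == cl j)%:R * (P j).[xi i])) =
  (\prod_i lead_coef (P i)) *
  \det (\matrix_(i, j) ((kap i == cl j)%:R * xi i ^+ d j)).
Proof.
move=> inj down sz.
pose C := \matrix_(k, j) ((cl k == cl j)%:R * (P j)`_(d k)).
have <- : \det C = \prod_i lead_coef (P i).
  rewrite (@det_graded _ _ d) => [|i j ij le].
    by apply: eq_bigr => i _; rewrite !mxE eqxx mul1r lead_coefE sz.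
  rewrite mxE; case: eqP => [eqc|]; last by rewrite mul0r.
  rewrite mul1r nth_default // sz ltn_neqAle le andbT.
  by apply: contra ij => /eqP eqd; apply/eqP/inj.
rewrite mulrC -det_mulmx; congr (\det _); apply/matrixP => i j; rewrite !mxE.
under [RHS]eq_bigr do rewrite !mxE.
case: (kap i =P cl j) => [kj|kj]; last first.
  rewrite mul0r big1 // => k _; case: (kap i =P cl k) => [ki|]; last by rewrite !mul0r.
  by rewrite -ki; case: eqP => // _; rewrite mul0r mulr0.
rewrite mul1r horner_coef sz kj.
rewrite (bigID (fun k => (cl k == cl j) && (d k <= d j)%N)) /= [X in _ = _ + X]big1 ?addr0.
  rewrite [RHS](eq_bigr (fun k => (P j)`_(d k) * xi i ^+ d k)); last first.
    by move=> k /andP[/eqP-> _]; rewrite eqxx !mul1r mulrC.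
  have dP k : (minn (d k) (d j) < (d j).+1)%N by rewrite ltnS geq_minr.
  rewrite [RHS](reindex_onto (fun k : 'I_(d j).+1 =>
     if [pick l | (cl l == cl j) && (d l == k)] is Some l then l else j)
     (fun k => Ordinal (dP k))) /=; last first.
    move=> k /andP[/eqP ck dk]; case: pickP => [l /andP[/eqP cl' /eqP dl]|/(_ k)].
      by apply: inj; rewrite ?ck // dl; apply/minn_idPl.
    by rewrite ck eqxx /= (minn_idPl dk) eqxx.
  apply: eq_big => [k|k _].
    symmetry; case: pickP => [l /andP[cl' /eqP dl]|no].
      have kd : (k <= d j)%N by rewrite -ltnS.
      by rewrite cl' -val_eqE /= dl kd (minn_idPl kd) eqxx.
    have kdj : (k < d j)%N \/ k = d j :> nat.
      by have := ltn_ord k; rewrite ltnS leq_eqVlt => /orP[/eqP|]; [right|left].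
    case: kdj => [kdj|kdj].
      by have [l cl' dl] := down _ _ kdj; have := no l; rewrite cl' dl !eqxx.
    by have := no j; rewrite kdj !eqxx.
  case: pickP => [l /andP[_ /eqP->]//|no].
  have kdj : (k < d j)%N \/ k = d j :> nat.
    by have := ltn_ord k; rewrite ltnS leq_eqVlt => /orP[/eqP|]; [right|left].
  case: kdj => [kdj|->//].
  by have [l cl' dl] := down _ _ kdj; have := no l; rewrite cl' dl !eqxx.
move=> k; case: eqP => [ck|]; last by rewrite mul0r mulr0.
by rewrite /= -ltnNge => dk; rewrite nth_default ?mulr0 // sz.
Qed.

(** * Symmetric and antisymmetric polynomial bases *)

(** Symmetric under x -> K - x, and zero at K / 2 if e holds. The roots -1, ..., -i
and K + 1, ..., K + i are chosen to extend the falling factorials x ^_ f and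
(K - x) ^_ f in [sym_anti_prod]. *)
Definition sym_poly (K : nat) (e : bool) (i : nat) : {poly rat} :=
  ('X - (K%:R / 2)%:P) ^+ (e.*2) *
  \prod_(k < i) (('X + (k.+1%:R)%:P) * ('X - ((K + k.+1)%:R)%:P)).

(** Symmetric as well; 'X times it has odd degree, and its antisymmetric part is
(2 'X - K) / 2 times it. The roots again extend the falling factorials, this
time at their other end. *)
Definition anti_poly (K f : nat) (j : nat) : {poly rat} :=
  \prod_(k < j) (('X - ((f + k)%:R)%:P) * ('X - (K%:R - (f + k)%:R)%:P)).

(** The factor by which x ^_ f has to be multiplied to become x ^_ (f + j). *)
Definition fall_poly (f j : nat) : {poly rat} :=
  \prod_(k < j) ('X - ((f + k)%:R)%:P).

Definition monic_deg (p : {poly rat}) (d : nat) := (p \is monic) && (size p == d.+1).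

Lemma monic_degM p q a b : monic_deg p a -> monic_deg q b -> monic_deg (p * q) (a + b).
Proof.
move=> /andP[pm /eqP ps] /andP[qm /eqP qs]; apply/andP; split; first by rewrite monicMl.
by rewrite size_monicM ?monic_neq0 // ps qs addnS.
Qed.

Lemma monic_deg_prod n (p : nat -> {poly rat}) a :
  (forall k, monic_deg (p k) a) -> monic_deg (\prod_(k < n) p k) (n * a).
Proof.
move=> pa; elim: n => [|n IH]; first by rewrite big_ord0 /monic_deg monic1 size_poly1 eqxx.
by rewrite big_ord_recr mulSn addnC monic_degM.
Qed.

Lemma monic_degX c : monic_deg ('X - c%:P) 1.
Proof. by rewrite /monic_deg monicXsubC size_XsubC eqxx. Qed.

Lemma monic_degXn c n : monic_deg (('X - c%:P) ^+ n) n.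
Proof.
elim: n => [|n IH]; first by rewrite expr0 /monic_deg monic1 size_poly1 eqxx.
by rewrite exprS -add1n monic_degM ?monic_degX.
Qed.

Lemma sym_poly_deg K e i : monic_deg (sym_poly K e i) (e.*2 + i.*2).
Proof.
rewrite /sym_poly -[i.*2]muln2 monic_degM ?monic_degXn //.
apply: (monic_deg_prod _ (p := fun k => ('X + (k.+1%:R)%:P) * ('X - ((K + k.+1)%:R)%:P))).
move=> k; rewrite -[2%N]/(1 + 1)%N monic_degM ?monic_degX //.
by rewrite -[_%:P]opprK -polyCN monic_degX.
Qed.

Lemma anti_poly_deg K f j : monic_deg ('X * anti_poly K f j) j.*2.+1.
Proof.
rewrite -add1n -muln2 monic_degM //.
  by rewrite -['X]subr0 -polyC0 monic_degX.
apply: (monic_deg_prod _ (p := fun k => ('X - ((f + k)%:R)%:P) * ('X - (K%:R - (f + k)%:R)%:P))).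
by move=> k; rewrite -[2%N]/(1 + 1)%N monic_degM ?monic_degX.
Qed.

Lemma fall_poly_deg f j : monic_deg (fall_poly f j) j.
Proof.
rewrite -[X in monic_deg _ X]muln1.
by apply: (monic_deg_prod _ (p := fun k => 'X - ((f + k)%:R)%:P)) => k; apply: monic_degX.
Qed.

Lemma sym_polyE K e i (a b : rat) : a + b = K%:R ->
  (sym_poly K e i).[a] = (sym_poly K e i).[b].
Proof.
move=> ab; have -> : a = K%:R - b by rewrite -ab addrK.
rewrite /sym_poly !hornerM !horner_exp !horner_prod !hornerE; congr (_ * _).
  by case: e => //=; rewrite ?expr0 //; field.
by apply: eq_bigr => k _; rewrite !hornerE !natrD; ring.
Qed.

Lemma anti_polyE K f j (a b : rat) : a + b = K%:R ->
  (anti_poly K f j).[a] = (anti_poly K f j).[b].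
Proof.
move=> ab; have -> : a = K%:R - b by rewrite -ab addrK.
rewrite /anti_poly !horner_prod.
by apply: eq_bigr => k _; rewrite !hornerE; ring.
Qed.

Lemma ffact_natr n k : (n ^_ k)%:R = \prod_(i < k) (n%:R - i%:R) :> rat.
Proof.
elim: k => [|k IH]; first by rewrite big_ord0.
rewrite big_ord_recr ffactnSr natrM IH /=; case: (leqP k n) => kn; first by rewrite natrB.
by rewrite (bigD1 (Ordinal kn)) //= subrr !mul0r.
Qed.

Lemma bin_fall (n f j : nat) :
  'C(n, f + j)%:R = (n ^_ f)%:R * ((f + j)`!%:R^-1 * (fall_poly f j).[n%:R]) :> rat.
Proof.
have nz : ((f + j)`!)%:R != 0 :> rat by rewrite pnatr_eq0 -lt0n fact_gt0.
apply: (mulIf nz); rewrite -natrM bin_ffact ffact_natr big_split_ord /= -ffact_natr.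
have -> : (fall_poly f j).[n%:R] = \prod_(i < j) (n%:R - (f + i)%:R).
  by rewrite /fall_poly horner_prod; apply: eq_bigr => k _; rewrite !hornerE.
by move: nz (\prod_(i < j) _) => nz P; field.
Qed.

Ltac col_cases := repeat match goal with
  | |- context [if (?a < ?b)%N then _ else _] => case: (ltnP a b) => ? /=
  | |- context [if (?a <= ?b)%N then _ else _] => case: (leqP a b) => ? /=
  end.

(** * Sums over paired points *)

(** The points x <= K are divided into two classes by cl, and xi x is a coordinate
of x inside its class. The reflection x -> K - x preserves cl and acts inside class
c as the reflection of [0, Kc c]. With one class and xi = id this covers the
unsigned sum; with the parity as class and xi = half it covers the signed sum for
even K. *)
Section PairedSum.
Variables (K X : nat) (cl : nat -> bool) (xi : nat -> nat).
Variables (Kc fc qc : bool -> nat) (ec : bool -> bool).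
Hypothesis XK : (X <= K.+1)%N.
Hypothesis cl_sym : forall x, (x <= K)%N -> cl (K - x) = cl x.
Hypothesis xi_sym : forall x, (x <= K)%N -> (xi x + xi (K - x) = Kc (cl x))%N.
Hypothesis ec1 : ~~ (ec false && ec true).
Hypothesis mid : ec false || ec true ->
  cl K./2 = ec true /\ (xi K./2).*2 = Kc (ec true).

Local Notation e := (ec false || ec true).
Local Notation q := (qc false + qc true)%N.
Local Notation mc c := ((qc c).*2 + ec c)%N.
Local Notation m := (q + (e + q))%N.

(** The columns of class false come first. The number of columns of class c is twice
the number qc c of pairs of points in that class, plus one if the middle point
belongs to it. *)
Definition block_col (j x : nat) : rat :=
  if (j < mc false)%N then (~~ cl x)%:R * 'C(xi x, fc false + j)%:R
  else (cl x)%:R * 'C(xi x, fc true + (j - mc false))%:R.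

Definition moment (c : nat -> rat) (k : bool) : 'M[rat]_(qc k) :=
  \matrix_(i, j) \sum_(x < X | cl x == k) c x *
    ((xi x ^_ fc k)%:R * ((Kc k - xi x) ^_ fc k)%:R) *
    ((sym_poly (Kc k) (ec k) i).[(xi x)%:R] *
     ((2 * (xi x)%:R - (Kc k)%:R) * (anti_poly (Kc k) (fc k) j).[(xi x)%:R])).

(** The product of the leading coefficients of the binomial columns of class k. *)
Definition inv_facts (k : bool) : rat := \prod_(j < mc k) ((fc k + j)`!%:R)^-1.

(** The falling factorial that the middle row contributes when its point is in
class k. *)
Definition mid_weight (k : bool) : rat := if ec k then ((Kc k)./2 ^_ fc k)%:R else 1.

(** The src_ functions describe the columns of [block_col]; the tgt_ functions those
needed for [det_paired_rows]: q symmetric ones, a constant one for the middle row,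
and q of odd degree. *)
Let tgt_class (j : nat) : bool :=
  if (j < q)%N then (qc false <= j)%N else
  if (j < q + e)%N then ec true else (qc false <= j - (q + e))%N.
Let tgt_poly (j : nat) : {poly rat} :=
  if (j < q)%N then
    (if (j < qc false)%N then sym_poly (Kc false) (ec false) j
     else sym_poly (Kc true) (ec true) (j - qc false))
  else if (j < q + e)%N then 1
  else if (j - (q + e) < qc false)%N
       then 'X * anti_poly (Kc false) (fc false) (j - (q + e))
       else 'X * anti_poly (Kc true) (fc true) (j - (q + e) - qc false).
Let tgt_deg (j : nat) : nat :=
  (if j < q then
    (if j < qc false then (ec false).*2 + j.*2
     else (ec true).*2 + (j - qc false).*2)
  else if j < q + e then 0
  else if j - (q + e) < qc false then (j - (q + e)).*2.+1
       else (j - (q + e) - qc false).*2.+1)%N.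
Let src_class (j : nat) : bool := (mc false <= j)%N.
Let src_deg (j : nat) : nat := if (j < mc false)%N then j else (j - mc false)%N.
Let src_poly (j : nat) : {poly rat} :=
  ((fc (src_class j) + src_deg j)`!%:R)^-1 *: fall_poly (fc (src_class j)) (src_deg j).
Let tgt_to_src (j : nat) : nat := if tgt_class j then (mc false + tgt_deg j)%N else tgt_deg j.
Let weight (x : nat) : rat := (xi x ^_ fc (cl x))%:R.

Lemma ec_cases : (ec false, ec true) = (false, false) \/
  (ec false, ec true) = (true, false) \/ (ec false, ec true) = (false, true).
Proof. by move: ec1; case: (ec false) (ec true) => -[] //= _; tauto. Qed.

Lemma tgt_to_src_spec (j : nat) : (j < m)%N ->
  [/\ (tgt_to_src j < m)%N, src_class (tgt_to_src j) = tgt_class j & src_deg (tgt_to_src j) = tgt_deg j].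
Proof.
rewrite /tgt_to_src /src_class /src_deg /tgt_class /tgt_deg.
by case: ec_cases => [[-> ->]|[[-> ->]|[-> ->]]] /= jm; col_cases; split; lia.
Qed.

Lemma tgt_deg_inj (i j : nat) : (i < m)%N -> (j < m)%N ->
  tgt_class i = tgt_class j -> tgt_deg i = tgt_deg j -> i = j.
Proof.
rewrite /tgt_class /tgt_deg.
by case: ec_cases => [[-> ->]|[[-> ->]|[-> ->]]] /= im jm; col_cases; lia.
Qed.

Lemma tgt_poly_deg (j : nat) : monic_deg (tgt_poly j) (tgt_deg j).
Proof.
rewrite /tgt_poly /tgt_deg; do !case: ifP => _; rewrite ?sym_poly_deg ?anti_poly_deg //.
by rewrite /monic_deg monic1 size_poly1 eqxx.
Qed.

Lemma block_colE (j x : nat) :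
  block_col j x = weight x * ((cl x == src_class j)%:R * (src_poly j).[(xi x)%:R]).
Proof.
rewrite /block_col /weight /src_poly /src_deg /src_class [(_ + _ <= j)%N]leqNgt; case: ifP => jm /=;
rewrite ?eqb_id ?eqbF_neg;
case: (cl x); rewrite /= ?mul0r ?mulr0 // !mul1r bin_fall hornerZ //.
Qed.

Local Notation D y := (\det (\matrix_(i < m, j < m) block_col j (paired_point K e y i))).

Definition sym_col (j x : nat) : rat := (cl x == tgt_class j)%:R * (tgt_poly j).[(xi x)%:R].

Lemma lead_prod : \prod_(i < m) lead_coef (src_poly i) = inv_facts false * inv_facts true.
Proof.
rewrite (eq_bigr (fun i : 'I_m => ((fc (src_class i) + src_deg i)`!%:R)^-1)) => [|i _]; last first.
  rewrite lead_coefZ; have /andP[/monicP-> _] := fall_poly_deg (fc (src_class i)) (src_deg i).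
  by rewrite mulr1.
rewrite -(big_mkord xpredT (fun i => ((fc (src_class i) + src_deg i)`!%:R)^-1)).
have mE : m = (mc false + mc true)%N by case: ec_cases => [[-> ->]|[[-> ->]|[-> ->]]] /=; lia.
rewrite mE (big_cat_nat (n := mc false)) ?leq_addr //=; congr (_ * _).
  rewrite big_mkord; apply: eq_bigr => i _.
  by rewrite /src_class /src_deg ltn_ord leqNgt ltn_ord.
rewrite -{1}[mc false]add0n big_addn addKn big_mkord; apply: eq_bigr => i _.
by rewrite /src_class /src_deg leq_addl ltnNge leq_addl /= addnK.
Qed.

Lemma mid_prod : \prod_(i < e) weight K./2 = mid_weight false * mid_weight true.
Proof.
have := mid; rewrite /mid_weight /weight; case: ec_cases => [[-> ->]|[[-> ->]|[-> ->]]] /=.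
- by rewrite big_ord0 mulr1.
- by case=> // -> <-; rewrite big_ord1 doubleK mulr1.
- by case=> // -> <-; rewrite big_ord1 doubleK mul1r.
Qed.

Lemma sym_col_sym j x : (j < q + e)%N -> (x <= K)%N -> sym_col j (K - x) = sym_col j x.
Proof.
move=> jq xK; rewrite /sym_col cl_sym //; case: eqP => [cx|]; last by rewrite !mul0r.
congr (_ * _); have := xi_sym xK; move: cx => -> => xs.
have hs : (xi (K - x))%:R + (xi x)%:R = (Kc (tgt_class j))%:R :> rat by rewrite -xs natrD addrC.
move: hs; rewrite /tgt_poly /tgt_class; case: ifP => jq1; last by rewrite jq !hornerE.
by rewrite leqNgt; case: ifP => /= _ hs; apply: sym_polyE.
Qed.

Lemma sym_col_mid : e -> sym_col q K./2 = 1 /\ forall j, (j < q)%N -> sym_col j K./2 = 0.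
Proof.
move=> ee; have [c0 x0] := mid ee; rewrite /sym_col c0; split.
  have qe : (q < q + e)%N by rewrite ee addn1.
  by rewrite /tgt_class /tgt_poly ltnn qe eqxx mul1r hornerE.
move=> j jq; case: eqP => [ec'|]; last by rewrite mul0r.
rewrite mul1r /tgt_poly jq; move: ec' x0; rewrite /tgt_class jq leqNgt.
have x2 k : ((xi K./2).*2 = Kc k)%N -> (xi K./2)%:R = (Kc k)%:R / 2 :> rat.
  by move=> <-; rewrite -muln2 natrM mulfK.
case: ec_cases ee => [[-> ->]|[[-> ->]|[-> ->]]] //= _; case: ifP => // _ _ /x2 x0;
by rewrite /sym_poly hornerM horner_exp x0 !hornerE subrr expr0n mul0r.
Qed.

(** The binomial columns of each class are exchanged, by [det_class_poly] used twice,
for symmetric polynomials, a constant that detects the middle row, and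
polynomials of odd degree; the degrees are the same up to order. Then
[det_paired_rows] applies. *)
Lemma block_det : exists b : bool, forall y : {ffun 'I_q -> 'I_X},
  D y = (-1) ^+ b * (inv_facts false * inv_facts true) *
    ((\prod_i (weight (y i) * weight (K - y i)%N)) * (mid_weight false * mid_weight true)) *
    (\det (\matrix_(i < q, j < q) sym_col j (y i)) *
     \det (\matrix_(i < q, j < q)
        (sym_col (q + e + j)%N (y i) - sym_col (q + e + j)%N (K - y i)%N))).
Proof.
have pP (j : 'I_m) : (tgt_to_src j < m)%N by case: (tgt_to_src_spec (ltn_ord j)).
pose p j := Ordinal (pP j).
have pI : injective p.
  move=> i j /(congr1 val) /= eq; apply/val_inj.
  have [_ s1 d1] := tgt_to_src_spec (ltn_ord i); have [_ s2 d2] := tgt_to_src_spec (ltn_ord j).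
  by apply: (tgt_deg_inj (ltn_ord i) (ltn_ord j)); rewrite -?s1 -?d1 eq.
have [b Hb] := det_mxsub_inj rat (@inj_id 'I_m) pI.
exists b => y.
pose pt (i : 'I_m) := paired_point K e y i.
have -> : \matrix_(i < m, j < m) block_col j (paired_point K e y i) =
  diag_mx (\row_i weight (pt i)) *m
    \matrix_(i, j) ((cl (pt i) == src_class j)%:R * (src_poly j).[(xi (pt i))%:R]).
  by apply/matrixP => i j; rewrite mul_diag_mx !mxE block_colE.
rewrite det_mulmx det_diag.
have -> : \prod_i (\row_i0 weight (pt i0)) 0 i =
  (\prod_i (weight (y i) * weight (K - y i)%N)) * (mid_weight false * mid_weight true).
  under eq_bigr do rewrite mxE.
  rewrite (@big_split_ord _ _ _ q (e + q)) (@big_split_ord _ _ _ e q) /= -mid_prod.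
  rewrite mulrC -mulrA mulrC big_split /=; congr (_ * _ * _).
  - apply: eq_bigr => i _; rewrite /pt /paired_point /= [(_ < q)%N]ltnNge leq_addr /=.
    by rewrite ltn_add2l [(_ < e)%N]ltnNge leq_addr /= addnA addKn val_atE.
  - by apply: eq_bigr => i _; rewrite /pt /paired_point /= ltn_ord val_atE.
  - apply: eq_bigr => i _; rewrite /pt /paired_point /= [(_ < q)%N]ltnNge leq_addr /=.
    by rewrite ltn_add2l ltn_ord.
rewrite (@det_class_poly m (fun j => src_class j) (fun j => src_deg j) (fun j => src_poly j)
  (fun i => cl (pt i)) (fun i => (xi (pt i))%:R)); first last.
- move=> i; have /andP[_ /eqP sz] := fall_poly_deg (fc (src_class i)) (src_deg i).
  by rewrite size_scale ?sz // invr_eq0 pnatr_eq0 -lt0n fact_gt0.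
- move=> i k ki; have im := ltn_ord i.
  have jm : ((if src_class i then mc false + k else k) < m)%N.
    by move: ki im; rewrite /src_deg /src_class; case: (leqP (mc false) i) => ? /=; lia.
  exists (Ordinal jm); move: ki; rewrite /src_deg /src_class /=; case: (leqP (mc false) i) => ? /= ki;
    rewrite ?leq_addr ?addKn //.
  + by apply/negbTE; rewrite -ltnNge; lia.
  + by rewrite ltnNge leq_addr.
  + by rewrite ifT //; lia.
- move=> i j; rewrite /src_deg /src_class => h1 h2; apply: val_inj => /=; move: h1 h2.
  by case: (leqP (mc false) i) => ?; case: (leqP (mc false) j) => ? //=; lia.
rewrite lead_prod.
set Ms := (X in _ * (_ * \det X)).
have := Hb Ms.
have -> : mxsub id p Ms = \matrix_(i, j) ((cl (pt i) == tgt_class j)%:R * (xi (pt i))%:R ^+ tgt_deg j).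
  by apply/matrixP => i j; rewrite !mxE /=; have [_ -> ->] := tgt_to_src_spec (ltn_ord j).
move=> HM.
have := @det_class_poly m (fun j => tgt_class j) (fun j => tgt_deg j) (fun j => tgt_poly j)
  (fun i => cl (pt i)) (fun i => (xi (pt i))%:R).
rewrite HM big1 => [|i _]; last by have /andP[/monicP] := tgt_poly_deg i.
move=> HT.
have {HT} := HT _ _ _; rewrite mul1r.
have -> : \matrix_(i < m, j < m) ((cl (pt i) == tgt_class j)%:R * (tgt_poly j).[(xi (pt i))%:R]) =
  \matrix_(i < m, j < m) sym_col j (paired_point K e y i) by [].
rewrite det_paired_rows; first last.
- exact: sym_col_mid.
- by move=> i j jq; apply: sym_col_sym => //; rewrite -ltnS (leq_trans (ltn_ord _)).
move=> HT; have -> : \det Ms = (-1) ^+ b *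
   (\det (\matrix_(i < q, j < q) sym_col j (y i)) *
     \det (\matrix_(i < q, j < q)
        (sym_col (q + e + j)%N (y i) - sym_col (q + e + j)%N (K - y i)%N))).
  rewrite HT; first by rewrite signrMK.
  - by move=> i j h1 h2; apply/val_inj/(tgt_deg_inj (ltn_ord i) (ltn_ord j)).
  - move=> i k ki; have [pim sci _] := tgt_to_src_spec (ltn_ord i).
    have sm : ((if tgt_class i then mc false + k else k) < m)%N.
      by apply: leq_ltn_trans pim; rewrite /tgt_to_src; case: (tgt_class i); lia.
    have pjE := congr1 val (f_invF pI (Ordinal sm)); move: pjE => /=.
    set j := invF pI _ => pjE; exists j; have [_ s1 d1] := tgt_to_src_spec (ltn_ord j);
      rewrite -?s1 -?d1 pjE; move: sci; rewrite /src_class /src_deg /tgt_to_src; case: (tgt_class i) => sci //.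
    + by rewrite leq_addr.
    + by apply/negbTE; move/negbT: sci; rewrite -!ltnNge; lia.
    + by rewrite ltnNge leq_addr addKn.
    + by move/negbT: sci; rewrite -ltnNge => sci; rewrite (ltn_trans ki).
  - by move=> i; have /andP[_ /eqP] := tgt_poly_deg i.
move: (\det _) (\det _) (inv_facts false * _) (\prod_i _) (_ * mid_weight _) => s1 s2 s3 s4 s5.
by ring.
Qed.

Lemma sym_colE (k : bool) (j : nat) x :
  (j < qc k)%N -> sym_col ((if k then qc false else 0%N) + j)%N x =
    (cl x == k)%:R * (sym_poly (Kc k) (ec k) j).[(xi x)%:R].
Proof.
move=> jq; rewrite /sym_col /tgt_class /tgt_poly; case: k jq => jq; last first.
  by rewrite add0n jq ltn_addr // leqNgt jq.
by rewrite ltn_add2l jq leq_addr [(_ + j < qc false)%N]ltnNge leq_addr /= addKn.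
Qed.

Lemma anti_colE (k : bool) (j : nat) x : (x <= K)%N -> (j < qc k)%N ->
  let j' := (q + e + ((if k then qc false else 0%N) + j))%N in
  sym_col j' x - sym_col j' (K - x) =
    (cl x == k)%:R * ((2 * (xi x)%:R - (Kc k)%:R) *
      (anti_poly (Kc k) (fc k) j).[(xi x)%:R]).
Proof.
move=> xK jq j'; rewrite /sym_col cl_sym //.
have j'q : (j' < q)%N = false by rewrite /j' -addnA ltnNge leq_addr.
have j'e : (j' < q + e)%N = false by rewrite /j' ltnNge leq_addr.
rewrite /tgt_class /tgt_poly j'q j'e /j' addKn.
have -> : (qc false <= (if k then qc false else 0) + j)%N = k.
  by case: (k) jq => jq; [rewrite leq_addr|rewrite add0n leqNgt jq].
rewrite -mulrBr; case: eqP => [cx|]; last by rewrite !mul0r.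
have hs : (xi (K - x))%:R = (Kc k)%:R - (xi x)%:R :> rat.
  by rewrite -cx -(xi_sym xK) natrD addrC addKr.
have -> : (if ((if k then qc false else 0) + j < qc false)%N then
    'X * anti_poly (Kc false) (fc false) ((if k then qc false else 0) + j)
    else 'X * anti_poly (Kc true) (fc true) ((if k then qc false else 0) + j - qc false))
  = 'X * anti_poly (Kc k) (fc k) j.
  by case: (k) jq => jq; [rewrite ltnNge leq_addr addKn|rewrite add0n jq].
rewrite hs !hornerM hornerX hornerX (@anti_polyE _ _ _ (_ - _) (xi x)%:R) ?subrK //.
by congr (_ * _); ring.
Qed.

(** After [block_det] the sum is a Cauchy-Binet sum, and the resulting matrix is
block diagonal because columns of different classes have disjoint supports. *)
Lemma paired_sum : exists b : bool, forall c : nat -> rat,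
  \sum_(y : {ffun 'I_q -> 'I_X} | strictly_decreasing y) (\prod_i c (y i)) * D y =
  (-1) ^+ b * (inv_facts false * inv_facts true) * (mid_weight false * mid_weight true) *
  (\det (moment c false) * \det (moment c true)).
Proof.
have [b Hb] := block_det; exists b => c.
pose c' x := c x * (weight x * weight (K - x)%N).
under eq_bigr do rewrite Hb.
transitivity ((-1) ^+ b * (inv_facts false * inv_facts true) * (mid_weight false * mid_weight true) *
  \sum_(y : {ffun 'I_q -> 'I_X} | strictly_decreasing y) (\prod_i c' (y i)) *
    (\det (\matrix_(i, j) (fun i : 'I_q => sym_col i) j (y i)) *
     \det (\matrix_(i, j) (fun (j : 'I_q) x =>
         sym_col (q + e + j)%N x - sym_col (q + e + j)%N (K - x)%N) j (y i)))).
  rewrite mulr_sumr; apply: eq_bigr => y _.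
  rewrite [\prod_i c' _]big_split /=.
  move: (\det _) (\det _) (\prod_i c (y i)) (\prod_i (weight (y i) * weight (K - y i)%N)) (inv_facts false * _) (mid_weight _ * _).
  by move=> s1 s2 s3 s4 s5 s6; ring.
rewrite (@Cauchy_Binet_sorted rat q X c' (fun i : 'I_q => sym_col i)
  (fun (j : 'I_q) x => sym_col (q + e + j)%N x - sym_col (q + e + j)%N (K - x)%N)).
congr (_ * _).
rewrite -[RHS](@det_ublock _ _ _ _ 0); congr (\det _).
have xK (x : 'I_X) : (x <= K)%N by rewrite -ltnS (leq_trans (ltn_ord x)).
have E (k l : bool) (i j : nat) (i' j' : 'I_q) : (i < qc k)%N -> (j < qc l)%N ->
    i' = ((if k then qc false else 0) + i)%N :> nat ->
    j' = ((if l then qc false else 0) + j)%N :> nat ->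
    \sum_(x < X) c' x * (sym_col i' x * (sym_col (q + e + j') x - sym_col (q + e + j') (K - x))) =
    if k == l then \sum_(x < X | cl x == k) c x *
      ((xi x ^_ fc k)%:R * ((Kc k - xi x) ^_ fc k)%:R) *
      ((sym_poly (Kc k) (ec k) i).[(xi x)%:R] *
       ((2 * (xi x)%:R - (Kc l)%:R) * (anti_poly (Kc l) (fc l) j).[(xi x)%:R])) else 0.
  move=> ik jl -> ->.
  under eq_bigr => x _ do rewrite sym_colE // anti_colE //.
  case: eqP => [kl|kl]; last first.
    apply: big1 => x _; case: eqP => [->|_]; last by rewrite !(mul0r, mulr0).
    by case: eqP => // _; rewrite !(mul0r, mulr0).
  rewrite [RHS]big_mkcond; apply: eq_bigr => x _; rewrite -kl.
  case: eqP => [cx|]; last by rewrite !(mul0r, mulr0).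
  rewrite !mul1r /c' /weight cl_sym // cx; have := xi_sym (xK x); rewrite cx => <-.
  by rewrite addKn.
apply/matrixP => i j; case: (split_ordP i) => i' ->; case: (split_ordP j) => j' ->;
  rewrite ?(block_mxEul, block_mxEur, block_mxEdl, block_mxEdr) !mxE.
- by apply: (E false false) => /=; rewrite ?ltn_ord ?add0n.
- by apply: (E false true) => /=; rewrite ?ltn_ord ?add0n.
- by apply: (E true false) => /=; rewrite ?ltn_ord ?add0n.
- by apply: (E true true) => /=; rewrite ?ltn_ord ?add0n.
Qed.

End PairedSum.

Ltac field_ok := field; repeat (match goal with |- is_true (_ && _) => apply/andP; split end); first [assumption | done].

(** * Hilbert determinants *)

Lemma det_schur1 q (A : 'M[rat]_q) (b : 'cV[rat]_q) (c : 'rV[rat]_q) (d : rat) :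
  d != 0 ->
  \det (block_mx A b c d%:M) = d * \det (A - d^-1 *: (b *m c)).
Proof.
move=> d0; pose L : 'M[rat]_(q + 1) := block_mx 1%:M (- d^-1 *: b) 0 1%:M.
have <- : \det (L *m block_mx A b c d%:M) = \det (block_mx A b c d%:M).
  by rewrite det_mulmx det_ublock !det1 !mul1r.
rewrite mulmx_block !mul1mx !mul0mx !add0r -!scalemxAl mul_mx_scalar.
rewrite scalerA mulNr mulVf // scaleN1r subrr det_lblock det_scalar1 mulrC.
by rewrite scaleNr.
Qed.

(** One step of elimination: the Schur complement of the last entry of a Cauchy matrix
is a Cauchy matrix with rescaled rows and columns. *)
Lemma det_cauchy_step q (x y : nat -> rat) :
  (forall i j, (i <= q)%N -> (j <= q)%N -> x i + y j != 0) ->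
  \det (\matrix_(i < q.+1, j < q.+1) (x i + y j)^-1) =
  (x q + y q)^-1 *
  (\prod_(i < q) ((x q - x i) / (x i + y q)) * \prod_(j < q) ((y q - y j) / (x q + y j))) *
  \det (\matrix_(i < q, j < q) (x i + y j)^-1).
Proof.
move=> nz; have nzq := nz _ _ (leqnn q) (leqnn q).
have -> : \det (\matrix_(i < q.+1, j < q.+1) (x i + y j)^-1) =
  \det (\matrix_(i < q + 1, j < q + 1) (x i + y j)^-1) by rewrite addn1.
have -> : \matrix_(i < q + 1, j < q + 1) (x i + y j)^-1 =
   block_mx (\matrix_(i < q, j < q) (x i + y j)^-1) (\col_(i < q) (x i + y q)^-1)
     (\row_(j < q) (x q + y j)^-1) ((x q + y q)^-1)%:M.
  apply/matrixP => i j; case: (split_ordP i) => i' ->; case: (split_ordP j) => j' ->;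
  rewrite ?(block_mxEul, block_mxEur, block_mxEdl, block_mxEdr) !mxE ?ord1 /= ?addn0 ?eqxx ?mulr1n //.
rewrite det_schur1 ?invr_eq0 // -!mulrA; congr (_ * _).
have -> : \matrix_(i < q, j < q) (x i + y j)^-1 - (x q + y q)^-1^-1 *:
    (\col_(i < q) (x i + y q)^-1 *m \row_(j < q) (x q + y j)^-1) =
  diag_mx (\row_i ((x q - x i) / (x i + y q))) *m
    (\matrix_(i < q, j < q) (x i + y j)^-1 *m diag_mx (\row_j ((y q - y j) / (x q + y j)))).
  apply/matrixP => i j; rewrite mul_diag_mx mul_mx_diag !mxE big_ord1 !mxE invrK.
  have n1 := nz i j (ltnW (ltn_ord i)) (ltnW (ltn_ord j)).
  have n2 := nz i q (ltnW (ltn_ord i)) (leqnn q).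
  have n3 := nz q j (leqnn q) (ltnW (ltn_ord j)).
  move: n1 n2 n3 nzq; move: (x i) (x q) (y j) (y q) => a b c d *; field_ok.
rewrite !det_mulmx !det_diag; congr (_ * _); last first.
  by rewrite mulrC; congr (_ * _); apply: eq_bigr => i _; rewrite mxE.
by apply: eq_bigr => i _; rewrite mxE.
Qed.

(** The superfactorial. Determinants and box numbers are compared as monomials in
its values. *)
Definition sfact (n : nat) : rat := \prod_(k < n) (k`!)%:R.

Lemma sfactS n : sfact n.+1 = sfact n * (n`!)%:R.
Proof. by rewrite /sfact big_ord_recr. Qed.

Lemma fact_neq0 n : (n`!)%:R != 0 :> rat.
Proof. by rewrite pnatr_eq0 -lt0n fact_gt0. Qed.

Lemma sfact_neq0 n : sfact n != 0.
Proof. by apply/prodf_neq0 => i _; apply: fact_neq0. Qed.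

Lemma sfactD a n : sfact (a + n) = sfact a * \prod_(k < n) ((a + k)`!)%:R.
Proof. by rewrite /sfact big_split_ord. Qed.

Lemma sfact_rev s q : \prod_(j < q) ((s + q - j.+1)`!)%:R = sfact (s + q) / sfact s.
Proof.
rewrite sfactD mulrAC mulfV ?sfact_neq0 // mul1r.
rewrite (reindex_inj rev_ord_inj) /=; apply: eq_bigr => j _; congr (_`!%:R).
by have := ltn_ord j; lia.
Qed.

Lemma prod_fact_shift a q : \prod_(i < q) ((a + i)`!)%:R = sfact (a + q) / sfact a.
Proof. by rewrite sfactD mulrAC mulfV ?sfact_neq0 // mul1r. Qed.

Lemma prod_ratio g q : \prod_(i < q) (g + i.+1)%:R = ((g + q)`!)%:R / (g`!)%:R :> rat.
Proof.
elim: q => [|q IH]; first by rewrite big_ord0 addn0 divff ?fact_neq0.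
rewrite big_ord_recr /= IH addnS factS natrM.
by rewrite mulrC mulrA.
Qed.

Lemma det_hilbert f q :
  \det (\matrix_(i < q, j < q) ((f + i + j).+1%:R)^-1) =
  sfact q ^+ 2 * sfact (f + q) ^+ 2 / (sfact (f + q.*2) * sfact f) :> rat.
Proof.
elim: q => [|q IH].
  rewrite det_mx00 double0 addn0 {1 2}/sfact big_ord0 expr1n mul1r expr2 divff //.
  by rewrite mulf_neq0 ?sfact_neq0.
have E r : \matrix_(i < r, j < r) ((f + i + j).+1%:R)^-1 =
  \matrix_(i < r, j < r) ((f + i).+1%:R + j%:R)^-1 :> 'M[rat]_r.
  by apply/matrixP => i j; rewrite !mxE -natrD addSn.
rewrite E (@det_cauchy_step q (fun i => (f + i).+1%:R) (fun j => j%:R)) => [|i j _ _]; last first.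
  by rewrite -natrD pnatr_eq0 addSn.
rewrite -E IH.
have pq : \prod_(i < q) (q%:R - i%:R) = (q`!)%:R :> rat by rewrite -ffact_natr ffactnn.
have -> : \prod_(i < q) (((f + q).+1%:R - (f + i).+1%:R) / ((f + i).+1%:R + q%:R)) =
    (q`!)%:R / (((f + q + q)`!)%:R / ((f + q)`!)%:R) :> rat.
  rewrite prodf_div; congr (_ / _).
    by rewrite -pq; apply: eq_bigr => i _; rewrite -!addnS !natrD; ring.
  by rewrite -prod_ratio; apply: eq_bigr => i _; rewrite -natrD; congr (_%:R); lia.
have -> : \prod_(i < q) ((q%:R - i%:R) / ((f + q).+1%:R + i%:R)) =
    (q`!)%:R / (((f + q + q)`!)%:R / ((f + q)`!)%:R) :> rat.
  rewrite prodf_div; congr (_ / _); first exact: pq.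
  by rewrite -prod_ratio; apply: eq_bigr => i _; rewrite -natrD; congr (_%:R); lia.
rewrite doubleS !addnS !sfactS.
have -> : (f + q.*2).+1`! = ((f + q.*2).+1 * (f + q.*2)`!)%N by rewrite factS.
have -> : (f + q + q = f + q.*2)%N by rewrite -addnA addnn.
have -> : (f + q).+1%:R + q%:R = (f + q.*2).+1%:R :> rat by rewrite -natrD; congr (_%:R); lia.
rewrite natrM; have n1 : (f + q.*2).+1%:R != 0 :> rat by rewrite pnatr_eq0.
have := fact_neq0 (f + q.*2); have := fact_neq0 (f + q); have := sfact_neq0 (f + q.*2).
have := sfact_neq0 f.
move: n1; move: (_%:R) (_%:R) (_%:R) (_%:R) (sfact _) (sfact _) (sfact _) (sfact _).
move=> a b c d e' f' g h' n1 n2 n3 n4 n5.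
by field_ok.
Qed.

(** As 1 / (n (n + 1)) is the difference of 1 / n and 1 / (n + 1), summing each row with
those below it telescopes to a Hilbert matrix with rescaled rows and columns. *)
Lemma det_hilbert1 f q :
  \det (\matrix_(i < q, j < q) (((f + i + j).+1%:R)^-1 * ((f + i + j).+2%:R)^-1)) =
  sfact q * sfact q.+1 * (sfact (f + q) * sfact (f + q).+1) /
    (sfact (f + q.*2).+1 * sfact f) :> rat.
Proof.
set M := (X in \det X).
pose U : 'M[rat]_q := \matrix_(i, k) (i <= k)%N%:R.
have detU : \det U = 1.
  rewrite (@det_graded _ _ (fun i : 'I_q => i)) => [|i j ij le].
    by apply: big1 => i _; rewrite mxE leqnn.
  by rewrite mxE leqNgt ltn_neqAle le andbT val_eqE eq_sym ij.
have n0 n : n.+1%:R != 0 :> rat by rewrite pnatr_eq0.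
rewrite -[LHS]mul1r -{1}detU -det_mulmx.
have -> : U *m M =
  diag_mx (\row_i (q%:R - i%:R)) *m
  (\matrix_(i < q, j < q) ((f + i + j).+1%:R)^-1 *m diag_mx (\row_j ((f + q + j.+1)%:R)^-1)).
  apply/matrixP => i j; rewrite mul_diag_mx mul_mx_diag !mxE.
  transitivity (\sum_(i <= k < q) (((f + k + j).+1%:R)^-1 - ((f + k + j).+2%:R)^-1) : rat).
    rewrite big_geq_mkord [RHS]big_mkcond /=; apply: eq_bigr => k _; rewrite !mxE.
    case: ifP => _; last by rewrite mul0r.
    rewrite mul1r; have := n0 (f + k + j)%N; have := n0 (f + k + j).+1.
    rewrite -[(f + k + j).+2%:R]natr1.
    by move: ((f + k + j).+1%:R) => a h1 h2; field_ok.
  rewrite (telescope_sumr_eq (fun k => - ((f + k + j).+1%:R)^-1)) ?(ltnW (ltn_ord i)) //; last first.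
    by move=> k _; rewrite addnS addSn opprK addrC.
  have := n0 (f + i + j)%N; have := n0 (f + q + j)%N; rewrite addnS.
  have -> : (q%:R - i%:R : rat) = (f + q + j).+1%:R - (f + i + j).+1%:R.
    by rewrite -!addnS !natrD; ring.
  by move: (_.+1%:R) (_.+1%:R) => a b h1 h2; field_ok.
rewrite !det_mulmx !det_diag det_hilbert.
rewrite (eq_bigr (fun i : 'I_q => q%:R - i%:R)) => [|i _]; last by rewrite mxE.
rewrite -ffact_natr ffactnn.
rewrite [X in _ * (_ * X)](eq_bigr (fun j : 'I_q => ((f + q + j.+1)%:R)^-1)) => [|i _];
  last by rewrite mxE.
rewrite prodfV prod_ratio -[(f + q + q)%N]addnA addnn !sfactS.
have := fact_neq0 (f + q.*2); have := fact_neq0 (f + q); have := sfact_neq0 (f + q.*2).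
have := sfact_neq0 f.
move: (_%:R) (_%:R) (_%:R) (sfact _) (sfact _) (sfact _) (sfact _) => a b c d e' g h' h1 h2 h3 h4.
by field_ok.
Qed.

(** * Evaluation of the moments *)

Lemma ffact_shift x i f j :
  ((x + i) ^_ (i + f + j))%:R =
  \prod_(k < i) (x + k.+1)%:R * (x ^_ f)%:R * \prod_(k < j) (x%:R - (f + k)%:R) :> rat.
Proof.
rewrite !ffact_natr 2!big_split_ord /=; congr (_ * _ * _).
- rewrite [RHS](reindex_inj rev_ord_inj) /=; apply: eq_bigr => k _.
  have := ltn_ord k; move: (nat_of_ord k) => k' ki.
  have -> : ((x + i)%:R = (x + (i - k'.+1).+1)%:R + k'%:R :> rat).
    by rewrite -natrD; congr (_%:R); lia.
  by rewrite addrK.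
- by apply: eq_bigr => k _; rewrite !natrD; ring.
- by apply: eq_bigr => k _; rewrite !natrD; ring.
Qed.

(** By the choice of their roots, the two polynomials extend the falling factorials at
both ends to falling factorials of one common length f + i + j. *)
Lemma sym_anti_prod K f i j x : (x <= K)%N ->
  (x ^_ f)%:R * ((K - x) ^_ f)%:R *
    ((\prod_(k < i) (('X + (k.+1%:R)%:P) * ('X - ((K + k.+1)%:R)%:P))).[x%:R] *
     (anti_poly K f j).[x%:R]) =
  (-1) ^+ i * (-1) ^+ j *
  (((x + i) ^_ (f + i + j))%:R * ((K - x + i) ^_ (f + i + j))%:R) :> rat.
Proof.
move=> xK; rewrite [(f + i)%N]addnC !ffact_shift !horner_prod.
have -> : \prod_(k < i) (('X + (k.+1%:R)%:P) * ('X - ((K + k.+1)%:R)%:P)).[x%:R] =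
   (-1) ^+ i * (\prod_(k < i) (x + k.+1)%:R * \prod_(k < i) (K - x + k.+1)%:R) :> rat.
  rewrite -big_split -[X in (-1) ^+ X](card_ord i) -prodrN; apply: eq_bigr => k _ /=.
  by rewrite !hornerE !natrD natrB //; ring.
have -> : \prod_(k < j) (('X - ((f + k)%:R)%:P) * ('X - (K%:R - (f + k)%:R)%:P)).[x%:R] =
  (-1) ^+ j * (\prod_(k < j) (x%:R - (f + k)%:R) * \prod_(k < j) ((K - x)%:R - (f + k)%:R)) :> rat.
  rewrite -big_split -[X in (-1) ^+ X](card_ord j) -prodrN; apply: eq_bigr => k _ /=.
  by rewrite !hornerE natrB //; ring.
move: (\prod_(k < i) _) (\prod_(k < i) _) (\prod_(k < j) _) (\prod_(k < j) _).
by move=> a b c d; ring.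
Qed.

Lemma ffactSr_nat n k : (n ^_ k.+1)%:R = (n ^_ k)%:R * (n%:R - k%:R) :> rat.
Proof. by rewrite !ffact_natr big_ord_recr. Qed.

(** The summand is, up to the factor n + 1, the decrement of
(K + i + 1 - x) ^_ (n + 1) * (x + i) ^_ (n + 1), which vanishes for x = K + 1. *)
Lemma telescoping_moment K n i : (i <= n)%N ->
  \sum_(x < K.+1 | (K < x.*2)%N) (2 * x%:R - K%:R) *
     (((x + i) ^_ n)%:R * ((K - x + i) ^_ n)%:R) =
  ((K + i - K./2) ^_ n.+1)%:R * ((K./2 + i.+1) ^_ n.+1)%:R / n.+1%:R :> rat.
Proof.
move=> le; have n0 : n.+1%:R != 0 :> rat by rewrite pnatr_eq0.
have -> : \sum_(x < K.+1 | (K < x.*2)%N) (2 * x%:R - K%:R) *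
     (((x + i) ^_ n)%:R * ((K - x + i) ^_ n)%:R) =
  \sum_(K./2.+1 <= x < K.+1) (2 * x%:R - K%:R) *
     (((x + i) ^_ n)%:R * ((K - x + i) ^_ n)%:R) :> rat.
  rewrite big_geq_mkord; apply: eq_bigl => x /=; lia.
pose T x : rat := ((K + i.+1 - x) ^_ n.+1)%:R * ((x + i) ^_ n.+1)%:R.
rewrite (telescope_sumr_eq (fun x => - (T x / n.+1%:R))); last first.
- move=> x /andP[_ xK]; rewrite /T.
  have -> : (K + i.+1 - x = (K - x + i).+1)%N by lia.
  have -> : (K + i.+1 - x.+1 = K - x + i)%N by lia.
  have -> : (2 * x%:R - K%:R : rat) = (x + i)%:R - (K - x + i)%:R.
    by rewrite !natrD natrB //; ring.
  rewrite addSn; move: (x + i)%N (K - x + i)%N => a b.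
  rewrite (ffactSr_nat a) (ffactSr_nat b) !ffactSS !natrM.
  move: n0; rewrite -!natr1; move: ((a ^_ n)%:R : rat) (b ^_ n)%:R a%:R b%:R n%:R.
  move=> a1 b1 a2 b2 n2 h1; field_ok.
- by lia.
have -> : T K.+1 = 0.
  rewrite /T; have -> : (K + i.+1 - K.+1 = i)%N by lia.
  by rewrite ffact_small ?ltnS // mul0r.
rewrite mul0r oppr0 add0r opprK /T addSnnS.
by have -> : (K + i.+1 - K./2.+1 = K + i - K./2)%N by lia.
Qed.

(** The moment matrix for a single class that contains all points of [0, K]. *)
Definition half_moment K f e q : 'M[rat]_q := \matrix_(i, j)
  \sum_(x < K.+1 | (K < x.*2)%N) ((x ^_ f)%:R * ((K - x) ^_ f)%:R) *
    ((sym_poly K e i).[x%:R] * ((2 * x%:R - K%:R) * (anti_poly K f j).[x%:R])).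

Lemma half_moment_pairsE K f q (i j : 'I_q) :
  half_moment K f false q i j = (-1) ^+ i * (-1) ^+ j *
   (((K + i - K./2) ^_ (f + i + j).+1)%:R * ((K./2 + i.+1) ^_ (f + i + j).+1)%:R
     / (f + i + j).+1%:R).
Proof.
rewrite mxE -telescoping_moment ?mulr_sumr; last by lia.
apply: eq_bigr => x _; have xK : (x <= K)%N by rewrite -ltnS.
rewrite [RHS]mulrCA -sym_anti_prod // /sym_poly expr0 mul1r.
move: (x ^_ f)%:R (((K - x) ^_ f)%:R) (_.[_]) (_.[_]) (2 * _ - _) => a b c d g.
by ring.
Qed.

(** The additional factor (x - K / 2) ^ 2 of the symmetric polynomial equals
(k + i + 1) ^ 2 - (x + i + 1) (K - x + i + 1) with K = 2k, so the moment is a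
combination of two telescoping ones. *)
Lemma half_moment_midE k f q (i j : 'I_q) :
  half_moment k.*2 f true q i j = (-1) ^+ i * (-1) ^+ j *
   (((k + i) ^_ (f + i + j).+1)%:R * ((k + i.+1) ^_ (f + i + j).+1)%:R *
     ((k + i.+1)%:R * (k%:R - (f + j)%:R))
     / ((f + i + j).+1%:R * (f + i + j).+2%:R)).
Proof.
set n := (f + i + j)%N.
have E1 := @telescoping_moment k.*2 n i ltac:(lia).
have E2 := @telescoping_moment k.*2 n.+1 i.+1 ltac:(lia).
have e1 : (k.*2 + i - k.*2./2 = k + i)%N by lia.
have e2 : (k.*2 + i.+1 - k.*2./2 = (k + i).+1)%N by lia.
rewrite e1 in E1; rewrite e2 in E2.
rewrite doubleK in E1 E2.
have n1 : n.+1%:R != 0 :> rat by rewrite pnatr_eq0.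
have n2 : n.+2%:R != 0 :> rat by rewrite pnatr_eq0.
transitivity ((-1) ^+ i * (-1) ^+ j * (((k + i.+1) ^ 2)%:R *
   (((k + i) ^_ n.+1)%:R * ((k + i.+1) ^_ n.+1)%:R / n.+1%:R) -
   (((k + i).+1 ^_ n.+2)%:R * ((k + i.+2) ^_ n.+2)%:R / n.+2%:R)) : rat).
  rewrite mxE -E1 -E2 mulr_sumr -sumrB mulr_sumr.
  apply: eq_bigr => x _; have xK : (x <= k.*2)%N by rewrite -ltnS.
  rewrite !addnS 2!ffactSS !natrM /sym_poly hornerM horner_exp.
  have := @sym_anti_prod k.*2 f i j x xK; rewrite -/n.
  set S := (\prod_(k < i) _).[_]; set A := _.[_]; move=> E.
  transitivity (('X - ((k.*2)%:R / 2)%:P).[x%:R] ^+ 2 * (2 * x%:R - (k.*2)%:R) *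
    ((x ^_ f)%:R * ((k.*2 - x) ^_ f)%:R * (S * A))).
    by rewrite -/A; move: (S) (A) => S1 A1; ring.
  rewrite E; have -> : ('X - ((k.*2)%:R / 2)%:P).[x%:R] ^+ 2 =
     ((k + i).+1 ^ 2)%:R - (x + i).+1%:R * (k.*2 - x + i).+1%:R :> rat.
    have kd : (k.*2)%:R = k%:R * 2 :> rat by rewrite -muln2 natrM.
    by rewrite !hornerE -!addnS natrX !natrD natrB // kd; field.
  by move: ((x + i) ^_ n)%:R ((k.*2 - x + i) ^_ n)%:R => a b; ring.
rewrite !addnS (ffactSS (k + i) n.+1) (ffactSS (k + i).+1 n.+1).
rewrite (natrM _ (k + i).+1) (natrM _ (k + i).+2) natrX; congr (_ * _).
have -> : (k%:R - (f + j)%:R : rat) = (k + i).+1%:R - n.+1%:R.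
  by rewrite /n -!addnS !natrD; ring.
have -> : (k + i).+2%:R = (k + i).+1%:R + 1 :> rat by rewrite natr1.
move: n1 n2; rewrite -[n.+2%:R]natr1.
move: ((k + i) ^_ n.+1)%:R (((k + i).+1) ^_ n.+1)%:R (k + i).+1%:R (n.+1%:R) => a b c d h1 h2.
by field_ok.
Qed.

Lemma sfact0 : sfact 0 = 1. Proof. by rewrite /sfact big_ord0. Qed.

(** * The product formula in terms of MacMahon's box numbers *)

(** MacMahon's number of plane partitions in a p x q x r box, in a form that is
visibly symmetric. *)
Definition macmahon (p q r : nat) : rat :=
  sfact p * sfact q * sfact r * sfact (p + q + r) /
  (sfact (p + q) * sfact (q + r) * sfact (p + r)).

Lemma rising_fact t n : (rising t.+1 n)%:R = ((t + n)`!)%:R / (t`!)%:R :> rat.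
Proof.
rewrite /rising big_mkord natr_prod -prod_ratio.
by apply: eq_bigr => i _; rewrite addSnnS.
Qed.

Lemma B_macmahon a b c : B a b c = macmahon a b c.
Proof.
rewrite /B big_add1 /= big_mkord.
rewrite (eq_bigr (fun i : 'I_a => ((b + c + i)`!)%:R / ((c + i)`!)%:R *
   (((0 + i)`!)%:R / ((b + i)`!)%:R))) => [|i _].
  rewrite big_split /= !prodf_div !prod_fact_shift sfact0 /macmahon.
  have -> : (b + c + a = a + b + c)%N by lia.
  rewrite [(c + a)%N]addnC [(b + a)%N]addnC add0n.
  have := sfact_neq0 (b + c); have := sfact_neq0 (a + c); have := sfact_neq0 (a + b).
  have := sfact_neq0 c; have := sfact_neq0 b.
  move: (sfact _) (sfact _) (sfact _) (sfact _) (sfact _) (sfact _) (sfact _).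
  by move=> x1 x2 x3 x4 x5 x6 x7 h1 h2 h3 h4 h5; field_ok.
rewrite addnS !rising_fact add0n.
have -> : (c + i + b = b + c + i)%N by lia.
rewrite [(b + i)%N]addnC.
have := fact_neq0 i; have := fact_neq0 (c + i); have := fact_neq0 (i + b).
move: (_`!%:R) (_`!%:R) (_`!%:R) (_`!%:R) => x1 x2 x3 x4 h1 h2 h3.
by field_ok.
Qed.

(** The value, up to sign, of the unsigned sum over q pairs of points with sum K, with
a middle point if e holds, and the columns f, f + 1, ... *)
Definition paired_value (q : nat) (e : bool) (f K : nat) : rat :=
  \prod_(j < q.*2 + e) ((f + j)`!%:R)^-1 * (if e then (K./2 ^_ f)%:R else 1) *
  \det (half_moment K f e q).

Lemma ffact_ratio a n : (n <= a)%N -> (a ^_ n)%:R = (a`!)%:R / ((a - n)`!)%:R :> rat.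
Proof. by move=> na; rewrite -(ffact_fact na) natrM mulfK ?fact_neq0. Qed.

Lemma det_scaled q (M H : 'M[rat]_q) (rho sigma : nat -> rat) :
  (forall i j, M i j = (-1) ^+ i * (-1) ^+ j * (rho i * sigma j * H i j)) ->
  \det M = \prod_(i < q) rho i * \prod_(j < q) sigma j * \det H.
Proof.
move=> ME.
have -> : M = diag_mx (\row_(i < q) ((-1) ^+ i * rho i)) *m (H *m diag_mx (\row_(j < q) ((-1) ^+ j * sigma j))).
  by apply/matrixP => i j; rewrite mul_diag_mx mul_mx_diag !mxE ME; ring.
rewrite !det_mulmx !det_diag.
rewrite (eq_bigr (fun i : 'I_q => (-1) ^+ i * rho i)) => [|i _]; last by rewrite mxE.
rewrite [X in _ * (_ * X)](eq_bigr (fun i : 'I_q => (-1) ^+ i * sigma i)) => [|i _]; last by rewrite mxE.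
rewrite !big_split /=.
have ss : \prod_(i < q) (-1) ^+ i * \prod_(i < q) (-1) ^+ i = 1 :> rat.
  by rewrite -big_split /= big1 // => i _; rewrite -expr2 -exprM mulnC exprM sqrrN expr1n.
move: ss; move: (\prod_(i < q) (-1) ^+ i) (\prod_(i < q) rho i) (\prod_(i < q) sigma i) (\det H).
move=> a b c d aa; transitivity ((a * a) * (b * c * d)); first by ring.
by rewrite aa mul1r.
Qed.

Lemma inv_facts_sfact f n : \prod_(j < n) ((f + j)`!%:R)^-1 = sfact f / sfact (f + n).
Proof. by rewrite prodfV prod_fact_shift invf_div. Qed.

(** In this lemma and the next two, each moment is a Hilbert matrix entry times a row
factor and a column factor, all of them factorials. *)
Lemma paired_value_odd q f s : paired_value q false f (s + q + f).*2.-1 = macmahon q (q + f) s ^+ 2.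
Proof.
rewrite /paired_value mulr1 addn0 inv_facts_sfact.
rewrite (@det_scaled _ _ (\matrix_(i < q, j < q) ((f + i + j).+1%:R)^-1)
  (fun i => (((s + q + f + i)`!)%:R) ^+ 2) (fun j => (((s + q - j.+1)`!)%:R) ^- 2)).
  rewrite det_hilbert prodfV !prodrXl prod_fact_shift sfact_rev /macmahon.
  have -> : (s + q + f + q = q + (q + f) + s)%N by lia.
  have -> : (q + (q + f) = f + q.*2)%N by lia.
  have -> : (q + f + s = s + q + f)%N by lia.
  rewrite [(q + f)%N]addnC [(q + s)%N]addnC.
  have := sfact_neq0 (f + q.*2); have := sfact_neq0 (s + q + f); have := sfact_neq0 (s + q).
  have := sfact_neq0 s; have := sfact_neq0 f.
  move: (sfact _) (sfact _) (sfact _) (sfact _) (sfact _) (sfact _) (sfact _) (sfact _).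
  by move=> x1 x2 x3 x4 x5 x6 x7 x8 h1 h2 h3 h4 h5; field_ok.
move=> i j; have jq := ltn_ord j; rewrite half_moment_pairsE mxE.
have -> : ((s + q + f).*2.-1 + i - (s + q + f).*2.-1./2 = s + q + f + i)%N by lia.
have -> : ((s + q + f).*2.-1./2 + i.+1 = s + q + f + i)%N by lia.
rewrite ffact_ratio; last by lia.
have -> : (s + q + f + i - (f + i + j).+1 = s + q - j.+1)%N by lia.
congr (_ * _); have := fact_neq0 (s + q - j.+1).
have : (f + i + j).+1%:R != 0 :> rat by rewrite pnatr_eq0.
by move: (_`!%:R) (_`!%:R) (_.+1%:R) => a b c h1 h2; field_ok.
Qed.

Lemma paired_value_even q f s : paired_value q false f (s + q + f).*2 = macmahon q (q + f) s * macmahon q (q + f) s.+1.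
Proof.
rewrite /paired_value mulr1 addn0 inv_facts_sfact.
rewrite (@det_scaled _ _ (\matrix_(i < q, j < q) ((f + i + j).+1%:R)^-1)
  (fun i => ((s + q + f + i)`!)%:R * (((s + q + f).+1 + i)`!)%:R)
  (fun j => ((s + q - j.+1)`!)%:R^-1 * ((s.+1 + q - j.+1)`!)%:R^-1)).
  rewrite det_hilbert !big_split /= !prodfV !prod_fact_shift !sfact_rev /macmahon.
  have -> : (s + q + f + q = q + (q + f) + s)%N by lia.
  have -> : ((s + q + f).+1 + q = q + (q + f) + s.+1)%N by lia.
  have -> : (q + (q + f) = f + q.*2)%N by lia.
  have -> : (q + f + s = s + q + f)%N by lia.
  have -> : (q + f + s.+1 = (s + q + f).+1)%N by lia.
  rewrite [(q + f)%N]addnC ![(q + _)%N]addnC.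
  have := sfact_neq0 (f + q.*2); have := sfact_neq0 (s + q + f); have := sfact_neq0 (s + q).
  have := sfact_neq0 (s + q + f).+1; have := sfact_neq0 (s.+1 + q).
  have := sfact_neq0 s; have := sfact_neq0 s.+1; have := sfact_neq0 f.
  move: (sfact f) (sfact s) (sfact s.+1) (sfact (s.+1 + q)) (sfact (s + q + f).+1) (sfact (s + q))
   (sfact (s + q + f)) (sfact (f + q.*2)).
  move=> x1 x2 x3 x4 x5 x6 x7 x8 h1 h2 h3 h4 h5 h6 h7 h8.
  move: (sfact _) (sfact _) (sfact _) (sfact _) => y1 y2 y3 y4.
  by field_ok.
move=> i j; have jq := ltn_ord j; rewrite half_moment_pairsE mxE.
have -> : ((s + q + f).*2 + i - (s + q + f).*2./2 = s + q + f + i)%N by lia.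
have -> : ((s + q + f).*2./2 + i.+1 = (s + q + f).+1 + i)%N by lia.
rewrite !ffact_ratio; [|by lia..].
have -> : (s + q + f + i - (f + i + j).+1 = s + q - j.+1)%N by lia.
have -> : ((s + q + f).+1 + i - (f + i + j).+1 = s.+1 + q - j.+1)%N by lia.
congr (_ * _); have := fact_neq0 (s + q - j.+1); have := fact_neq0 (s.+1 + q - j.+1).
have : (f + i + j).+1%:R != 0 :> rat by rewrite pnatr_eq0.
move: (_`!%:R) (_`!%:R) (_`!%:R) (_`!%:R) (_.+1%:R) => a b c d g h1 h2 h3; field_ok.
Qed.

Lemma paired_value_mid q f s : paired_value q true f (s + q + f).*2 = macmahon q (q + f).+1 s * macmahon q.+1 (q + f) s.
Proof.
rewrite /paired_value addn1 inv_facts_sfact doubleK ffact_ratio ?leq_addl // addnK.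
rewrite (@det_scaled _ _ (\matrix_(i < q, j < q) (((f + i + j).+1%:R)^-1 * ((f + i + j).+2%:R)^-1))
  (fun i => ((((s + q + f).+1 + i)`!)%:R) ^+ 2) (fun j => (((s + q - j.+1)`!)%:R) ^- 2)).
  rewrite det_hilbert1 prodfV !prodrXl prod_fact_shift sfact_rev /macmahon.
  have -> : ((s + q + f).+1 + q = q + (q + f).+1 + s)%N by lia.
  have -> : (q.+1 + (q + f) + s = q + (q + f).+1 + s)%N by lia.
  have -> : (q + (q + f).+1 = f + q.*2.+1)%N by lia.
  have -> : (q.+1 + (q + f) = f + q.*2.+1)%N by lia.
  have -> : ((q + f).+1 + s = (s + q + f).+1)%N by lia.
  have -> : (q + f + s = s + q + f)%N by lia.
  have -> : (q.+1 + s = (s + q).+1)%N by lia.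
  rewrite [(q + f)%N]addnC [(q + s)%N]addnC !addnS !sfactS.
  have := sfact_neq0 (f + q.*2); have := sfact_neq0 (s + q + f); have := sfact_neq0 (s + q).
  have := fact_neq0 (f + q.*2); have := fact_neq0 (s + q + f); have := fact_neq0 (s + q).
  have := sfact_neq0 s; have := sfact_neq0 f.
  move: (sfact f) (sfact s) (sfact (s + q)) (sfact (s + q + f)) (sfact (f + q.*2))
    ((s + q)`!%:R) ((s + q + f)`!%:R) ((f + q.*2)`!%:R).
  move=> x1 x2 x3 x4 x5 x6 x7 x8 h1 h2 h3 h4 h5 h6 h7 h8.
  move: (sfact _) (sfact _) (sfact _) (_%:R) (_%:R) => y1 y2 y3 y4 y5.
  by field_ok.
move=> i j; have jq := ltn_ord j; rewrite half_moment_midE mxE.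
have -> : (s + q + f + i.+1 = (s + q + f).+1 + i)%N by lia.
rewrite !ffact_ratio; [|by lia..].
have -> : (s + q + f + i - (f + i + j).+1 = s + q - j.+1)%N by lia.
have -> : ((s + q + f).+1 + i - (f + i + j).+1 = (s + q - j.+1).+1)%N by lia.
have -> : ((s + q + f)%:R - (f + j)%:R : rat) = (s + q - j.+1).+1%:R.
  by rewrite -natrB; [congr (_%:R)|]; lia.
rewrite addSn !factS !natrM.
congr (_ * _); have := fact_neq0 (s + q - j.+1).
have : (s + q - j.+1).+1%:R != 0 :> rat by rewrite pnatr_eq0.
have : (f + i + j).+1%:R != 0 :> rat by rewrite pnatr_eq0.
have : (f + i + j).+2%:R != 0 :> rat by rewrite pnatr_eq0.
move: ((f + i + j).+2%:R) ((f + i + j).+1%:R) ((s + q - j.+1).+1%:R) ((s + q - j.+1)`!%:R).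
move: (_%:R) (_%:R) => a b c d g h h1 h2 h3 h4; field_ok.
Qed.

(** * The unsigned sum *)

Definition orbit_sum (zeta : rat) h m f : rat :=
  \sum_(P : {set cube h m (m + f + f)} | self_complementary P)
     zeta ^+ #|P :&: half_cubes h m f|.

Lemma orbit_sum_det (zeta : rat) h q f (e : bool) : zeta ^+ 2 = 1 ->
  (e -> ~~ odd h) ->
  let m := (q + (e + q))%N in let K := (h + m + f + f).-1 in
  exists b : bool, exists k : nat,
  orbit_sum zeta h m f =
  (-1) ^+ b * zeta ^+ k *
  \sum_(y : {ffun 'I_q -> 'I_(h + (m + f))} | strictly_decreasing y)
     (\prod_i if (K < (y i).*2)%N then zeta ^+ y i else 0) *
     \det (\matrix_(i < m, j < m) gauss_bin zeta (f + j) (paired_point K e y i)).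
Proof.
move=> z2 he m K; have [b [k H]] := @sum_center_det zeta h q f e z2 he.
exists b, (odd m * h./2 + k)%N; rewrite /orbit_sum sum_sc_GT_sum; last first.
  by rewrite /m => om; apply: he; move: om; case: (e) => //; lia.
by rewrite H exprD; move: (\sum_(y | _) _) (zeta ^+ k) (zeta ^+ _) ((-1) ^+ b) => *; ring.
Qed.

Lemma orbit_sum_1 h m f : orbit_sum 1 h m f = (SC h m (m + f + f))%:R.
Proof.
rewrite /orbit_sum /SC -sum1_card natr_sum; apply: eq_big => [P|P _]; last by rewrite expr1n.
by rewrite inE.
Qed.

(** For zeta = 1 all points are put in one class, and the other class is empty. *)
Lemma orbit_sum_1_value h q f (e : bool) : (e -> ~~ odd h) ->
  let m := (q + (e + q))%N in
  exists b : bool, orbit_sum 1 h m f = (-1) ^+ b * paired_value q e f (h + m + f + f).-1.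
Proof.
move=> he m; set K := _.-1.
pose qc (k : bool) := if k then 0%N else q.
pose ec (k : bool) := ~~ k && e.
have [b1 [k1]] := @orbit_sum_det 1 h (qc false + qc true) f (ec false || ec true)
  (expr1n _ _) ltac:(by rewrite /ec /= orbF).
have mE : (qc false + qc true + (ec false || ec true + (qc false + qc true)) = m)%N.
  by rewrite /qc /ec /= orbF addn0.
rewrite mE expr1n mulr1 -/K => ->.
have := @paired_sum K (h + (m + f)) (fun=> false) id (fun=> K) (fun=> f) qc ec.
case.
- by rewrite /K; lia.
- by [].
- by move=> x xK; rewrite subnKC.
- by rewrite /ec /= andbF.
- rewrite /ec /= orbF => ee; split=> //; have := he ee.
  by rewrite /K /m ee; lia.
move=> b2 H2; exists (b1 (+) b2).
have := H2 (fun x => if (K < x.*2)%N then 1 ^+ x else 0).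
rewrite mE; set S1 := (\sum_(y | _) _) => ES.
have -> : \sum_(y : {ffun 'I_(qc false + qc true) -> 'I_(h + (m + f))} | strictly_decreasing y)
     (\prod_i if (K < (y i).*2)%N then 1 ^+ y i else 0) *
     \det (\matrix_(i < m, j < m) gauss_bin 1 (f + j) (paired_point K (ec false || ec true) y i)) = S1.
  apply: eq_bigr => y _; congr (_ * \det _).
  apply/matrixP => i j; rewrite !mxE gauss_bin_1 /block_col.
  have jm : (j < (qc false).*2 + ec false)%N.
    by have := ltn_ord j; rewrite /qc /ec /m /=; lia.
  by rewrite jm mul1r.
rewrite ES signr_addb -!mulrA; congr (_ * (_ * _)); rewrite /paired_value.
have -> : inv_facts (fun=> f) qc ec true = 1 by rewrite /inv_facts /qc /ec /= big_ord0.
have -> : mid_weight (fun=> K) (fun=> f) ec true = 1 by rewrite /mid_weight /ec.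
rewrite !mul1r -mulrA; congr (_ * (_ * _)).
rewrite [X in _ * X](_ : _ = 1) ?mulr1; last exact: det_mx00.
congr (\det _); apply/matrixP => i j; rewrite !mxE.
have Xf : (h + (m + f) <= K.+1)%N by rewrite /K; lia.
rewrite (big_ord_widen_cond K.+1 (fun=> true) (fun x => (if (K < x.*2)%N then 1 ^+ x else 0) *
   ((x ^_ f)%:R * ((K - x) ^_ f)%:R) *
   ((sym_poly K (ec false) i).[x%:R] *
    ((2 * x%:R - K%:R) * (anti_poly K f j).[x%:R])))) // big_mkcond [RHS]big_mkcond.
apply: eq_bigr => x _ /=; rewrite expr1n; case: ifP => xX; case: ifP => Kx; rewrite ?mul0r ?mul1r //.
(* The points x >= h + m + f satisfy K - x < f. *)
rewrite [((K - x) ^_ f)%N]ffact_small ?mulr0 ?mul0r //.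
by have := ltn_ord x; move: xX Kx; rewrite /K; lia.
Qed.

Lemma cube_oppK a b c : involutive (@cube_opp a b c).
Proof. by move=> [[x i] j]; rewrite /cube_opp /= !rev_ordK. Qed.

(** * Replacing the half-full partition, and exchanging axes *)

Definition transversal a b c (T : {set cube a b c}) :=
  [forall u, (u \in T) == (cube_opp u \notin T)].

Lemma transversalP a b c (T : {set cube a b c}) :
  reflect (forall u, (u \in T) = (cube_opp u \notin T)) (transversal T).
Proof. by apply: (iffP forallP) => H u; [apply/eqP|rewrite -H]. Qed.

Lemma sc_transversal a b c (P : {set cube a b c}) : self_complementary P -> transversal P.
Proof. by case/andP. Qed.

(** The central symmetry maps the part of P :\: H outside R onto the part of H :\: P
inside R. Hence |P :\: H| is the size of the symmetric difference of P and H
inside R. *)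
Lemma odd_setD_transversal a b c (P H R : {set cube a b c}) :
  transversal P -> transversal H -> transversal R ->
  odd #|P :\: H| = odd #|P :&: R| (+) odd #|H :&: R|.
Proof.
move=> /transversalP tP /transversalP tH /transversalP tR.
have E : #|(P :\: H) :\: R| = #|(H :\: P) :&: R|.
  rewrite -(card_imset _ (inv_inj (@cube_oppK a b c))); apply: eq_card => u.
  rewrite -{1}[u]cube_oppK mem_imset; last exact: inv_inj (@cube_oppK a b c).
  rewrite !inE (tP (cube_opp u)) (tH (cube_opp u)) (tR (cube_opp u)) cube_oppK.
  by rewrite !negbK andbC [(u \notin P) && _]andbC.
have := cardsID R (P :\: H); have := cardsID H (P :&: R); have := cardsID P (H :&: R).
rewrite E.
have -> : (H :&: R) :&: P = (P :&: R) :&: H by apply/setP => u; rewrite !inE; case: (u \in P); case: (u \in H); case: (u \in R).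
have -> : (H :&: R) :\: P = (H :\: P) :&: R by apply/setP => u; rewrite !inE; case: (u \in P); case: (u \in H); case: (u \in R).
have -> : (P :&: R) :\: H = (P :\: H) :&: R by apply/setP => u; rewrite !inE; case: (u \in P); case: (u \in H); case: (u \in R).
move: (#|_|) (#|_|) (#|_|) (#|_|) (#|_|) (#|_|) => x1 x2 x3 x4 x5 x6.
by move=> <- <- <-; rewrite !oddD; case: (odd _); case: (odd _); case: (odd _).
Qed.

Lemma sign_setD_transversal a b c (H R : {set cube a b c}) :
  transversal H -> transversal R ->
  exists s : bool, forall P, self_complementary P ->
    (-1) ^+ #|P :\: H| = (-1) ^+ s * (-1) ^+ #|P :&: R| :> rat.
Proof.
move=> tH tR; exists (odd #|H :&: R|) => P /sc_transversal tP.
by rewrite -signr_odd (odd_setD_transversal tP tH tR) signr_addb !signr_odd mulrC.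
Qed.

Lemma half_full_transversal a b c : (odd a -> ~~ odd b) -> transversal (half_full a b c).
Proof.
move=> ab; apply/transversalP => -[[x i] j]; rewrite /half_full.
case oa: (odd a) ab => ab; rewrite /= !inE /=; have := ltn_ord i; have := ltn_ord x.
  by move/(_ isT): ab; lia.
by lia.
Qed.

Lemma half_cubes_transversal h m f : (odd m -> ~~ odd h) -> transversal (half_cubes h m f).
Proof.
move=> mh; apply/transversalP => -[[x i] j]; rewrite !inE /=.
have := ltn_ord i; have := ltn_ord x; have := ltn_ord j.
case om: (odd m) mh => mh; last by lia.
by move/(_ isT): mh; lia.
Qed.

Lemma signed_orbit_sum h m f : (odd h -> ~~ odd m) ->
  exists s : bool, (signed_sum h m (m + f + f))%:~R = (-1) ^+ s * orbit_sum (-1) h m f.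
Proof.
move=> hm; have mh : odd m -> ~~ odd h by case: (odd m) hm; case: (odd h) => // /(_ isT).
have [s Hs] := sign_setD_transversal (@half_full_transversal h m (m + f + f) hm)
  (half_cubes_transversal f mh).
exists s; rewrite /signed_sum rmorph_sum /= /orbit_sum mulr_sumr.
by apply: eq_bigr => P SC; rewrite rmorphXn /= rmorphN1 Hs.
Qed.

Section Isomorphism.
Variables (a b c a' b' c' : nat).
Variables (F : cube a b c -> cube a' b' c') (G : cube a' b' c' -> cube a b c).
Hypothesis GF : cancel F G.
Hypothesis Gle : forall u v, cube_le u v -> cube_le (G u) (G v).
Hypothesis Gopp : forall u, G (cube_opp u) = cube_opp (G u).

Lemma sc_preim (P : {set cube a b c}) :
  self_complementary P -> self_complementary (G @^-1: P).
Proof.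
move=> /andP[/forallP PP /forallP SC]; apply/andP; split.
  apply/forallP => u; apply/implyP; rewrite inE => uP.
  apply/forallP => v; apply/implyP => /Gle vu; rewrite inE.
  by have /implyP/(_ uP)/forallP/(_ (G v))/implyP := PP (G u); apply.
by apply/forallP => u; rewrite !inE Gopp.
Qed.

Lemma preim_inj : injective (fun P : {set cube a b c} => G @^-1: P).
Proof.
move=> P Q /setP PQ; apply/setP => u; have := PQ (F u).
by rewrite !inE GF.
Qed.

(** Applied to an isomorphism and to its inverse, this gives invariance under
permutations of the axes. *)
Lemma SC_le : (SC a b c <= SC a' b' c')%N.
Proof.
rewrite /SC -(card_imset _ preim_inj); apply: subset_leq_card.
by apply/subsetP => Q /imsetP[P]; rewrite inE => /sc_preim SP ->; rewrite inE.
Qed.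

End Isomorphism.

Definition swap23 a b c (u : cube a b c) : cube a c b := (u.1.1, u.2, u.1.2).
Definition swap12 a b c (u : cube a b c) : cube b a c := (u.1.2, u.1.1, u.2).

Lemma swap23K a b c : cancel (@swap23 a b c) (@swap23 a c b).
Proof. by case=> -[]. Qed.

Lemma swap23_le a b c (u v : cube a b c) : cube_le u v -> cube_le (swap23 u) (swap23 v).
Proof. by rewrite /cube_le /= => /and3P[-> -> ->]. Qed.

Lemma SC_swap23 a b c : SC a b c = SC a c b.
Proof.
by apply/eqP; rewrite eqn_leq; apply/andP; split;
  apply: (SC_le (@swap23K _ _ _) (@swap23_le _ _ _)).
Qed.

Lemma SC_swap12 a b c : SC a b c = SC b a c.
Proof.
have le a' b' c' (u v : cube a' b' c') : cube_le u v -> cube_le (swap12 u) (swap12 v).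
  by rewrite /cube_le /= => /and3P[-> -> ->].
have K a' b' c' : cancel (@swap12 a' b' c') (@swap12 b' a' c') by case=> -[].
by apply/eqP; rewrite eqn_leq; apply/andP; split; apply: (SC_le (@K _ _ _) (@le _ _ _)).
Qed.

(** Exchanging the last two axes moves H, but H and its image are both transversals,
so only a global sign changes. *)
Lemma signed_sum_swap a b c : (odd a -> ~~ odd b) -> (odd a -> ~~ odd c) ->
  exists s : bool, (signed_sum a b c)%:~R = (-1) ^+ s * (signed_sum a c b)%:~R :> rat.
Proof.
move=> ab ac; pose sw (P : {set cube a b c}) : {set cube a c b} := @swap23 a c b @^-1: P.
have swK : cancel sw (fun P => @swap23 a b c @^-1: P).
  by move=> P; apply/setP => u; rewrite !inE swap23K.
have scsw (P : {set cube a b c}) : self_complementary (sw P) = self_complementary P.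
  apply/idP/idP => [SP|]; last exact: (sc_preim (@swap23_le _ _ _)).
  by rewrite -[P]swK; apply: (sc_preim (@swap23_le _ _ _)).
have tH : transversal (sw (half_full a b c)).
  apply/transversalP => u; rewrite !inE.
  by have /transversalP := @half_full_transversal a b c ab; apply.
have tH' := @half_full_transversal a c b ac.
have [s1 H1] := sign_setD_transversal tH tH'.
have [s2 H2] := sign_setD_transversal tH' tH'.
exists (s1 (+) s2); rewrite /signed_sum !rmorph_sum /= mulr_sumr.
rewrite [RHS](reindex_onto sw (fun P => @swap23 a b c @^-1: P)) /=; last first.
  by move=> P _; apply/setP => u; rewrite !inE swap23K.
apply: eq_big => [P|P SP]; first by rewrite scsw swK eqxx andbT.
rewrite !rmorphXn /= !rmorphN1 H2 ?scsw //.
have -> : nstat P = #|sw P :\: sw (half_full a b c)|.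
  rewrite /nstat -(card_imset _ (can_inj (@swap23K a b c))); apply: eq_card => u.
  by rewrite -{1}[u]swap23K mem_imset ?inE //; apply: can_inj (@swap23K _ _ _).
by rewrite H1 ?scsw // signr_addb -mulrA; congr (_ * _); rewrite mulrA -signr_addb addbb mul1r.
Qed.

Lemma macmahon_sym12 p q r : macmahon p q r = macmahon q p r.
Proof.
rewrite /macmahon [(q + p)%N]addnC.
move: (sfact p) (sfact q) (sfact r) (sfact (p + q + r)) (sfact (p + q)) (sfact (q + r))
  (sfact (p + r)) => x1 x2 x3 x4 x5 x6 x7.
by congr (_ / _); ring.
Qed.

Lemma macmahon_sym23 p q r : macmahon p q r = macmahon p r q.
Proof.
rewrite /macmahon [(r + q)%N]addnC [(p + r + q)%N]addnAC.
move: (sfact p) (sfact q) (sfact r) (sfact (p + q + r)) (sfact (p + q)) (sfact (q + r))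
  (sfact (p + r)) => x1 x2 x3 x4 x5 x6 x7.
by congr (_ / _); ring.
Qed.

Lemma sfact_gt0 n : 0 < sfact n.
Proof. by apply: prodr_gt0 => i _; rewrite ltr0n fact_gt0. Qed.

Lemma macmahon_gt0 p q r : 0 < macmahon p q r.
Proof. by rewrite /macmahon divr_gt0 // !mulr_gt0 ?sfact_gt0. Qed.

(** * Stanley's product formula *)

(** Cardinalities are nonnegative, which removes the sign left open by the
determinant manipulations. *)
Lemma nat_of_sign n (x : rat) (b : bool) : 0 < x -> n%:R = (-1) ^+ b * x -> n%:R = x.
Proof.
case: b => x0; rewrite ?expr0 ?mul1r // expr1 mulN1r => e.
by have : (0 : rat) <= n%:R by []; rewrite e oppr_ge0 leNgt x0.
Qed.

Lemma Stanley_eee s p t : (SC s.*2 p.*2 t.*2)%:R = macmahon s p t ^+ 2.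
Proof.
wlog pt : p t / (p <= t)%N => [H|].
  by case: (leqP p t) => [/H//|/ltnW/H]; rewrite SC_swap23 macmahon_sym23.
have [b] := @orbit_sum_1_value s.*2 p (t - p) false ltac:(by []).
rewrite orbit_sum_1.
have -> : (p + (false + p) + (t - p) + (t - p) = t.*2)%N by lia.
have -> : (p + (false + p) = p.*2)%N by lia.
have -> : ((s.*2 + p.*2 + (t - p) + (t - p)).-1 = (s + p + (t - p)).*2.-1)%N by lia.
rewrite paired_value_odd subnKC // [macmahon p t s]macmahon_sym23 [macmahon p s t]macmahon_sym12 => /nat_of_sign->//.
by rewrite exprn_gt0 // macmahon_gt0.
Qed.

Lemma Stanley_oee s p t : (SC s.*2.+1 p.*2 t.*2)%:R = macmahon s p t * macmahon s.+1 p t.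
Proof.
wlog pt : p t / (p <= t)%N => [H|].
  by case: (leqP p t) => [/H//|/ltnW/H]; rewrite SC_swap23 macmahon_sym23 [X in _ * X]macmahon_sym23.
have [b] := @orbit_sum_1_value s.*2.+1 p (t - p) false ltac:(by []).
rewrite orbit_sum_1.
have -> : (p + (false + p) + (t - p) + (t - p) = t.*2)%N by lia.
have -> : (p + (false + p) = p.*2)%N by lia.
have -> : ((s.*2.+1 + p.*2 + (t - p) + (t - p)).-1 = (s + p + (t - p)).*2)%N by lia.
rewrite paired_value_even subnKC // ![macmahon p t _]macmahon_sym23 ![macmahon p _ t]macmahon_sym12 => /nat_of_sign->//.
by rewrite mulr_gt0 // macmahon_gt0.
Qed.

Lemma Stanley_eoo s p t : (SC s.*2 p.*2.+1 t.*2.+1)%:R = macmahon s p t.+1 * macmahon s p.+1 t.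
Proof.
wlog pt : p t / (p <= t)%N => [H|].
  case: (leqP p t) => [/H//|/ltnW/H]; rewrite SC_swap23 macmahon_sym23 [X in _ * X]macmahon_sym23.
  by rewrite mulrC.
have [b] := @orbit_sum_1_value s.*2 p (t - p) true ltac:(by rewrite odd_double).
rewrite orbit_sum_1.
have -> : (p + (true + p) + (t - p) + (t - p) = t.*2.+1)%N by lia.
have -> : (p + (true + p) = p.*2.+1)%N by lia.
have -> : ((s.*2 + p.*2.+1 + (t - p) + (t - p)).-1 = (s + p + (t - p)).*2)%N by lia.
rewrite paired_value_mid subnKC // ![macmahon _ _ s]macmahon_sym23 [macmahon p s _]macmahon_sym12 [macmahon p.+1 s _]macmahon_sym12.
move/nat_of_sign-> => //.
by rewrite mulr_gt0 // macmahon_gt0.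
Qed.

(** The cube at the center would be opposite to itself. *)
Lemma SC_ooo a b c : odd a -> odd b -> odd c -> SC a b c = 0%N.
Proof.
move=> oa ob oc; apply/eqP; rewrite cards_eq0; apply/eqP/setP => P; rewrite !inE.
apply/negP => /sc_transversal/transversalP tP.
have a2 : (a./2 < a)%N by lia.
have b2 : (b./2 < b)%N by lia.
have c2 : (c./2 < c)%N by lia.
have := tP (Ordinal a2, Ordinal b2, Ordinal c2).
have -> : cube_opp (Ordinal a2, Ordinal b2, Ordinal c2) =
   (Ordinal a2, Ordinal b2, Ordinal c2).
  by rewrite /cube_opp; congr (_, _, _); apply: val_inj => /=; lia.
by case: (_ \in P).
Qed.

(** * Parity classes for the signed sum *)

(** The columns f, ..., f + m - 1 of Gaussian binomials at -1 sorted by parity class: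
m0 columns on even points, starting with the first even index, and then the
columns on odd points. *)
Definition parity_col (f m0 j x : nat) : rat :=
  if (j < m0)%N then (~~ odd x)%:R * 'C(x./2, uphalf f + j)%:R
  else (odd x)%:R * 'C(x./2, f./2 + (j - m0))%:R.

(** The column of index k, supported on points of one parity, before sorting by
class. The flag t makes the last column odd although its index is even. *)
Definition pure_col (f m : nat) (t : bool) (k x : nat) : rat :=
  (if odd (f + k) || (t && (k == m.-1)) then (odd x)%:R else (~~ odd x)%:R) *
  'C(x./2, (f + k)./2)%:R.

Definition half_sign (j : nat) : rat := (-1) ^+ j./2.

Lemma gauss_bin_N1E j x : gauss_bin (-1) j x = half_sign j *
  ((if odd j then (odd x)%:R else 1) * 'C(x./2, j./2)%:R).
Proof.
rewrite /half_sign; have [E O] := gauss_bin_N1 j./2 x; case oj : (odd j).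
  by rewrite -{1}[j]odd_double_half oj add1n O.
by rewrite -{1}[j]odd_double_half oj add0n E mul1r.
Qed.

(** An even-indexed Gaussian binomial at -1 is supported on all points. Its odd part is
the next column, so column operations remove it, except for the last column,
which has no successor. *)
Lemma det_pure_col f m (t : bool) (r : 'I_m -> nat) : (t -> odd (m + f)) ->
  \det (\matrix_(i < m, j < m) (half_sign (f + j) *
     (pure_col f m t j (r i) + (if ~~ odd (f + j) && (j.+1 < m)%N
        then (odd (r i))%:R * 'C((r i)./2, (f + j)./2)%:R else 0)))) =
  \prod_(j < m) half_sign (f + j) * \det (\matrix_(i < m, j < m) pure_col f m t j (r i)).
Proof.
move=> tN.
pose C : 'M[rat]_m := \matrix_(k, c) (half_sign (f + c) *
  ((k == c)%:R + (~~ odd (f + c) && (k == c.+1 :> nat))%:R)).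
have <- : \det C = \prod_(j < m) half_sign (f + j).
  rewrite (@det_graded _ _ (fun k : 'I_m => m - k)%N) => [|k c kc le].
    by apply: eq_bigr => k _; rewrite mxE eqxx [k == k.+1 :> nat]ltn_eqF // andbF addr0 mulr1.
  rewrite mxE (negbTE kc) add0r [k == c.+1 :> nat]ltn_eqF ?andbF ?mulr0 //.
  by have := ltn_ord k; have := ltn_ord c; lia.
rewrite mulrC -det_mulmx; congr (\det _); apply/matrixP => i j; rewrite !mxE.
rewrite [RHS](eq_bigr (fun k : 'I_m => half_sign (f + j) * ((k == j)%:R * pure_col f m t k (r i)) +
   half_sign (f + j) * ((~~ odd (f + j) && (k == j.+1 :> nat))%:R * pure_col f m t k (r i)))) => [|k _];
  last by rewrite !mxE; move: (pure_col _ _ _ _ _) (half_sign _) => a b; ring.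
rewrite big_split /= -!mulr_sumr mulrDr; congr (_ * _ + _ * _).
  rewrite (bigD1 j) //= eqxx mul1r big1 ?addr0 // => k /negbTE->.
  by rewrite mul0r.
case: ifP => [/andP[oj jm]|/negbT jj].
  rewrite (bigD1 (Ordinal jm)) //= oj eqxx mul1r big1 => [|k /negbTE kj]; last first.
    by rewrite -[k == j.+1 :> nat]/(k == Ordinal jm) kj mul0r.
  rewrite addr0 /pure_col addnS /= oj /= uphalf_half (negbTE oj) add0n.
  by [].
rewrite big1 // => k _; case: (k =P j.+1 :> nat) => kj; last by rewrite andbF mul0r.
have jm : (j.+1 < m)%N by rewrite -kj.
by move: jj; rewrite jm andbT => /negbTE->; rewrite mul0r.
Qed.

Lemma det_gauss_bin_even f m : ~~ odd (m + f) -> forall r : 'I_m -> nat,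
  \det (\matrix_(i < m, j < m) gauss_bin (-1) (f + j) (r i)) =
  \prod_(j < m) half_sign (f + j) * \det (\matrix_(i < m, j < m) pure_col f m false j (r i)).
Proof.
move=> oN r; rewrite -det_pure_col //; congr (\det _); apply/matrixP => i j.
rewrite !mxE gauss_bin_N1E; congr (_ * _); rewrite /pure_col orbF.
case oj: (odd (f + j)) => /=; first by rewrite addr0.
have -> : (j.+1 < m)%N by have := ltn_ord j; move: oN oj; lia.
by case: (odd _) => /=; ring.
Qed.

(** Here the last column has even index. It is the sum of its even and odd parts, and
the determinant is linear in it. *)
Lemma det_gauss_bin_odd f m : odd (m + f) -> (0 < m)%N -> forall r : 'I_m -> nat,
  \det (\matrix_(i < m, j < m) gauss_bin (-1) (f + j) (r i)) =
  \prod_(j < m) half_sign (f + j) *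
   (\det (\matrix_(i < m, j < m) pure_col f m false j (r i)) +
    \det (\matrix_(i < m, j < m) pure_col f m true j (r i))).
Proof.
case: m => // m oN _ r; rewrite mulrDr -!det_pure_col //.
rewrite -[LHS]det_tr -[X in _ = X + _]det_tr -[X in _ = _ + X]det_tr.
rewrite -[X in _ = X + _]mul1r -[X in _ = _ + X]mul1r.
apply: (@determinant_multilinear _ _ _ _ _ ord_max).
- apply/matrixP => k i; rewrite !mxE gauss_bin_N1E !mul1r -mulrDr /pure_col /= ltnn andbF !addr0 eqxx /=.
  have -> : odd (f + m) = false by move: oN; lia.
  by case: (odd _) => /=; ring.
- apply/matrixP => k i; rewrite !mxE /= gauss_bin_N1E /pure_col orbF.
  rewrite /bump leqNgt ltn_ord add0n.
  congr (_ * _); case oj: (odd (f + k)) => /=; first by rewrite addr0.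
  have -> : (k.+1 < m.+1)%N by have := ltn_ord k; lia.
  by case: (odd _) => /=; ring.
- apply/matrixP => k i; rewrite !mxE /= gauss_bin_N1E /pure_col.
  rewrite /bump leqNgt ltn_ord add0n [k == m :> nat]ltn_eqF // orbF.
  congr (_ * _); case oj: (odd (f + k)) => /=; first by rewrite addr0.
  have -> : (k.+1 < m.+1)%N by have := ltn_ord k; lia.
  by case: (odd _) => /=; ring.
Qed.

Lemma det_parity_col f m (t : bool) : (t -> odd (m + f)) -> (0 < m)%N ->
  let m0 := ((if t then (m + f)./2 else uphalf (m + f)) - uphalf f)%N in
  exists b : bool, forall r : 'I_m -> nat,
  \det (\matrix_(i < m, j < m) pure_col f m t j (r i)) =
  (-1) ^+ b * \det (\matrix_(i < m, j < m) parity_col f m0 j (r i)).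
Proof.
move=> tN m_gt0 m0.
(* The minimum matters only for the last column in the case t, whose index is even. *)
pose p (j : nat) := (if j < m0 then (uphalf f + j).*2 - f
  else minn ((f./2 + (j - m0)).*2.+1 - f) m.-1)%N.
have pm (j : 'I_m) : (p j < m)%N.
  rewrite /p; case: ifP => jm; last by have := geq_minr ((f./2 + (j - m0)).*2.+1 - f) m.-1; lia.
  by move: jm tN; rewrite /m0; case: (t) => // jm; [move/(_ isT)|move=> _]; have := ltn_ord j; lia.
pose pp j := Ordinal (pm j).
have ppI : injective pp.
  move=> i j /(congr1 val) /= eq; apply: val_inj => /=.
  have := ltn_ord i; have := ltn_ord j; move: eq tN; rewrite /p /m0.
  case: (t) => eq; [move/(_ isT)|move=> _]; move: eq; do 2![case: ifP => ?]; lia.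
have [b Hb] := det_mxsub_inj rat (@inj_id 'I_m) ppI.
exists b => r; have := Hb (\matrix_(i < m, j < m) pure_col f m t j (r i)).
have -> : mxsub id pp (\matrix_(i < m, j < m) pure_col f m t j (r i)) =
   \matrix_(i < m, j < m) parity_col f m0 j (r i).
  apply/matrixP => i j; rewrite !mxE /pure_col /parity_col /= /p.
  have jm := ltn_ord j.
  case: (ltnP j m0) => jm0.
    rewrite ifF; last first.
      move: jm0 tN; rewrite /m0; case: (t) => /= jm0; [move/(_ isT)|move=> _]; lia.
    by congr (_ * 'C(_, _)%:R); lia.
  rewrite ifT; last first.
    move: jm0 tN; rewrite /m0; case: (t) => /= jm0; [move/(_ isT)|move=> _]; lia.
  congr (_ * 'C(_, _)%:R).
  move: jm0 tN; rewrite /m0; case: (t) => /= jm0; [move/(_ isT)|move=> _]; lia.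
by move=> ->; rewrite signrMK.
Qed.

Lemma prod_half_sign n (g : nat -> nat) : exists b : bool,
  \prod_(j < n) half_sign (g j) = (-1) ^+ b.
Proof.
elim: n => [|n [b IH]]; first by exists false; rewrite big_ord0.
by exists (b (+) odd (g n)./2); rewrite big_ord_recr /= IH signr_addb signr_odd.
Qed.

Lemma det_gauss_parity_even f m : ~~ odd (m + f) -> (0 < m)%N ->
  exists b : bool, forall r : 'I_m -> nat,
  \det (\matrix_(i < m, j < m) gauss_bin (-1) (f + j) (r i)) =
  (-1) ^+ b * \det (\matrix_(i < m, j < m) parity_col f (uphalf (m + f) - uphalf f) j (r i)).
Proof.
move=> oN m0; have [b1 H1] := prod_half_sign m (fun j => f + j)%N.
have [b2 H2] := @det_parity_col f m false ltac:(by []) m0.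
by exists (b1 (+) b2) => r; rewrite det_gauss_bin_even // H1 H2 signr_addb mulrA.
Qed.

Lemma det_gauss_parity_odd f m : odd (m + f) -> (0 < m)%N ->
  exists b1 b2 : bool, forall r : 'I_m -> nat,
  \det (\matrix_(i < m, j < m) gauss_bin (-1) (f + j) (r i)) =
  (-1) ^+ b1 * \det (\matrix_(i < m, j < m) parity_col f (uphalf (m + f) - uphalf f) j (r i)) +
  (-1) ^+ b2 * \det (\matrix_(i < m, j < m) parity_col f ((m + f)./2 - uphalf f) j (r i)).
Proof.
move=> oN m0; have [b1 H1] := prod_half_sign m (fun j => f + j)%N.
have [b2 H2] := @det_parity_col f m false ltac:(by []) m0.
have [b3 H3] := @det_parity_col f m true ltac:(by []) m0.
exists (b1 (+) b2), (b1 (+) b3) => r.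
by rewrite det_gauss_bin_odd // H1 H2 H3 !signr_addb mulrDr !mulrA.
Qed.

Lemma sum_parity_class A (k : bool) (G : nat -> rat) :
  \sum_(x < A.*2 | odd x == k) G x = \sum_(z < A) G (z.*2 + k)%N.
Proof.
elim: A => [|A IH]; first by rewrite !big_ord0.
rewrite big_mkcond doubleS !big_ord_recr /= -IH -big_mkcond -addrA; congr (_ + _).
by rewrite odd_double; case: (k) => /=; rewrite ?add0r ?addr0 ?addn1 ?addn0.
Qed.

(** Substitute x = 2 z + k. The reflection of [0, K] restricts to the one of [0, Kk].
Points between the two summation ranges contribute 0 by the assumption on F. *)
Lemma half_sum K X f (k : bool) (F : nat -> rat) : ~~ odd K -> X = (K.+1 - f)%N ->
  let Kk := if k then K./2.-1 else K./2 in
  let fk := if k then f./2 else uphalf f in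
  (forall z, (Kk - z < fk)%N -> F z = 0) ->
  \sum_(x < X | odd x == k) (if (K < x.*2)%N then (-1) ^+ x else 0) * F x./2 =
  (-1) ^+ k * \sum_(z < Kk.+1 | (Kk < z.*2)%N) F z.
Proof.
move=> oK XE Kk fk F0.
have Xle : (X <= K.+1.*2)%N by lia.
have Kle : (Kk.+1 <= K.+1)%N by rewrite /Kk; case: (k); lia.
rewrite (big_ord_widen_cond _ (fun x => odd x == k)
  (fun x => (if (K < x.*2)%N then (-1) ^+ x else 0) * F x./2) Xle).
rewrite (big_ord_widen_cond _ (fun z => Kk < z.*2)%N F Kle).
rewrite [LHS]big_mkcondr mulr_sumr [RHS]big_mkcond.
rewrite (sum_parity_class K.+1 k (fun x => if (x < X)%N then
   (if (K < x.*2)%N then (-1) ^+ x else 0) * F x./2 else 0)).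
apply: eq_bigr => z _; have zK := ltn_ord z.
have -> : ((z.*2 + k)./2 = z)%N by case: (k); lia.
have -> : (-1) ^+ (z.*2 + k) = (-1) ^+ k :> rat.
  by rewrite exprD -mul2n exprM sqrrN !expr1n mul1r.
case: ifP => xX; last first.
  case: ifP => zc //; rewrite F0 ?mulr0 //.
  by move: zc xX; rewrite /Kk /fk; case: (k); lia.
case: ifP => xK; case: ifP => zc; rewrite ?mul0r //.
- by move: zc xX xK; rewrite /Kk; case: (k); lia.
- by move: zc xX xK; rewrite /Kk; case: (k); lia.
Qed.

(** * The signed sum for even K *)

(** What the signed sum becomes once its columns are sorted by parity class. *)
Definition class_sum h q (e : bool) f m0 : rat :=
  let m := (q + (e + q))%N in let K := (h + m + f + f).-1 in
  \sum_(y : {ffun 'I_q -> 'I_(h + (m + f))} | strictly_decreasing y)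
     (\prod_i if (K < (y i).*2)%N then (-1) ^+ y i else 0) *
     \det (\matrix_(i < m, j < m) parity_col f m0 j (paired_point K e y i)).

(** The sign (-1) ^ x is constant on each parity class, and the reflection preserves
the classes. In terms of the halves of the points, each class is an unsigned sum;
its interval has length K / 2 for even and K / 2 - 1 for odd points. *)
Lemma class_sum_val h q0 q1 (e0 e1 : bool) f :
  let q := (q0 + q1)%N in let e := e0 || e1 in
  let K := (h + (q + (e + q)) + f + f).-1 in
  ~~ odd K -> (0 < q + (e + q))%N -> ~~ (e0 && e1) -> (e -> odd K./2 = e1) ->
  exists b : bool, class_sum h q e f (q0.*2 + e0) =
    (-1) ^+ b * (paired_value q0 e0 (uphalf f) K./2 * paired_value q1 e1 f./2 K./2.-1).
Proof.
move=> q e K oK m_gt0 e01 emid.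
pose qc (k : bool) := if k then q1 else q0.
pose ec (k : bool) := if k then e1 else e0.
pose fc (k : bool) := if k then f./2 else uphalf f.
pose Kc (k : bool) := if k then K./2.-1 else K./2.
have := @paired_sum K (h + (q + (e + q) + f)) odd half Kc fc qc ec.
case=> //.
- by rewrite /K; lia.
- by move=> x xK; rewrite oddB // (negbTE oK).
- by move=> x xK; rewrite /Kc; case ox: (odd x); lia.
- by move=> ee; split; [exact: emid|]; have := emid ee; rewrite /Kc /ec; case: (e1); lia.
move=> b H.
pose c x : rat := if (K < x.*2)%N then (-1) ^+ x else 0.
have mom k : moment (h + (q + (e + q) + f)) odd half Kc fc qc ec c k =
    (-1) ^+ k *: half_moment (Kc k) (fc k) (ec k) (qc k).
  apply/matrixP => i j; rewrite !mxE.
  pose F z : rat := (z ^_ fc k)%:R * ((Kc k - z) ^_ fc k)%:R *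
    ((sym_poly (Kc k) (ec k) i).[z%:R] *
    ((2 * z%:R - (Kc k)%:R) * (anti_poly (Kc k) (fc k) j).[z%:R])).
  have := @half_sum K (h + (q + (e + q) + f)) f k F oK.
  rewrite -/(Kc k) -/(fc k) => <-.
  - by apply: eq_bigr => x _; rewrite /F /c [RHS]mulrA.
  - by rewrite /K; lia.
  - by move=> z zf; rewrite /F [((Kc k - z) ^_ _)%N]ffact_small // mulr0 mul0r.
exists (b (+) odd q1).
rewrite /class_sum -/K; have := H c; rewrite !mom !detZ.
have -> : ((-1) ^+ false) ^+ qc false = 1 :> rat by rewrite expr1n.
rewrite expr1 signr_addb signr_odd /paired_value /inv_facts /mid_weight mul1r /=.
move: (\det _) (\det _) (\prod_(j < _) _) (\prod_(j < _) _) ((-1) ^+ q1) => d1 d2 p1 p2 s1.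
move: (if e0 then _ else _) (if e1 then _ else _) => w1 w2 HE.
rewrite (_ : \sum_(y | _) _ = (-1) ^+ b * (p2 * p1) * (w1 * w2) * (d2 * (s1 * d1))).
  by move: ((-1) ^+ b) => s2; ring.
rewrite -HE; apply: eq_bigr => y _; congr (_ * \det _).
Qed.

(** The even points come in pairs, up to the middle one, so their number has a forced
parity. If m0 has the other parity, the matrix has a zero block that is too
large. *)
Lemma class_sum_zero h q (e : bool) f m0 :
  let m := (q + (e + q))%N in let K := (h + m + f + f).-1 in
  ~~ odd K -> (0 < m)%N -> (m0 <= m)%N -> odd m0 != e && ~~ odd K./2 -> class_sum h q e f m0 = 0.
Proof.
move=> m K oK m_gt0 m0m par; apply: big1 => y sy.
have yK i : (y i <= K)%N by have := ltn_ord (y i); rewrite /K /m; lia.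
suff -> : \det (\matrix_(i < m, j < m) parity_col f m0 j (paired_point K e y i)) = 0 by rewrite mulr0.
pose Ev := [set i : 'I_m | ~~ odd (paired_point K e y i)].
have cE : odd #|Ev| = e && ~~ odd K./2.
  have -> : #|Ev| = (\sum_(i < m) ~~ odd (paired_point K e y i))%N.
    by rewrite -sum1_card big_mkcond; apply: eq_bigr => i _; rewrite inE; case: (odd _).
  rewrite (@big_split_ord _ _ _ q (e + q)) (@big_split_ord _ _ _ e q) /=.
  have -> : (\sum_(i < q) ~~ odd (paired_point K e y i) = \sum_(i < q) ~~ odd (y i))%N.
    apply: eq_bigr => i _; rewrite /paired_point ltn_ord val_atE.
    by rewrite oddB ?yK // (negbTE oK).
  have -> : (\sum_(i < q) ~~ odd (paired_point K e y (q + (e + i))) = \sum_(i < q) ~~ odd (y i))%N.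
    apply: eq_bigr => i _; rewrite /paired_point [(_ < q)%N]ltnNge leq_addr /=.
    rewrite ltn_add2l [(_ < e)%N]ltnNge leq_addr /=.
    have -> : (q + (e + i) - (q + e) = i)%N by lia.
    by rewrite val_atE.
  have -> : (\sum_(i < e) ~~ odd (paired_point K e y (q + i)) = e && ~~ odd K./2)%N.
    rewrite (eq_bigr (fun=> nat_of_bool (~~ odd K./2))) => [|i _].
      by rewrite sum_nat_const card_ord mulnb.
    by rewrite /paired_point [(_ < q)%N]ltnNge leq_addr /= ltn_add2l ltn_ord.
  by rewrite addnCA addnn oddD odd_double addbF; case: (e && _).
have m0E : (#|Ev| != m0)%N by apply: contraNneq par => <-; rewrite cE.
have cEle : (#|Ev| <= m)%N by rewrite -[X in (_ <= X)%N]card_ord max_card.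
have c1 : #|[set j : 'I_m | (j < m0)%N]| = m0 by apply: card_ltn_ord.
have c2 := cardsC Ev; have c3 := cardsC [set j : 'I_m | (j < m0)%N].
rewrite card_ord in c2 c3.
case: (ltngtP #|Ev| m0) m0E => // lt _.
  apply: (@det_zero_block _ _ (~: Ev) [set j : 'I_m | (j < m0)%N]); last first.
    by rewrite c1 -[X in (X < _)%N]c2 [X in (_ < X)%N]addnC ltn_add2r.
  by move=> i j; rewrite !inE negbK mxE /parity_col => oi ->; rewrite oi mul0r.
apply: (@det_zero_block _ _ Ev (~: [set j : 'I_m | (j < m0)%N])); last first.
  by rewrite -[X in (X < _)%N]c3 c1 ltn_add2r.
by move=> i j; rewrite !inE mxE /parity_col => /negbTE oi /negbTE->; rewrite oi mul0r.
Qed.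

Lemma sign_pow (b : bool) k : exists s : bool, (-1) ^+ b * (-1) ^+ k = (-1) ^+ s :> rat.
Proof. by exists (b (+) odd k); rewrite signr_addb signr_odd. Qed.

Lemma orbit_sum_class_even h q (e : bool) f : (e -> ~~ odd h) ->
  let m := (q + (e + q))%N in (0 < m)%N -> ~~ odd (m + f) ->
  exists b : bool, orbit_sum (-1) h m f = (-1) ^+ b * class_sum h q e f (uphalf (m + f) - uphalf f).
Proof.
move=> he m m0 oN; have [b [k ->]] := @orbit_sum_det (-1) h q f e (sqrr_sign _ 1) he.
have [s ->] := sign_pow b k; have [s' H] := det_gauss_parity_even oN m0.
exists (s (+) s'); rewrite signr_addb -mulrA; congr (_ * _).
rewrite /class_sum mulr_sumr; apply: eq_bigr => y _.
by rewrite (H (paired_point _ e y)) mulrCA.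
Qed.

Lemma orbit_sum_class_odd h q (e : bool) f : (e -> ~~ odd h) ->
  let m := (q + (e + q))%N in (0 < m)%N -> odd (m + f) ->
  exists b1 b2 : bool, orbit_sum (-1) h m f =
    (-1) ^+ b1 * class_sum h q e f (uphalf (m + f) - uphalf f) +
    (-1) ^+ b2 * class_sum h q e f ((m + f)./2 - uphalf f).
Proof.
move=> he m m0 oN; have [b [k ->]] := @orbit_sum_det (-1) h q f e (sqrr_sign _ 1) he.
have [s ->] := sign_pow b k; have [s1 [s2 H]] := det_gauss_parity_odd oN m0.
exists (s (+) s1), (s (+) s2); rewrite !signr_addb -!mulrA -mulrDr; congr (_ * _).
rewrite /class_sum !mulr_sumr -big_split; apply: eq_bigr => y _ /=.
by rewrite (H (paired_point _ e y)) mulrDr ![_ * (_ ^+ _ * _)]mulrCA.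
Qed.

(** * The signed sum for odd K *)

(** Rows and columns have common factors; the remaining entries are monic polynomials
in n + i, which reduces everything to a Vandermonde determinant. *)
Lemma det_binomial_shift n F q :
  \det (\matrix_(i < q, j < q) 'C(n + i, F + j)%:R) =
  \prod_(i < q) ((n + i) ^_ F)%:R * \prod_(j < q) ((F + j)`!)%:R^-1 * sfact q :> rat.
Proof.
pose V : 'M[rat]_q := \matrix_(i < q, j < q) ((false == false)%:R * ((n + i)%:R : rat) ^+ j).
have DP (P : nat -> {poly rat}) : (forall i, size (P i) = i.+1) ->
  \det (\matrix_(i < q, j < q) (P j).[(n + i)%:R]) = \prod_(i < q) lead_coef (P i) * \det V.
  move=> sz; rewrite -(@det_class_poly q (fun=> false) (fun i => i) (fun i => P i) (fun=> false)
     (fun i => (n + i)%:R)) //.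
  - by congr (\det _); apply/matrixP => i j; rewrite !mxE mul1r.
  - by move=> i j _ /val_inj.
  - by move=> i k ki; exists (Ordinal (ltn_trans ki (ltn_ord i))).
have szf (a : rat) g j : a != 0 -> size (a *: fall_poly g j) = j.+1.
  by move=> a0; have /andP[_ /eqP sz] := fall_poly_deg g j; rewrite size_scale.
have lf (a : rat) g j : lead_coef (a *: fall_poly g j) = a.
  by have /andP[/monicP l1 _] := fall_poly_deg g j; rewrite lead_coefZ l1 mulr1.
have DV : \det V = sfact q.
  have := DP (fun j => (j`!)%:R^-1 *: fall_poly n j) (fun j => szf _ _ _ _).
  have nz k : k`!%:R^-1 != 0 :> rat by rewrite invr_eq0 fact_neq0.
  move=> H; have {H} := H (fun j => nz j).
  rewrite (eq_bigr (fun j : 'I_q => (j`!)%:R^-1)) => [|j _]; last by rewrite lf.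
  rewrite prodfV -/(sfact q).
  have -> : \matrix_(i < q, j < q) (j`!%:R^-1 *: fall_poly n j).[(n + i)%:R] =
     \matrix_(i < q, j < q) 'C(i, j)%:R :> 'M[rat]_q.
    apply/matrixP => i j; rewrite !mxE hornerZ.
    have -> : 'C(i, j)%:R = (i ^_ j)%:R / (j`!)%:R :> rat.
      by rewrite -bin_ffact natrM mulfK ?fact_neq0.
    rewrite mulrC ffact_natr /fall_poly horner_prod; congr (_ / _).
    by apply: eq_bigr => k _; rewrite !hornerE !natrD; ring.
  rewrite (@det_graded _ _ (fun i : 'I_q => q - i)%N) => [|i j ij le].
    rewrite big1 => [|i _]; last by rewrite mxE binn.
    by move=> H1; rewrite -[LHS](mulVKf (sfact_neq0 q)) -H1 mulr1.
  rewrite mxE bin_small //; move: ij; rewrite -val_eqE /=.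
  by have := ltn_ord i; have := ltn_ord j; lia.
have -> : \matrix_(i < q, j < q) 'C(n + i, F + j)%:R =
  diag_mx (\row_(i < q) ((n + i) ^_ F)%:R) *m
  \matrix_(i < q, j < q) (((F + j)`!)%:R^-1 *: fall_poly F j).[(n + i)%:R] :> 'M[rat]_q.
  by apply/matrixP => i j; rewrite mul_diag_mx !mxE bin_fall hornerZ.
rewrite det_mulmx det_diag (DP (fun j => ((F + j)`!)%:R^-1 *: fall_poly F j)) => [|i]; last first.
  by rewrite szf // invr_eq0 fact_neq0.
rewrite DV mulrA; congr (_ * _ * _); first by apply: eq_bigr => i _; rewrite mxE.
by apply: eq_bigr => i _; rewrite lf.
Qed.

(** After reversing the rows, the Chu-Vandermonde formula says that multiplication by
the unitriangular matrix of Pascal's triangle gives the matrix of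
[det_binomial_shift]. *)
Lemma det_binomial_hankel s q f : exists b : bool,
  \det (\matrix_(i < q, j < q) 'C(s + q + f, (f + i + j).+1)%:R) =
  (-1) ^+ b * macmahon q (q + f) s :> rat.
Proof.
have [b Hb] := det_mxsub_inj rat (@rev_ord_inj q) (@inj_id 'I_q).
exists b; rewrite -[LHS](signrMK b) -Hb; congr (_ * _).
set n := (s + q + f)%N; set F := (f + q)%N.
have -> : mxsub (@rev_ord q) id (\matrix_(i < q, j < q) 'C(n, (f + i + j).+1)%:R) =
  \matrix_(k < q, j < q) 'C(n, F + j - k)%:R :> 'M[rat]_q.
  apply/matrixP => i j; rewrite !mxE /=; congr ('C(_, _)%:R).
  by rewrite /F; have := ltn_ord i; lia.
have -> : \det (\matrix_(k < q, j < q) 'C(n, F + j - k)%:R : 'M[rat]_q) =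
  \det (\matrix_(i < q, j < q) 'C(n + i, F + j)%:R : 'M[rat]_q).
  pose L : 'M[rat]_q := \matrix_(i, k) 'C(i, k)%:R.
  have detL : \det L = 1.
    rewrite (@det_graded _ _ (fun i : 'I_q => q - i)%N) => [|i j ij le].
      by apply: big1 => i _; rewrite mxE binn.
    rewrite mxE bin_small //; move: ij; rewrite -val_eqE /=.
    by have := ltn_ord i; have := ltn_ord j; lia.
  rewrite -[LHS]mul1r -{1}detL -det_mulmx; congr (\det _); apply/matrixP => i j.
  rewrite !mxE.
  rewrite (eq_bigr (fun k : 'I_q => ('C(i, k) * 'C(n, F + j - k))%:R)) => [|k _]; last first.
    by rewrite !mxE natrM.
  rewrite -natr_sum [(n + i)%N]addnC -binomial.Vandermonde; congr (_%:R).
  have qF : (q <= (F + j).+1)%N by rewrite /F; lia.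
  rewrite (big_ord_widen _ (fun k => 'C(i, k) * 'C(n, F + j - k))%N qF) big_mkcond /=.
  apply: eq_bigr => k _; case: ltnP => // qk.
  by rewrite bin_small // (leq_trans (ltn_ord i)).
rewrite det_binomial_shift (eq_bigr (fun i : 'I_q => ((n + i)`!)%:R / ((s + i)`!)%:R)) => [|i _]; last first.
  rewrite ffact_ratio; last by rewrite /n /F; lia.
  by congr (_ / (_`!)%:R); rewrite /n /F; lia.
rewrite prodf_div !prod_fact_shift inv_facts_sfact /macmahon /n /F.
have -> : (s + q + f + q = q + (q + f) + s)%N by lia.
have -> : (f + q + q = q + (q + f))%N by lia.
have -> : (q + f + s = s + q + f)%N by lia.
rewrite [(f + q)%N]addnC [(q + s)%N]addnC.
have := sfact_neq0 (s + q + f); have := sfact_neq0 s; have := sfact_neq0 (s + q).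
have := sfact_neq0 (q + (q + f)).
move: (sfact _) (sfact _) (sfact _) (sfact _) (sfact _) (sfact _) (sfact _).
by move=> x1 x2 x3 x4 x5 x6 x7 h1 h2 h3 h4; field_ok.
Qed.

Definition even_rep (K x : nat) : nat := if odd x then (K - x)%N else x.

(** Every pair of points has one even and one odd member. So the matrix is the product
of a matrix that records which member is even and of a block diagonal matrix. The
signs (-1) ^ y_i come from the first factor, and cancel those of the signed sum. *)
Lemma paired_det_odd K X q f (y : {ffun 'I_q -> 'I_X}) :
  odd K -> (X <= K.+1)%N ->
  \det (\matrix_(i < q + q, j < q + q) parity_col f q j (paired_point K false y i)) =
  (-1) ^+ q * \prod_i (-1) ^+ (y i) *
  (\det (\matrix_(i < q, j < q) 'C((even_rep K (y i))./2, uphalf f + j)%:R) *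
   \det (\matrix_(i < q, j < q) 'C((K - even_rep K (y i))./2, f./2 + j)%:R)).
Proof.
move=> oK XK.
have yK i : (y i <= K)%N by rewrite -ltnS (leq_trans (ltn_ord _)).
set P := (X in _ * (\det X * _)); set Q := (X in _ * (_ * \det X)).
pose a := \row_(i < q) (odd (y i))%:R : 'rV[rat]_q.
pose b := \row_(i < q) (~~ odd (y i))%:R : 'rV[rat]_q.
pose T := block_mx (diag_mx a) (diag_mx b) (diag_mx b) (diag_mx a).
have -> : \matrix_(i < q + q, j < q + q) parity_col f q j (paired_point K false y i) =
  T *m block_mx P 0 0 Q.
  rewrite mulmx_block !mulmx0 !addr0 !add0r; apply/matrixP => i j.
  case: (split_ordP i) => i' ->; case: (split_ordP j) => j' ->;
  rewrite ?(block_mxEul, block_mxEur, block_mxEdl, block_mxEdr) mul_diag_mx !mxE /parity_col /paired_point /=.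
  - rewrite !ltn_ord val_atE oddB ?yK // oK /= negbK /even_rep.
    by case: (odd (y i')); rewrite ?mul0r.
  - rewrite ltn_ord val_atE [(_ < q)%N]ltnNge leq_addr addKn /= oddB ?yK // oK /even_rep.
    by case: (odd (y i')); rewrite ?mul0r.
  - rewrite [(q + i' < q)%N]ltnNge leq_addr ltn_ord addn0 [(q + i' < q)%N]ltnNge leq_addr /= addKn val_atE /even_rep.
    by case: (odd (y i')); rewrite ?mul0r.
  - rewrite ![(q + _ < q)%N]ltnNge !leq_addr addn0 ![(q + _ < q)%N]ltnNge !leq_addr /= !addKn val_atE /even_rep.
    by case: ifP => oy; rewrite ?mul0r // subKn.
rewrite det_mulmx det_ublock; congr (_ * _).
(* Since diag a + diag b = 1, conjugation by a unitriangular block matrix makes T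
   block triangular, with diagonal blocks 1 and diag a - diag b. *)
pose L1 : 'M[rat]_(q + q) := block_mx 1%:M 0 1%:M 1%:M.
pose L2 : 'M[rat]_(q + q) := block_mx 1%:M 0 (- 1%:M) 1%:M.
have d1 : \det L1 = 1 by rewrite det_lblock !det1 mulr1.
have d2 : \det L2 = 1 by rewrite det_lblock !det1 mulr1.
have ab : diag_mx a + diag_mx b = 1%:M.
  apply/matrixP => i j; rewrite !mxE; case: (odd (y i)); rewrite /= ?mul0rn ?addr0 ?add0r //.
have -> : \det T = \det (L2 *m T *m L1) by rewrite !det_mulmx d1 d2 mulr1 mul1r.
have -> : L2 *m T *m L1 = block_mx 1%:M (diag_mx b) 0 (diag_mx a - diag_mx b).
  rewrite /L2 /T /L1 !mulmx_block !mul1mx !mul0mx !mulmx1 !mulmx0 !addr0 !add0r !mulNmx !mul1mx.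
  congr block_mx; first by [].
    rewrite addrACA -opprD ab [diag_mx b + _]addrC ab addNr //.
  by rewrite addrC.
rewrite det_ublock det1 mul1r -linearB det_diag.
have -> : (-1) ^+ q = \prod_(i < q) (-1) :> rat by rewrite prodr_const card_ord.
rewrite -big_split; apply: eq_bigr => i _ /=; rewrite !mxE -[(-1) ^+ (y i)]signr_odd.
by case: (odd (y i)) => /=; rewrite ?expr1 ?expr0; ring.
Qed.

(** The map [even_rep] is a bijection from the points above K / 2 onto the even
points. *)
Lemma sum_even_rep K (G : nat -> rat) : odd K ->
  \sum_(x < K.+1) (if (K < x.*2)%N then G (even_rep K x)./2 else 0) =
  \sum_(z < (K./2).+1) G z.
Proof.
move=> oK; pose g x := G (even_rep K x)./2.
have gK x : (x <= K)%N -> g (K - x)%N = g x.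
  move=> xK; rewrite /g /even_rep oddB // oK.
  by case ox: (odd x) => /=; rewrite ?subKn.
transitivity (\sum_(x < K.+1 | ~~ odd x) g x); last first.
  have -> : (K.+1 = (K./2).+1.*2)%N by lia.
  rewrite (eq_bigl (fun x : 'I_(K./2.+1.*2) => odd x == false)) => [|x]; last by rewrite eqbF_neg.
  rewrite sum_parity_class; apply: eq_bigr => z _.
  by rewrite addn0 /g /even_rep odd_double doubleK.
rewrite -big_mkcond (bigID (fun x : 'I_K.+1 => odd x)) /= addrC.
rewrite [RHS](bigID (fun x : 'I_K.+1 => (K < x.*2)%N)) /=; congr (_ + _).
  by apply: eq_bigl => x; rewrite andbC.
rewrite [RHS](reindex_inj rev_ord_inj) /=; apply: eq_big => [x|x _].
  by have := ltn_ord x; lia.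
by rewrite subSS gK // -ltnS.
Qed.

(** The Chu-Vandermonde formula in the upper arguments: choosing a + b + 1 elements of
an (n + 1)-element chain, split by the position of the element in place a + 1. *)
Lemma sum_bin_conv n a b :
  (\sum_(z < n.+1) 'C(z, a) * 'C(n - z, b) = 'C(n.+1, (a + b).+1))%N.
Proof.
elim: n a b => [|n IH] a b.
  by rewrite big_ord1 !bin0n binS bin0n; case: a b => [|a] [|b].
rewrite big_ord_recr /= subnn; case: b => [|b].
  have IH0 := IH a 0%N; rewrite addn0 in IH0.
  rewrite bin0 muln1 addn0 [RHS]binS -IH0; congr (_ + _)%N.
  by apply: eq_bigr => z _; rewrite !bin0.
rewrite bin0n muln0 addn0 addnS binS -IH -addnS -IH -big_split /=.
apply: eq_bigr => z _; have zn : (z <= n)%N by have := ltn_ord z.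
by rewrite subSn // binS mulnDr.
Qed.

(** By [paired_det_odd] all signs cancel and Cauchy-Binet gives a determinant of
convolutions of binomial coefficients. *)
Lemma class_sum_odd_val s q f : (0 < q)%N ->
  exists b : bool, class_sum s.*2 q false f q = (-1) ^+ b * macmahon q (q + f) s.
Proof.
move=> q0; have [b Hb] := det_binomial_hankel s q f.
exists (b (+) odd q); rewrite signr_addb signr_odd mulrAC -Hb mulrC /class_sum.
set X := (s.*2 + _)%N; set K := _.-1.
have oK : odd K by rewrite /K; lia.
have XE : X = (K.+1 - f)%N by rewrite /K /X; lia.
have XK : (X <= K.+1)%N by lia.
pose c x : rat := if (K < x.*2)%N then 1 else 0.
pose P (j : 'I_q) x : rat := 'C((even_rep K x)./2, uphalf f + j)%:R.
pose Q (j : 'I_q) x : rat := 'C((K - even_rep K x)./2, f./2 + j)%:R.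
transitivity ((-1) ^+ q * \sum_(y : {ffun 'I_q -> 'I_X} | strictly_decreasing y) (\prod_i c (y i)) *
   (\det (\matrix_(i, j) P j (y i)) * \det (\matrix_(i, j) Q j (y i)))).
  rewrite mulr_sumr; apply: eq_bigr => y _; rewrite (paired_det_odd _ _ oK XK).
  have -> : \prod_i c (y i) = \prod_i (if (K < (y i).*2)%N then (-1) ^+ y i else 0) * \prod_i (-1) ^+ (y i).
    rewrite -big_split; apply: eq_bigr => i _ /=; rewrite /c; case: ifP => _; last by rewrite mul0r.
    by rewrite -expr2 -exprM mulnC exprM sqrrN !expr1n.
  rewrite /P /Q; move: (\det _) (\det _) (\prod_i _) (\prod_i _) ((-1) ^+ q).
  by move=> d1 d2 p1 p2 s1; ring.
rewrite Cauchy_Binet_sorted; congr (_ * \det _); apply/matrixP => i j; rewrite !mxE.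
pose G z : rat := 'C(z, uphalf f + i)%:R * 'C(K./2 - z, f./2 + j)%:R.
transitivity (\sum_(x < K.+1) (if (K < x.*2)%N then G (even_rep K x)./2 else 0)).
  rewrite (big_ord_widen _ (fun x => c x * (P i x * Q j x)) XK) big_mkcond.
  apply: eq_bigr => x _; have xK := ltn_ord x; rewrite /c /P /Q /G.
  have -> : ((K - even_rep K x)./2 = K./2 - (even_rep K x)./2)%N.
    by rewrite /even_rep; case: ifP => ox; lia.
  case: ifP => Kx; case: ifP => xX; rewrite ?mul0r ?mul1r //.
  case ox: (odd x); rewrite /even_rep ox.
    by rewrite bin_small ?mul0r //; lia.
  by rewrite ['C(_ - _, _)]bin_small ?mulr0 //; lia.
rewrite sum_even_rep // /G; under eq_bigr do rewrite -natrM.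
rewrite -natr_sum; congr (_%:R).
rewrite sum_bin_conv; congr 'C(_, _); rewrite /K; first by lia.
by lia.
Qed.

(** Exactly q of the points are even, so fewer than q columns on even points leave a
zero block that is too large. *)
Lemma class_sum_odd_zero h q f m0 : odd (h + (q + q) + f + f).-1 ->
  (m0 < q)%N -> class_sum h q false f m0 = 0.
Proof.
move=> oK m0q; rewrite /class_sum; set K := _.-1; apply: big1 => y sy.
have yK i : (y i <= K)%N by have := ltn_ord (y i); rewrite /K /=; lia.
suff -> : \det (\matrix_(i < q + q, j < q + q) parity_col f m0 j (paired_point K false y i)) = 0.
  by rewrite mulr0.
pose Ev := [set i : 'I_(q + q) | ~~ odd (paired_point K false y i)].
have cE : #|Ev| = q.
  have -> : #|Ev| = (\sum_(i < q + q) ~~ odd (paired_point K false y i))%N.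
    by rewrite -sum1_card big_mkcond; apply: eq_bigr => i _; rewrite inE; case: (odd _).
  rewrite big_split_ord /= -big_split -[RHS]card_ord -sum1_card; apply: eq_bigr => i _ /=.
  rewrite /paired_point ltn_ord [(_ < q)%N]ltnNge leq_addr addn0 [(_ < q)%N]ltnNge leq_addr /=.
  by rewrite addKn val_atE oddB ?yK // oK /=; case: (odd _).
have c1 : #|[set j : 'I_(q + q) | (j < m0)%N]| = m0 by apply: card_ltn_ord; lia.
have c3 := cardsC [set j : 'I_(q + q) | (j < m0)%N].
apply: (@det_zero_block _ _ Ev (~: [set j : 'I_(q + q) | (j < m0)%N])); last first.
  by rewrite card_ord in c3; rewrite -[X in (X < _)%N]c3 c1 ltn_add2r cE.
by move=> i j; rewrite !inE mxE /parity_col => /negbTE oi /negbTE->; rewrite oi mul0r.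
Qed.

(** * Comparison of products *)

(** Stanley's formula for each parity pattern of the sides (e even, o odd), with the
arguments of the box numbers in the order in which the signed values produce
them. *)
Lemma SC_val_eee s p t : (SC s.*2 p.*2 t.*2)%:R = macmahon p t s ^+ 2.
Proof. by rewrite Stanley_eee [macmahon s p t]macmahon_sym12 macmahon_sym23. Qed.
Lemma SC_val_oee s p t : (SC s.*2.+1 p.*2 t.*2)%:R = macmahon p t s * macmahon p t s.+1.
Proof. by rewrite Stanley_oee ![macmahon _ p t]macmahon_sym12 ![macmahon p _ t]macmahon_sym23. Qed.
Lemma SC_val_eoe s p t : (SC s.*2 p.*2.+1 t.*2)%:R = macmahon p t s * macmahon p.+1 t s.
Proof. by rewrite SC_swap12 Stanley_oee ![macmahon _ s t]macmahon_sym23. Qed.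
Lemma SC_val_eeo s p t : (SC s.*2 p.*2 t.*2.+1)%:R = macmahon p t s * macmahon p t.+1 s.
Proof. by rewrite SC_swap23 SC_val_eoe macmahon_sym12 [X in _ * X]macmahon_sym12. Qed.
Lemma SC_val_eoo s p t : (SC s.*2 p.*2.+1 t.*2.+1)%:R = macmahon p t.+1 s * macmahon p.+1 t s.
Proof. by rewrite Stanley_eoo ![macmahon s _ _]macmahon_sym12 ![macmahon _ s _]macmahon_sym23. Qed.
Lemma SC_val_oeo s p t : (SC s.*2.+1 p.*2 t.*2.+1)%:R = macmahon p t s.+1 * macmahon p t.+1 s.
Proof. by rewrite SC_swap12 Stanley_eoo [macmahon p s.+1 t]macmahon_sym23 [macmahon p s t.+1]macmahon_sym23 mulrC. Qed.
Lemma SC_val_ooe s p t : (SC s.*2.+1 p.*2.+1 t.*2)%:R = macmahon p t s.+1 * macmahon p.+1 t s.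
Proof. by rewrite SC_swap23 SC_val_oeo macmahon_sym12 [X in _ * X]macmahon_sym12. Qed.

(** If N is odd, two class sums occur, with m0 differing by 1; at most one has the
parity required by [class_sum_zero]. *)
Lemma orbit_sum_val h q0 q1 (e0 e1 : bool) f :
  let q := (q0 + q1)%N in let e := e0 || e1 in let m := (q + (e + q))%N in
  let K := (h + m + f + f).-1 in
  ~~ odd K -> (0 < m)%N -> ~~ (e0 && e1) -> (e -> ~~ odd h) -> (e -> odd K./2 = e1) ->
  (q0.*2 + e0 + uphalf f = uphalf (m + f) \/ q0.*2 + e0 + uphalf f = (m + f)./2)%N ->
  exists b : bool, orbit_sum (-1) h m f =
    (-1) ^+ b * (paired_value q0 e0 (uphalf f) K./2 * paired_value q1 e1 f./2 K./2.-1).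
Proof.
move=> q e m K oK m_gt0 e01 he emid m0E.
have [b HW] := @class_sum_val h q0 q1 e0 e1 f oK m_gt0 e01 emid.
have m0par : odd (q0.*2 + e0) = e && ~~ odd K./2.
  rewrite oddD odd_double oddb /=; case: (boolP e) emid => [|].
    by move=> ee /(_ isT)->; move: e01 ee; rewrite /e; case: (e0) (e1) => -[].
  by rewrite negb_or => /andP[/negbTE->].
case: (boolP (odd (m + f))) => oN; last first.
  have [b' ->] := orbit_sum_class_even he m_gt0 oN.
  have -> : (uphalf (m + f) - uphalf f = q0.*2 + e0)%N by move: m0E oN; lia.
  by exists (b' (+) b); rewrite HW signr_addb mulrA.
have [b1 [b2 ->]] := orbit_sum_class_odd he m_gt0 oN.
case: m0E => m0E.
  have -> : (uphalf (m + f) - uphalf f = q0.*2 + e0)%N by lia.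
  rewrite [X in _ + _ * X]class_sum_zero ?mulr0 ?addr0 //.
  - by exists (b1 (+) b); rewrite HW signr_addb mulrA.
  - by move: m0E oN; lia.
  - rewrite -m0par -/m (_ : (q0.*2 + e0 = ((m + f)./2 - uphalf f).+1)%N) /=.
      by case: (odd _).
    by move: m0E oN m_gt0; move: (m) (q0.*2 + e0)%N => m' k; lia.
have -> : ((m + f)./2 - uphalf f = q0.*2 + e0)%N by lia.
rewrite [X in _ * X + _]class_sum_zero ?mulr0 ?add0r //.
- by exists (b2 (+) b); rewrite HW signr_addb mulrA.
- by move: m0E oN; lia.
- rewrite -m0par -/m (_ : (uphalf (m + f) - uphalf f = (q0.*2 + e0).+1)%N) /=.
    by case: (odd _).
  by move: m0E oN m_gt0; move: (m) (q0.*2 + e0)%N => m' k; lia.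
Qed.

Lemma orbit_sum_zero h q (e : bool) f :
  let m := (q + (e + q))%N in let K := (h + m + f + f).-1 in
  ~~ odd K -> (0 < m)%N -> (e -> ~~ odd h) -> ~~ odd (m + f) ->
  odd (uphalf (m + f) - uphalf f) != e && ~~ odd K./2 ->
  orbit_sum (-1) h m f = 0.
Proof.
move=> m K oK m_gt0 he oN par; have [b ->] := orbit_sum_class_even he m_gt0 oN.
by rewrite class_sum_zero ?mulr0 //; rewrite /m; lia.
Qed.

Lemma orbit_sum_eee s p f : (0 < p)%N ->
  exists b : bool, orbit_sum (-1) s.*2 (p + (false + p)) f = (-1) ^+ b * macmahon p (p + f) s.
Proof.
move=> p0; have m0 : (0 < p + (false + p))%N by lia.
have he : false -> ~~ odd s.*2 by [].
have [b HW] := class_sum_odd_val s f p0.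
case: (boolP (odd (p + (false + p) + f))) => oN; last first.
  have [b' ->] := orbit_sum_class_even he m0 oN; exists (b' (+) b).
  have -> : (uphalf (p + (false + p) + f) - uphalf f = p)%N by lia.
  by rewrite HW signr_addb mulrA.
have [b1 [b2 ->]] := orbit_sum_class_odd he m0 oN; exists (b1 (+) b).
have -> : (uphalf (p + (false + p) + f) - uphalf f = p)%N by lia.
by rewrite [X in _ + _ * X]class_sum_odd_zero ?mulr0 ?addr0 ?HW ?signr_addb ?mulrA //; lia.
Qed.

(** Even points number 2 q0 and odd points 2 q1, with q0 and q1 determined by the
parities of p and f. In each case both sides are the same product of four
MacMahon numbers, or one of the two factors SC has three odd sides and the
signed sum vanishes by parity. *)
Lemma orbit_sum_oee s p f : (0 < p)%N ->
  exists b : bool, orbit_sum (-1) s.*2.+1 (p + (false + p)) f =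
    (-1) ^+ b * (SC s.+1 p (p + f) * SC s p (p + f))%:R.
Proof.
move=> p0; have key q0 q1 : (q0 + q1 = p)%N ->
  (q0.*2 + uphalf f = uphalf (p + (false + p) + f) \/
   q0.*2 + uphalf f = (p + (false + p) + f)./2)%N ->
  exists b : bool, orbit_sum (-1) s.*2.+1 (p + (false + p)) f =
    (-1) ^+ b * (paired_value q0 false (uphalf f) (s + p + f) * paired_value q1 false f./2 (s + p + f).-1).
  move=> qp; move: p0; rewrite -{}qp => p0 m0E.
  have KE : (s.*2.+1 + (q0 + q1 + (false + (q0 + q1))) + f + f).-1 = (s + (q0 + q1) + f).*2.
    by lia.
  have H := @orbit_sum_val s.*2.+1 q0 q1 false false f; cbv zeta beta iota delta [orb] in H.
  rewrite KE doubleK odd_double !addn0 in H; apply: H => //.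
  by rewrite addn_gt0 p0.
case op : (odd p); case of_ : (odd f); case os : (odd s).
- have [b ->] := key p./2 (p./2).+1 ltac:(lia) ltac:(lia); exists b; congr (_ * _).
  set r := p./2; set g := f./2; set u := s./2.
  have -> : uphalf f = g.+1 by lia.
  have -> : (s + p + f).-1 = (u + r.+1 + g).*2 by lia.
  have -> : (s + p + f)%N = (u.+1 + r + g.+1).*2.-1 by lia.
  rewrite paired_value_odd paired_value_even natrM.
  have -> : (p + f)%N = (r + g).+1.*2 by lia.
  have -> : s.+1 = u.+1.*2 by lia.
  have -> : s = u.*2.+1 by lia.
  have -> : p = r.*2.+1 by lia.
  by rewrite SC_val_eoe SC_val_ooe ?addnS ?addSn; ring.
- have [b ->] := key p./2 (p./2).+1 ltac:(lia) ltac:(lia); exists b; congr (_ * _).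
  set r := p./2; set g := f./2; set u := s./2.
  have -> : uphalf f = g.+1 by lia.
  have -> : (s + p + f).-1 = (u + r.+1 + g).*2.-1 by lia.
  have -> : (s + p + f)%N = (u + r + g.+1).*2 by lia.
  rewrite paired_value_odd paired_value_even natrM.
  have -> : (p + f)%N = (r + g).+1.*2 by lia.
  have -> : s.+1 = u.*2.+1 by lia.
  have -> : s = u.*2 by lia.
  have -> : p = r.*2.+1 by lia.
  by rewrite SC_val_eoe SC_val_ooe ?addnS ?addSn; ring.
- exists false; rewrite (@orbit_sum_zero s.*2.+1 p false f) //; [|by lia..].
  by rewrite [SC s _ _]SC_ooo ?muln0 ?mulr0 //; lia.
- exists false; rewrite (@orbit_sum_zero s.*2.+1 p false f) //; [|by lia..].
  by rewrite [SC s.+1 _ _]SC_ooo ?mul0n ?mulr0 //; lia.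
- have [b ->] := key p./2 p./2 ltac:(lia) ltac:(lia); exists b; congr (_ * _).
  set r := p./2; set g := f./2; set u := s./2.
  have -> : uphalf f = g.+1 by lia.
  have -> : (s + p + f).-1 = (u.+1 + r + g).*2.-1 by lia.
  have -> : (s + p + f)%N = (u + r + g.+1).*2 by lia.
  rewrite paired_value_odd paired_value_even natrM.
  have -> : (p + f)%N = (r + g).*2.+1 by lia.
  have -> : s.+1 = u.+1.*2 by lia.
  have -> : s = u.*2.+1 by lia.
  have -> : p = r.*2 by lia.
  by rewrite SC_val_eeo SC_val_oeo ?addnS ?addSn; ring.
- have [b ->] := key p./2 p./2 ltac:(lia) ltac:(lia); exists b; congr (_ * _).
  set r := p./2; set g := f./2; set u := s./2.
  have -> : uphalf f = g.+1 by lia.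
  have -> : (s + p + f).-1 = (u + r + g).*2 by lia.
  have -> : (s + p + f)%N = (u + r + g.+1).*2.-1 by lia.
  rewrite paired_value_odd paired_value_even natrM.
  have -> : (p + f)%N = (r + g).*2.+1 by lia.
  have -> : s.+1 = u.*2.+1 by lia.
  have -> : s = u.*2 by lia.
  have -> : p = r.*2 by lia.
  by rewrite SC_val_eeo SC_val_oeo ?addnS ?addSn; ring.
- have [b ->] := key p./2 p./2 ltac:(lia) ltac:(lia); exists b; congr (_ * _).
  set r := p./2; set g := f./2; set u := s./2.
  have -> : uphalf f = g by lia.
  have -> : (s + p + f).-1 = (u + r + g).*2 by lia.
  have -> : (s + p + f)%N = (u.+1 + r + g).*2.-1 by lia.
  rewrite paired_value_odd paired_value_even natrM.
  have -> : (p + f)%N = (r + g).*2 by lia.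
  have -> : s.+1 = u.+1.*2 by lia.
  have -> : s = u.*2.+1 by lia.
  have -> : p = r.*2 by lia.
  by rewrite SC_val_eee SC_val_oee ?addnS ?addSn; ring.
- have [b ->] := key p./2 p./2 ltac:(lia) ltac:(lia); exists b; congr (_ * _).
  set r := p./2; set g := f./2; set u := s./2.
  have -> : uphalf f = g by lia.
  have -> : (s + p + f).-1 = (u + r + g).*2.-1 by lia.
  have -> : (s + p + f)%N = (u + r + g).*2 by lia.
  rewrite paired_value_odd paired_value_even natrM.
  have -> : (p + f)%N = (r + g).*2 by lia.
  have -> : s.+1 = u.*2.+1 by lia.
  have -> : s = u.*2 by lia.
  have -> : p = r.*2 by lia.
  by rewrite SC_val_eee SC_val_oee ?addnS ?addSn; ring.
Qed.

(** As before, with the middle point in the class given by the parity of K / 2. *)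
Lemma orbit_sum_eoo s p f :
  exists b : bool, orbit_sum (-1) s.*2 (p + (true + p)) f =
    (-1) ^+ b * (SC s p.+1 (p + f) * SC s p (p + f).+1)%:R.
Proof.
have key q0 q1 (e1 : bool) : (q0 + q1 = p)%N -> odd (s + p + f) = e1 ->
  (q0.*2 + ~~ e1 + uphalf f = uphalf (p + (true + p) + f) \/
   q0.*2 + ~~ e1 + uphalf f = (p + (true + p) + f)./2)%N ->
  exists b : bool, orbit_sum (-1) s.*2 (p + (true + p)) f =
    (-1) ^+ b * (paired_value q0 (~~ e1) (uphalf f) (s + p + f) * paired_value q1 e1 f./2 (s + p + f).-1).
  move=> <- e1E m0E.
  have KE : (s.*2 + (q0 + q1 + (true + (q0 + q1))) + f + f).-1 = (s + (q0 + q1) + f).*2.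
    by lia.
  have H := @orbit_sum_val s.*2 q0 q1 (~~ e1) e1 f; cbv zeta in H.
  have ee : ~~ e1 || e1 by case: (e1).
  rewrite ee KE doubleK odd_double in H; apply: H => //.
  - by rewrite addnCA.
  - by case: (e1).
  - by rewrite odd_double.
case op : (odd p); case of_ : (odd f); case os : (odd s).
- exists false; rewrite (@orbit_sum_zero s.*2 p true f) //; [|by lia..].
  by rewrite [SC s p _]SC_ooo ?muln0 ?mulr0 //; lia.
- have [b ->] := key (p./2) (p./2.+1) false ltac:(lia) ltac:(lia) ltac:(lia); exists b; congr (_ * _).
  set r := p./2; set g := f./2; set u := s./2.
  have -> : uphalf f = g.+1 by lia.
  have -> : (s + p + f).-1 = (u + r.+1 + g).*2.-1 by lia.
  have -> : (s + p + f)%N = (u + r + g.+1).*2 by lia.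
  rewrite [~~ _]/= paired_value_mid paired_value_odd natrM.
  have -> : (p + f).+1 = (r + g).+1.*2.+1 by lia.
  have -> : (p + f)%N = (r + g).+1.*2 by lia.
  have -> : p.+1 = r.+1.*2 by lia.
  have -> : p = r.*2.+1 by lia.
  have -> : s = u.*2 by lia.
  by rewrite SC_val_eee SC_val_eoo ?addnS ?addSn; ring.
- have [b ->] := key (p./2) (p./2.+1) false ltac:(lia) ltac:(lia) ltac:(lia); exists b; congr (_ * _).
  set r := p./2; set g := f./2; set u := s./2.
  have -> : uphalf f = g by lia.
  have -> : (s + p + f).-1 = (u + r.+1 + g).*2.-1 by lia.
  have -> : (s + p + f)%N = (u.+1 + r + g).*2 by lia.
  rewrite [~~ _]/= paired_value_mid paired_value_odd natrM.
  have -> : (p + f).+1 = (r + g).+1.*2 by lia.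
  have -> : (p + f)%N = (r + g).*2.+1 by lia.
  have -> : p.+1 = r.+1.*2 by lia.
  have -> : p = r.*2.+1 by lia.
  have -> : s = u.*2.+1 by lia.
  by rewrite SC_val_oeo SC_val_ooe ?addnS ?addSn; ring.
- have [b ->] := key (p./2.+1) (p./2) true ltac:(lia) ltac:(lia) ltac:(lia); exists b; congr (_ * _).
  set r := p./2; set g := f./2; set u := s./2.
  have -> : uphalf f = g by lia.
  have -> : (s + p + f).-1 = (u + r + g).*2 by lia.
  have -> : (s + p + f)%N = (u + r.+1 + g).*2.-1 by lia.
  rewrite [~~ _]/= paired_value_odd paired_value_mid natrM.
  have -> : (p + f).+1 = (r + g).+1.*2 by lia.
  have -> : (p + f)%N = (r + g).*2.+1 by lia.
  have -> : p.+1 = r.+1.*2 by lia.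
  have -> : p = r.*2.+1 by lia.
  have -> : s = u.*2 by lia.
  by rewrite SC_val_eeo SC_val_eoe ?addnS ?addSn; ring.
- exists false; rewrite (@orbit_sum_zero s.*2 p true f) //; [|by lia..].
  by rewrite SC_ooo ?mul0n ?mulr0 //=; lia.
- have [b ->] := key (p./2) (p./2) true ltac:(lia) ltac:(lia) ltac:(lia); exists b; congr (_ * _).
  set r := p./2; set g := f./2; set u := s./2.
  have -> : uphalf f = g.+1 by lia.
  have -> : (s + p + f).-1 = (u + r + g).*2 by lia.
  have -> : (s + p + f)%N = (u + r + g.+1).*2.-1 by lia.
  rewrite [~~ _]/= paired_value_odd paired_value_mid natrM.
  have -> : (p + f).+1 = (r + g).+1.*2 by lia.
  have -> : (p + f)%N = (r + g).*2.+1 by lia.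
  have -> : p.+1 = r.*2.+1 by lia.
  have -> : p = r.*2 by lia.
  have -> : s = u.*2 by lia.
  by rewrite SC_val_eoo SC_val_eee ?addnS ?addSn; ring.
- have [b ->] := key (p./2) (p./2) true ltac:(lia) ltac:(lia) ltac:(lia); exists b; congr (_ * _).
  set r := p./2; set g := f./2; set u := s./2.
  have -> : uphalf f = g by lia.
  have -> : (s + p + f).-1 = (u + r + g).*2 by lia.
  have -> : (s + p + f)%N = (u.+1 + r + g).*2.-1 by lia.
  rewrite [~~ _]/= paired_value_odd paired_value_mid natrM.
  have -> : (p + f).+1 = (r + g).*2.+1 by lia.
  have -> : (p + f)%N = (r + g).*2 by lia.
  have -> : p.+1 = r.*2.+1 by lia.
  have -> : p = r.*2 by lia.
  have -> : s = u.*2.+1 by lia.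
  by rewrite SC_val_ooe SC_val_oeo ?addnS ?addSn; ring.
- have [b ->] := key (p./2) (p./2) false ltac:(lia) ltac:(lia) ltac:(lia); exists b; congr (_ * _).
  set r := p./2; set g := f./2; set u := s./2.
  have -> : uphalf f = g by lia.
  have -> : (s + p + f).-1 = (u + r + g).*2.-1 by lia.
  have -> : (s + p + f)%N = (u + r + g).*2 by lia.
  rewrite [~~ _]/= paired_value_mid paired_value_odd natrM.
  have -> : (p + f).+1 = (r + g).*2.+1 by lia.
  have -> : (p + f)%N = (r + g).*2 by lia.
  have -> : p.+1 = r.*2.+1 by lia.
  have -> : p = r.*2 by lia.
  have -> : s = u.*2 by lia.
  by rewrite SC_val_eoe SC_val_eeo ?addnS ?addSn; ring.
Qed.

Lemma signed_eee s p t : (0 < p)%N -> (0 < t)%N ->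
  exists b : bool, (signed_sum s.*2 p.*2 t.*2)%:~R = (-1) ^+ b * macmahon s p t.
Proof.
move=> p0 t0; wlog pt : p t p0 t0 / (p <= t)%N => [H|].
  case: (leqP p t) => [|/ltnW] pt; first exact: H.
  have [b1 ->] := @signed_sum_swap s.*2 p.*2 t.*2 ltac:(lia) ltac:(lia).
  have [b2 ->] := H t p t0 p0 pt.
  by exists (b1 (+) b2); rewrite signr_addb mulrA [macmahon s t p]macmahon_sym23.
have -> : t.*2 = (p.*2 + (t - p) + (t - p))%N by lia.
have [b1 ->] := @signed_orbit_sum s.*2 p.*2 (t - p) ltac:(lia).
have -> : p.*2 = (p + (false + p))%N by lia.
have [b2 ->] := orbit_sum_eee s (t - p) p0; exists (b1 (+) b2).
by rewrite signr_addb mulrA subnKC // [macmahon p t s]macmahon_sym23 macmahon_sym12.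
Qed.

Lemma signed_oee s p t : (0 < p)%N -> (0 < t)%N ->
  exists b : bool, (signed_sum s.*2.+1 p.*2 t.*2)%:~R =
    (-1) ^+ b * (SC s.+1 p t * SC s p t)%:R :> rat.
Proof.
move=> p0 t0; wlog pt : p t p0 t0 / (p <= t)%N => [H|].
  case: (leqP p t) => [|/ltnW] pt; first exact: H.
  have [b1 ->] := @signed_sum_swap s.*2.+1 p.*2 t.*2 ltac:(lia) ltac:(lia).
  have [b2 ->] := H t p t0 p0 pt.
  by exists (b1 (+) b2); rewrite signr_addb mulrA ![SC _ t p]SC_swap23.
have -> : t.*2 = (p.*2 + (t - p) + (t - p))%N by lia.
have [b1 ->] := @signed_orbit_sum s.*2.+1 p.*2 (t - p) ltac:(lia).
have -> : p.*2 = (p + (false + p))%N by lia.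
have [b2 ->] := orbit_sum_oee s (t - p) p0; exists (b1 (+) b2).
by rewrite signr_addb mulrA subnKC.
Qed.

Lemma signed_eoo s p t :
  exists b : bool, (signed_sum s.*2 p.*2.+1 t.*2.+1)%:~R =
    (-1) ^+ b * (SC s p.+1 t * SC s p t.+1)%:R :> rat.
Proof.
wlog pt : p t / (p <= t)%N => [H|].
  case: (leqP p t) => [|/ltnW] pt; first exact: H.
  have [b1 ->] := @signed_sum_swap s.*2 p.*2.+1 t.*2.+1 ltac:(lia) ltac:(lia).
  have [b2 ->] := H t p pt; exists (b1 (+) b2).
  by rewrite signr_addb mulrA [SC s t.+1 p]SC_swap23 [SC s t p.+1]SC_swap23 mulnC.
have -> : t.*2.+1 = (p.*2.+1 + (t - p) + (t - p))%N by lia.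
have [b1 ->] := @signed_orbit_sum s.*2 p.*2.+1 (t - p) ltac:(lia).
have -> : p.*2.+1 = (p + (true + p))%N by lia.
have [b2 ->] := orbit_sum_eoo s p (t - p); exists (b1 (+) b2).
by rewrite signr_addb mulrA subnKC.
Qed.

Lemma int_sign (x : int) (b : bool) (n : nat) :
  x%:~R = (-1) ^+ b * n%:R :> rat -> x = n%:Z \/ x = - n%:Z.
Proof.
case: b => e; [right|left]; apply: (@intr_inj rat); rewrite e.
  by rewrite expr1 mulN1r rmorphN.
by rewrite expr0 mul1r.
Qed.

Theorem theorem2 (a b c : nat) (ha : (0 < a)%N) (hb : (0 < b)%N)
    (hc : (0 < c)%N) :
  [/\ (~~ odd a -> ~~ odd b -> ~~ odd c ->
        (signed_sum a b c)%:~R = B a./2 b./2 c./2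
        \/ (signed_sum a b c)%:~R = - B a./2 b./2 c./2),
      (~~ odd a -> odd b -> odd c ->
        signed_sum a b c
          = (SC a./2 b.+1./2 c.-1./2 * SC a./2 b.-1./2 c.+1./2)%N%:Z
        \/ signed_sum a b c
          = - (SC a./2 b.+1./2 c.-1./2 * SC a./2 b.-1./2 c.+1./2)%N%:Z)
    & (odd a -> ~~ odd b -> ~~ odd c ->
        signed_sum a b c
          = (SC a.+1./2 b./2 c./2 * SC a.-1./2 b./2 c./2)%N%:Z
        \/ signed_sum a b c
          = - (SC a.+1./2 b./2 c./2 * SC a.-1./2 b./2 c./2)%N%:Z)].
Proof.
split=> oa ob oc.
- have [s ->] : exists s, a = s.*2 by exists a./2; lia.
  have [p pE] : exists p, b = p.*2 by exists b./2; lia.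
  have [t tE] : exists t, c = t.*2 by exists c./2; lia.
  have [z] := @signed_eee s p t ltac:(lia) ltac:(lia).
  rewrite pE tE !doubleK B_macmahon => ->.
  by case: z; [right; rewrite expr1 mulN1r|left; rewrite expr0 mul1r].
- have [s ->] : exists s, a = s.*2 by exists a./2; lia.
  have [p ->] : exists p, b = p.*2.+1 by exists b./2; lia.
  have [t ->] : exists t, c = t.*2.+1 by exists c./2; lia.
  have [z] := signed_eoo s p t; move/int_sign.
  by rewrite -!doubleS /= !doubleK.
- have [s ->] : exists s, a = s.*2.+1 by exists a./2; lia.
  have [p pE] : exists p, b = p.*2 by exists b./2; lia.
  have [t tE] : exists t, c = t.*2 by exists c./2; lia.
  have [z] := @signed_oee s p t ltac:(lia) ltac:(lia); move/int_sign.
  by rewrite pE tE -!doubleS /= !doubleK.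
Qed.
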